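(* Let $t_0>0$, let $F\in C_b^3(W,\mathcal L(U,W))$, $F_0\in C_b^1(W,W)$, let $\phi$ be the solution cocycle of $dY_t=F(Y_t)\,d\mathbf Z_t(\omega)+F_0(Y_t)\,dt$ driven by an $\mathbf X$-controlled rough path cocycle $\mathbf Z$, and let $Y:\Omega\to W\times\mathcal L(V,W)$ be its stationary point. Assume that $$\|\mathbf X(\omega)\|_{\alpha,[0,t_0]},\ \|\mathbf Z(\omega)\|_{\mathcal C^\alpha_{\mathbf X(\omega)}([0,t_0])}\in\bigcap_{p\ge1}L^p(\Omega),\qquad Y\in\bigcap_{p\ge1}L^p(\Omega;W\times\mathcal L(V,W)).$$ With $\psi_t^\omega:=D_{Y_\omega}\phi_t^\omega$, one has $$M_{\mathrm{lin}}(\omega):=\sup_{0\le t\le t_0}\log^+\|\psi_t^\omega\|+\sup_{0\le t\le t_0}\log^+\|(\psi_t^\omega)^{-1}\|\in L^1(\Omega).$$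
   Context: $U,V,W$ are finite-dimensional Banach spaces, $\alpha\in(1/3,1/2]$, $X_{s,t}:=X_t-X_s$, $\log^+x=\max\{\log x,0\}$. $C_b^k$: $k$-times continuously differentiable maps with bounded derivatives up to order $k$. $(\Omega,\mathcal F,\mathbb P,\{\theta_t\}_{t\in\mathbb R})$ is an invertible measure-preserving dynamical system (jointly measurable group of $\mathbb P$-preserving maps). Rough path on an interval $I$: $\mathbf X=(X,\mathbb X)$, $X$ $V$-valued, $\mathbb X$ $V\otimes V$-valued, $\mathbb X_{s,t}=\mathbb X_{s,u}+\mathbb X_{u,t}+X_{s,u}\otimes X_{u,t}$, $\|\mathbf X\|_{\alpha,I}:=\max\{\|X\|_{\alpha,I},\|\mathbb X\|_{2\alpha,I}^{1/2}\}<\infty$. $\mathbf X$-controlled path: $\mathbf Z=(Z,Z')$ with $R^Z_{s,t}:=Z_{s,t}-Z'_sX_{s,t}$ and $\|\mathbf Z\|_{\mathcal C^\alpha_{\mathbf X}(I)}:=\max\{\|Z\|_{\infty,I},\|Z'\|_{\infty,I},\|R^Z\|_{2\alpha,I},\|Z'\|_{\alpha,I}\}<\infty$. On $\mathbb R$ these are required on every compact interval. Rough path cocycle: random process $\mathbf X$ of rough paths on $\mathbb R$ with $X_{s,s+t}(\omega)=X_{0,t}(\theta_s\omega)$, $\mathbb X_{s,s+t}(\omega)=\mathbb X_{0,t}(\theta_s\omega)$ ($s\in\mathbb R,t\ge0$). $\mathbf X$-controlled rough path cocycle: random process $\mathbf Z=(Z,Z')$ with values in $U\times\mathcal L(V,U)$,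 $\mathbf Z(\omega)$ being $\mathbf X(\omega)$-controlled, $Z_{s,s+t}(\omega)=Z_{0,t}(\theta_s\omega)$, $Z'_{s+t}(\omega)=Z'_t(\theta_s\omega)$. Solution cocycle: for $y\in W$ let $(Y,Y')$ be the unique $\mathbf X(\omega)$-controlled path on $\mathbb R$ with $Y_t=y+\int_0^tF(Y_r)\,d\mathbf Z_r(\omega)+\int_0^tF_0(Y_r)\,dr$, $Y'_t=F(Y_t)Z'_t(\omega)$, where $\int F(Y)\,d\mathbf Z:=\lim\sum_{[u,v]}(F(Y_u)Z_{u,v}+DF(Y_u)Y'_uZ'_u\mathbb X_{u,v})$. Put $\phi_t^\omega(y):=(Y_t,Y'_t)$; $y$ is associated with the state $(y,F(y)Z'_0(\omega))$, and for $(y,y')\in W\times\mathcal L(V,W)$, $\phi_t^\omega(y,y'):=\phi_t^\omega(y)$. As a standing assumption, $\phi_t^\omega$ is of class $C^1$. Stationary point (standing): a measurable $Y:\Omega\to W\times\mathcal L(V,W)$, $\omega\mapsto Y_\omega$, with $\phi_t^\omega(Y_\omega)=Y_{\theta_t\omega}$ for $t\ge0$, obtained as the pull-back limit $Y_\omega=\lim_{t\to\infty}\phi_t^{\theta_{-t}\omega}(\mathbf Y_0(\omega))$, independent of the initial condition $\mathbf Y_0$. Inverse: $(\psi_t^\omega)^{-1}:=D_{\phi_t^\omega(Y_\omega)}\phi_{-t}^{\theta_t\omega}$. *)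

(* Defs.v *)
From HB Require Import structures.
From mathcomp Require Import all_boot all_order all_algebra.
From mathcomp Require Import all_classical all_reals all_analysis.
From mathcomp Require Import measurable_realfun.

Set Implicit Arguments.
Unset Strict Implicit.
Unset Printing Implicit Defensive.
Import Order.TTheory GRing.Theory Num.Theory.
Import numFieldNormedType.Exports.

Local Open Scope classical_set_scope.
Local Open Scope ring_scope.

Reserved Notation "''L' ( V , W )" (at level 0, format "''L' ( V ,  W )").

Section ContinuousLinear.
Context {R : realType} (V W : normedModType R).

Definition clin_pred : {pred V -> W} :=
  mem [set f : V -> W | linear f /\ continuous f].

Record clin := CLin { clin_fun :> V -> W ; clin_funP : clin_fun \in clin_pred }.

HB.instance Definition _ := [isSub for clin_fun].
HB.instance Definition _ := [Choice of clin by <:].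

Lemma clin_submod_closed : submod_closed clin_pred.
Proof.
split; first rewrite inE; first split=> /=.
- by move=> a x y; rewrite scaler0 addr0.
- exact: cst_continuous.
move=> a f g; rewrite !inE => -[lf cf] [lg cg]; split=> /=.
  move=> b x y; rewrite !fctE lf lg !scalerDr !scalerA (mulrC a) !addrA.
  by congr (_ + _); rewrite -!addrA; congr (_ + _); rewrite addrC.
move=> x; apply: cvgD; last exact: cg.
by apply: cvgZr; exact: cf.
Qed.

HB.instance Definition _ :=
  GRing.isSubmodClosed.Build R (V -> W) clin_pred clin_submod_closed.
HB.instance Definition _ := [SubChoice_isSubLmodule of clin by <:].

Lemma clin_linear (f : clin) : linear (f : V -> W).
Proof. by have := clin_funP f; rewrite inE => -[]. Qed.

HB.instance Definition _ (f : clin) :=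
  GRing.isLinear.Build R V W _ (f : V -> W) (@clin_linear f).

Lemma clin_continuous (f : clin) : continuous (f : V -> W).
Proof. by have := clin_funP f; rewrite inE => -[]. Qed.

Lemma clinP (f g : clin) : (forall x, f x = g x) -> f = g.
Proof. by move=> fg; apply/val_inj/funext. Qed.

Lemma clin_addE (f g : clin) x : (f + g) x = f x + g x.
Proof. by []. Qed.

Lemma clin_scaleE a (f : clin) x : (a *: f) x = a *: f x.
Proof. by []. Qed.

Definition opnorm (f : clin) : R :=
  sup [set `|f x| | x in [set x : V | `|x| <= 1]].

Lemma clin_bounded (f : clin) : exists2 r : R, 0 < r &
  forall x, `|f x| <= r * `|x|.
Proof.
have : bounded_near (f : V -> W) (nbhs 0).
  by apply/linear_bounded_continuous; exact: clin_continuous.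
by move=> /linear_boundedP/pinfty_ex_gt0.
Qed.

Lemma opnorm_has_sup (f : clin) :
  has_sup [set `|f x| | x in [set x : V | `|x| <= 1]].
Proof.
split; first by exists `|f 0|; exists 0 => //=; rewrite normr0.
have [r r0 fr] := clin_bounded f.
exists r => _ [x /= x1 <-]; apply: (le_trans (fr x)).
by rewrite ler_piMr// ltW.
Qed.

Lemma opnorm_ge0 (f : clin) : 0 <= opnorm f.
Proof.
rewrite (le_trans (normr_ge0 (f 0)))//; apply: ub_le_sup.
  by have [] := opnorm_has_sup f.
by exists 0 => //=; rewrite normr0.
Qed.

Lemma opnormP (f : clin) (x : V) : `|f x| <= opnorm f * `|x|.
Proof.
have [->|x0] := eqVneq x 0; first by rewrite linear0 !normr0 mulr0.
have nx : 0 < `|x| by rewrite normr_gt0.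
have : `|f (`|x|^-1 *: x)| <= opnorm f.
  apply: ub_le_sup; first by have [] := opnorm_has_sup f.
  exists (`|x|^-1 *: x) => //=.
  by rewrite normrZ normfV normr_id mulVf// gt_eqF.
by rewrite linearZ/= normrZ normfV normr_id ler_pdivrMl// mulrC.
Qed.

Lemma opnorm_le (f : clin) (M : R) : 0 <= M ->
  (forall x, `|f x| <= M * `|x|) -> opnorm f <= M.
Proof.
move=> M0 fM; apply: ge_sup; first by have [] := opnorm_has_sup f.
by move=> _ [x /= x1 <-]; rewrite (le_trans (fM x))// ler_piMr.
Qed.

Lemma opnormD (f g : clin) : opnorm (f + g) <= opnorm f + opnorm g.
Proof.
apply: opnorm_le => [|x]; first by rewrite addr_ge0 ?opnorm_ge0.
by rewrite mulrDl (le_trans (ler_normD _ _))// lerD// opnormP.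
Qed.

Lemma opnormZ_le (a : R) (f : clin) : opnorm (a *: f) <= `|a| * opnorm f.
Proof.
apply: opnorm_le => [|x]; first by rewrite mulr_ge0 ?opnorm_ge0.
rewrite (_ : (a *: f) x = a *: f x)// normrZ -mulrA.
by rewrite ler_wpM2l// opnormP.
Qed.

Lemma opnormZ (a : R) (f : clin) : opnorm (a *: f) = `|a| * opnorm f.
Proof.
apply/eqP; rewrite eq_le opnormZ_le/=.
have [->|a0] := eqVneq a 0; first by rewrite normr0 mul0r opnorm_ge0.
have := opnormZ_le a^-1 (a *: f).
by rewrite scalerA mulVf// scale1r normfV ler_pdivlMl// normr_gt0.
Qed.

Lemma opnorm0_eq0 (f : clin) : opnorm f = 0 -> f = 0.
Proof.
move=> f0; apply: clinP => x; apply/eqP.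
by rewrite -normr_le0 (le_trans (opnormP f x))// f0 mul0r.
Qed.

HB.instance Definition _ :=
  Lmodule_isNormed.Build R clin opnormD opnormZ opnorm0_eq0.

Lemma clin_normE (f : clin) :
  `|f| = sup [set `|f x| | x in [set x : V | `|x| <= 1]].
Proof. by []. Qed.

End ContinuousLinear.

Notation "''L' ( V , W )" := (clin V%type W%type) : type_scope.

Section ClinOperations.
Context {R : realType}.

Lemma clin_comp_subproof (U V W : normedModType R) (g : 'L(V, W)) (f : 'L(U, V)) :
  (fun x => g (f x)) \in @clin_pred R U W.
Proof.
rewrite inE; split=> /=; first by move=> a x y; rewrite !linearP.
by move=> x; apply: continuous_comp; exact: clin_continuous.
Qed.

Definition clin_comp (U V W : normedModType R) (g : 'L(V, W)) (f : 'L(U, V)) :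
  'L(U, W) := CLin (clin_comp_subproof g f).

(** ['d f x] as an element of the normed space [ 'L(V, E) ]; it is meaningful
    only where [f] is differentiable. *)
Definition Dtot (V E : normedModType R) (f : V -> E) (x : V) : 'L(V, E) :=
  insubd (0 : 'L(V, E)) ('d f x : V -> E).

Lemma DtotE (V E : normedModType R) (f : V -> E) (x : V) :
  differentiable f x -> Dtot f x = 'd f x :> (V -> E).
Proof.
move=> fx; rewrite /Dtot /insubd insubT//= inE; split; first exact: linearP.
exact: diff_continuous.
Qed.

Definition class_C1 (V E : normedModType R) (f : V -> E) : Prop :=
  (forall x, differentiable f x) /\ continuous (Dtot f).

(** The bound is required for the derivatives of every order from [0], that is
    for [f] itself, up to [k]. *)
Fixpoint class_Cb (k : nat) (V E : normedModType R) (f : V -> E) : Prop :=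
  (exists M : R, forall x, `|f x| <= M) /\
  match k with
  | 0 => continuous f
  | k'.+1 => (forall x, differentiable f x) /\ class_Cb k' (Dtot f)
  end.

Definition finite_dimensional (E : normedModType R) : Prop :=
  exists (n : nat) (e : 'I_n -> E),
    forall x, exists c : 'I_n -> R, x = \sum_(i < n) c i *: e i.

End ClinOperations.

(** For finite-dimensional [V], [V (x) V] is the dual of the space of bilinear
    forms on [V], with [v (x) w] acting by evaluation at [(v, w)]; the operator
    norm is then the projective tensor norm. *)

Section TensorSquare.
Context {R : realType}.

Definition tensor2 (V : normedModType R) := 'L('L(V, 'L(V, R^o)), R^o).

Lemma tens_subproof (V : normedModType R) (v w : V) :
  (fun B : 'L(V, 'L(V, R^o)) => B v w) \in @clin_pred R 'L(V, 'L(V, R^o)) R^o.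
Proof.
have lin : linear (fun B : 'L(V, 'L(V, R^o)) => B v w).
  by move=> a f g; rewrite clin_addE clin_scaleE.
rewrite inE; split=> //=.
pose ev : {linear 'L(V, 'L(V, R^o)) -> R^o} :=
  HB.pack (fun B : 'L(V, 'L(V, R^o)) => B v w)
    (GRing.isLinear.Build R 'L(V, 'L(V, R^o)) R^o _ _ lin).
apply: (@bounded_linear_continuous _ _ _ ev).
apply/linear_boundedP; near=> r => B /=.
rewrite (le_trans (opnormP (B v) w))//.
rewrite (@le_trans _ _ ((`|v| * `|w|) * `|B|))//; last first.
  by rewrite ler_wpM2r//; near: r; exact: nbhs_pinfty_ge.
rewrite mulrAC ler_wpM2r// [leRHS]mulrC; exact: (opnormP B v).
Unshelve. all: by end_near. Qed.

Definition tens (V : normedModType R) (v w : V) : tensor2 V :=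
  CLin (tens_subproof v w).

(** Meaningful for bilinear [b] and finite-dimensional [V]. *)
Definition tensor_lift (V E : normedModType R) (b : V -> V -> E) :
  'L(tensor2 V, E) :=
  get [set l : 'L(tensor2 V, E) | forall v w, l (tens v w) = b v w].

End TensorSquare.

Section RoughPaths.
Context {R : realType}.

Definition incr (E : normedModType R) (f : R -> E) (s t : R) : E := f t - f s.

Definition sup_norm (E : normedModType R) (f : R -> E) (a b : R) : \bar R :=
  ereal_sup [set `|f t|%:E | t in `[a, b]].

Definition holder_norm (E : normedModType R) (beta : R) (G : R -> R -> E)
    (a b : R) : \bar R :=
  ereal_sup [set z | exists s t : R, [/\ a <= s, s < t, t <= b &
    z = (`|G s t| / (t - s) `^ beta)%:E]].

Definition rough_norm (V : normedModType R) (alpha : R) (X : R -> V)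
    (XX : R -> R -> tensor2 V) (a b : R) : \bar R :=
  maxe (holder_norm alpha (incr X) a b)
       (holder_norm (2 * alpha) XX a b `^ 2^-1)%E.

(** Only the values [XX s t] with [s <= t] are relevant. *)
Definition rough_path (V : normedModType R) (alpha : R) (X : R -> V)
    (XX : R -> R -> tensor2 V) : Prop :=
  (forall s u t, s <= u -> u <= t ->
     XX s t = XX s u + XX u t + tens (incr X s u) (incr X u t)) /\
  (forall a b, a < b -> (rough_norm alpha X XX a b < +oo)%E).

Definition remainder (V E : normedModType R) (X : R -> V) (Z : R -> E)
    (Z' : R -> 'L(V, E)) (s t : R) : E :=
  incr Z s t - Z' s (incr X s t).

Definition controlled_norm (V E : normedModType R) (alpha : R) (X : R -> V)
    (Z : R -> E) (Z' : R -> 'L(V, E)) (a b : R) : \bar R :=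
  maxe (maxe (sup_norm Z a b) (sup_norm Z' a b))
       (maxe (holder_norm (2 * alpha) (remainder X Z Z') a b)
             (holder_norm alpha (incr Z') a b)).

Definition controlled_path (V E : normedModType R) (alpha : R) (X : R -> V)
    (Z : R -> E) (Z' : R -> 'L(V, E)) : Prop :=
  forall a b, a < b -> (controlled_norm alpha X Z Z' a b < +oo)%E.

End RoughPaths.

Section Integrals.
Context {R : realType}.

(** [a :: s] lists the points of the partition, as in [itv_partition a b s]. *)
Definition partition_sum (E : normedModType R) (G : R -> R -> E) (a : R)
    (s : seq R) : E :=
  \sum_(0 <= i < size s) G (nth a (a :: s) i) (nth a (a :: s) i.+1).

Definition mesh (a : R) (s : seq R) : R :=
  \big[Num.max/0]_(0 <= i < size s) (nth a (a :: s) i.+1 - nth a (a :: s) i).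

Definition is_partition_limit (E : normedModType R) (G : R -> R -> E)
    (a b : R) (l : E) : Prop :=
  forall e : R, 0 < e -> exists2 d : R, 0 < d &
    forall s, itv_partition a b s -> mesh a s < d ->
      `|partition_sum G a s - l| < e.

Definition is_integral_from0 (E : normedModType R) (G : R -> R -> E)
    (t : R) (l : E) : Prop :=
  if 0 <= t then is_partition_limit G 0 t l
  else is_partition_limit G t 0 (- l).

Definition rough_germ (U V W : normedModType R) (F : W -> 'L(U, W))
    (XX : R -> R -> tensor2 V) (Z : R -> U) (Z' : R -> 'L(V, U))
    (Y : R -> W) (Y' : R -> 'L(V, W)) (u v : R) : W :=
  F (Y u) (incr Z u v) +
  tensor_lift (fun v1 v2 : V => Dtot F (Y u) (Y' u v1) (Z' u v2)) (XX u v).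

Definition drift_germ (W : normedModType R) (F0 : W -> W) (Y : R -> W)
    (u v : R) : W :=
  (v - u) *: F0 (Y u).

Definition is_solution (U V W : normedModType R) (alpha : R)
    (F : W -> 'L(U, W)) (F0 : W -> W)
    (X : R -> V) (XX : R -> R -> tensor2 V) (Z : R -> U) (Z' : R -> 'L(V, U))
    (y : W) (Y : R -> W) (Y' : R -> 'L(V, W)) : Prop :=
  controlled_path alpha X Y Y' /\
  (forall t, exists I J : W,
    [/\ is_integral_from0 (rough_germ F XX Z Z' Y Y') t I,
        is_integral_from0 (drift_germ F0 Y) t J
      & Y t = y + I + J]) /\
  (forall t, Y' t = clin_comp (F (Y t)) (Z' t)).

End Integrals.

Section Random.
Context {R : realType} {d : measure_display} {Omega : measurableType d}.

Definition borel_measurable (E : normedModType R) (f : Omega -> E) : Prop :=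
  measurable_fun [set: Omega] (f : Omega -> g_sigma_algebraType (@open E)).

Definition in_all_Lp (P : probability Omega R) (f : Omega -> \bar R) : Prop :=
  measurable_fun [set: Omega] f /\
  forall p : R, 1 <= p -> ('N[P]_(p%:E)[f] < +oo)%E.

Definition measure_preserving_flow (P : probability Omega R) (theta : R -> Omega -> Omega) :
    Prop :=
  [/\ measurable_fun [set: measurableTypeR R * Omega]
        (fun p : measurableTypeR R * Omega => theta p.1 p.2),
      forall w, theta 0 w = w,
      forall s t w, theta (s + t) w = theta s (theta t w)
    & forall t (A : set Omega), measurable A -> P (theta t @^-1` A) = P A].

Definition rough_path_cocycle (V : normedModType R) (alpha : R)
    (theta : R -> Omega -> Omega)
    (X : Omega -> R -> V) (XX : Omega -> R -> R -> tensor2 V) : Prop :=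
  [/\ (forall t, borel_measurable (fun w => X w t)),
      (forall s t, s <= t -> borel_measurable (fun w => XX w s t)),
      (forall w, rough_path alpha (X w) (XX w))
    & forall w s t, 0 <= t ->
        incr (X w) s (s + t) = incr (X (theta s w)) 0 t /\
        XX w s (s + t) = XX (theta s w) 0 t].

Definition controlled_cocycle (U V : normedModType R) (alpha : R)
    (theta : R -> Omega -> Omega) (X : Omega -> R -> V)
    (Z : Omega -> R -> U) (Z' : Omega -> R -> 'L(V, U)) : Prop :=
  [/\ (forall t, borel_measurable (fun w => Z w t)),
      (forall t, borel_measurable (fun w => Z' w t)),
      (forall w, controlled_path alpha (X w) (Z w) (Z' w))
    & forall w s t, 0 <= t ->
        incr (Z w) s (s + t) = incr (Z (theta s w)) 0 t /\
        Z' w (s + t) = Z' (theta s w) t].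

Definition is_solution_cocycle (U V W : normedModType R) (alpha : R)
    (F : W -> 'L(U, W)) (F0 : W -> W)
    (X : Omega -> R -> V) (XX : Omega -> R -> R -> tensor2 V)
    (Z : Omega -> R -> U) (Z' : Omega -> R -> 'L(V, U))
    (phi : R -> Omega -> W -> W * 'L(V, W)) : Prop :=
  forall w y,
    is_solution alpha F F0 (X w) (XX w) (Z w) (Z' w) y
      (fun t => (phi t w y).1) (fun t => (phi t w y).2) /\
    (forall (Y : R -> W) (Y' : R -> 'L(V, W)),
      is_solution alpha F F0 (X w) (XX w) (Z w) (Z' w) y Y Y' ->
      forall t, phi t w y = (Y t, Y' t)).

Section States.
Context {V W : normedModType R}.
Implicit Types (phi : R -> Omega -> W -> W * 'L(V, W))
  (theta : R -> Omega -> Omega) (Y : Omega -> W * 'L(V, W)).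

Definition on_states phi (t : R) (w : Omega) (p : W * 'L(V, W)) :
    W * 'L(V, W) :=
  phi t w p.1.

Definition is_stationary_point theta phi Y : Prop :=
  [/\ borel_measurable Y,
      (forall w t, 0 <= t -> on_states phi t w (Y w) = Y (theta t w))
    & forall Y0 : Omega -> W * 'L(V, W), borel_measurable Y0 ->
        forall w, on_states phi t (theta (- t) w) (Y0 w) @[t --> +oo] --> Y w].

Definition psi phi Y (t : R) (w : Omega) : 'L(W * 'L(V, W), W * 'L(V, W)) :=
  Dtot (on_states phi t w) (Y w).

(** A derivative along the backward flow, not an algebraic inverse: [psi] is
    in general not injective, as [on_states] ignores the second component. *)
Definition psi_inv theta phi Y (t : R) (w : Omega) :
    'L(W * 'L(V, W), W * 'L(V, W)) :=
  Dtot (on_states phi (- t) (theta t w)) (on_states phi t w (Y w)).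

Definition logp (x : R) : R := Num.max (ln x) 0.

Definition M_lin theta phi Y (t0 : R) (w : Omega) : \bar R :=
  (ereal_sup [set (logp `|psi phi Y t w|)%:E | t in `[0%R, t0]] +
   ereal_sup [set (logp `|psi_inv theta phi Y t w|)%:E | t in `[0%R, t0]])%E.

End States.

End Random.

(* Main.v *)
Require Import Defs.
From HB Require Import structures.
From mathcomp Require Import all_boot all_order all_algebra.
From mathcomp Require Import all_classical all_reals all_analysis.
From mathcomp Require Import measurable_realfun.
From mathcomp Require Import ring lra.
Import Order.TTheory GRing.Theory Num.Theory.
Import numFieldNormedType.Exports.
Set Implicit Arguments.
Unset Strict Implicit.
Unset Printing Implicit Defensive.
Local Open Scope classical_set_scope.
Local Open Scope ring_scope.

(** The quantity [M_lin w] is bounded, for each [w], by a polynomial in the norms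
    of the driving path on [[0, t0]], and these norms have moments of all
    orders. The other half of the proof is the measurability of [M_lin].

    _Reduction to the flow._ A state acts only through its first component, so
    let [flow t w] be the map from the initial value in [W] to the first
    component of the solution at time [t]. By the chain rule [psi t w] sends
    [v] to [A v.1] together with [(DF (A v.1)) Z'], where [A] is the derivative
    of [flow t w], and [psi_inv t w] has the same form with the inverse of [A].
    The derivative of an [L]-Lipschitz map has norm at most [L], so it is enough
    to find Lipschitz constants of the flow and of the backward flow whose
    logarithm grows polynomially ([M_lin_bound]).

    _Lipschitz constants._ Let [K] dominate the norms of the driver, those of
    the vector fields and their derivatives, and the constant of the sewing
    lemma. Along a solution the defect of additivity of the germ of the rough
    integral is of order [3 alpha > 1], so that the integral is close to its
    germ ([sewing_estimate]). On an interval of length at most [K ^- 120] this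
    bounds the remainder of a solution by [K ^+ 9] ([rem_apriori]), linearly in
    the unknown because the derivatives of [F] are bounded. The same argument
    applied to the difference of two solutions bounds its remainder by a power
    of [K] times its supremum ([diff_rem]). Hence on such an interval the
    distance of two solutions is at most twice its value at an arbitrary point
    ([local_lipschitz]): time can be run in both directions, and covering
    [[0, t0]] by about [t0 * K ^+ 120] intervals gives the constant
    [2 ^+ N] with [N] of that size ([global_lipschitz]). In particular solutions
    are unique and the flow is invertible ([flowK]).

    _Measurability._ The flow is the limit of a Milstein scheme, which is
    visibly measurable, even from a random starting point; the convergence
    follows from the local error [K ^+ 32 * om h ^+ 3] and the Lipschitz bound
    ([scheme_cvg]). The derivative of the flow is a limit of difference
    quotients, hence measurable as well. The supremum over all times is
    reduced to rational ones because the difference quotients, and therefore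
    the derivative, are Hoelder continuous in time, uniformly ([dflow_incr]).
    For the inverse, the condition [`|A^-1 v| <= c * `|v|] is
    written [`|u| <= c * `|A u|] ([psi_inv_le]). Both conditions are thus
    countable intersections over rational times and over a dense sequence of
    vectors. *)

(** * Identities in abelian groups *)

(** Syntax of the identities decided by [abelian]; variables are indices in
    an environment. *)
Inductive zexpr := ZVar of nat | ZZero | ZAdd of zexpr & zexpr | ZOpp of zexpr.

Fixpoint zeval (V : zmodType) (env : seq V) (e : zexpr) : V :=
  match e with
  | ZVar i => nth 0 env i
  | ZZero => 0
  | ZAdd a b => zeval env a + zeval env b
  | ZOpp a => - zeval env a
  end.

Fixpoint zcoef (e : zexpr) (i : nat) : int :=
  match e with
  | ZVar j => (i == j)%:Z
  | ZZero => 0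
  | ZAdd a b => zcoef a i + zcoef b i
  | ZOpp a => - zcoef a i
  end.

Lemma zeval_coef (V : zmodType) (env : seq V) e :
  zeval env e = \sum_(i < size env) env`_i *~ zcoef e i.
Proof.
elim: e => [j||a IHa b IHb|a IHa] /=.
- have [jn|nj] := ltnP j (size env).
    rewrite (bigD1 (Ordinal jn))//= eqxx big1 ?addr0// => i ij.
    by case: eqP => // iE; move: ij; rewrite -val_eqE /= iE eqxx.
  rewrite nth_default// big1// => i _; case: eqP => // iE.
  by have := ltn_ord i; rewrite iE ltnNge nj.
- by rewrite big1.
- by rewrite IHa IHb -big_split/=; apply: eq_bigr => i _; rewrite mulrzDr.
- by rewrite IHa -sumrN; apply: eq_bigr => i _; rewrite mulrNz.
Qed.

Lemma zexpr_eq (V : zmodType) (env : seq V) a b :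
  all (fun i => zcoef a i == zcoef b i) (iota 0 (size env)) ->
  zeval env a = zeval env b.
Proof.
move=> /allP ab; rewrite !zeval_coef; apply: eq_bigr => i _; congr (_ *~ _).
by apply/eqP/ab; rewrite mem_iota ltn_ord.
Qed.

Ltac zmem x env :=
  lazymatch env with
  | nil => constr:(false)
  | ?y :: ?s => match constr:(Set) with
                | _ => let _ := match constr:(Set) with _ => constr_eq x y end in
                       constr:(true)
                | _ => zmem x s
                end
  end.
Ltac zidx x env :=
  lazymatch env with
  | ?y :: ?s => match constr:(Set) with
                | _ => let _ := match constr:(Set) with _ => constr_eq x y end in
                       constr:(O)
                | _ => let n := zidx x s in constr:(S n)
                end
  end.
Ltac zvars t env :=
  lazymatch t with
  | (?a + ?b)%R => let e := zvars a env in zvars b e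
  | (- ?a)%R => zvars a env
  | 0%R => env
  | _ => let m := zmem t env in
         lazymatch m with true => env | false => constr:(t :: env) end
  end.
Ltac zquote t env :=
  lazymatch t with
  | (?a + ?b)%R => let x := zquote a env in let y := zquote b env in
                   constr:(ZAdd x y)
  | (- ?a)%R => let x := zquote a env in constr:(ZOpp x)
  | 0%R => constr:(ZZero)
  | _ => let n := zidx t env in constr:(ZVar n)
  end.

(** Decides equalities in abelian groups, by reflection. *)
Ltac abelian :=
  lazymatch goal with
  | |- @eq ?T ?l ?r =>
    let e0 := zvars l (@nil T) in
    let env := zvars r e0 in
    let a := zquote l env in
    let b := zquote r env in
    exact: (@zexpr_eq _ env a b erefl)
  end.

Ltac by_ring := rewrite le_eqVlt; apply/orP; left; apply/eqP; ring.

(** * Mean value and Taylor estimates *)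

Lemma clin_subE (R : realType) (V W : normedModType R) (f g : 'L(V, W)) x :
  (f - g) x = f x - g x.
Proof. by []. Qed.

Lemma clin_appB (R : realType) (V W : normedModType R) (f : 'L(V, W)) x y :
  f (x - y) = f x - f y.
Proof. exact: raddfB. Qed.

Section MeanValue.
Context {R : realType}.

(** Slope estimates propagate along [0, 1]: the set of [t] up to which the
    estimate holds is closed, and open to the right. *)
Lemma pointwise_slope_bound (E : normedModType R) (g : R -> E) (C : R) :
  (forall s, 0 <= s <= 1 -> exists2 e, 0 < e &
     forall u, `|u - s| < e -> `|g u - g s| <= C * `|u - s|) ->
  `|g 1 - g 0| <= C.
Proof.
move=> slope.
pose A := [set t | 0 <= t <= 1 /\
  forall s, 0 <= s <= t -> `|g s - g 0| <= C * s].
have A0 : A 0.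
  split; first by rewrite lexx ler01.
  move=> s /andP[s0 s0']; have -> : s = 0 by apply/le_anti; rewrite s0 s0'.
  by rewrite subrr normr0 mulr0.
have hsA : has_sup A.
  split; first by exists 0.
  by exists 1 => t [/andP[]].
set c := sup A.
have c0 : 0 <= c by apply: ub_le_sup => //; case: hsA.
have c1 : c <= 1 by apply: ge_sup => [|t [/andP[]]//]; exists 0.
have below s : 0 <= s -> s < c -> `|g s - g 0| <= C * s.
  move=> s0 sc.
  have [t At st] : exists2 t, A t & s < t.
    by apply: sup_gt => //; case: hsA.
  by apply: At.2; rewrite s0 ltW.
have [e e0 He] := slope c (introT andP (conj c0 c1)).
have atc : `|g c - g 0| <= C * c.
  have [c_eq0|c_neq0] := eqVneq c 0.
    by rewrite c_eq0 subrr normr0 mulr0.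
  have cgt0 : 0 < c by rewrite lt_def c_neq0.
  pose s := Num.max 0 (c - e / 2).
  have sc : s < c by rewrite /s gt_max cgt0 ltrBlDr ltrDl divr_gt0.
  have s0 : 0 <= s by rewrite /s le_max lexx.
  have sce : `|s - c| < e.
    rewrite distrC gtr0_norm ?subr_gt0// ltrBlDl -ltrBlDr.
    rewrite (@lt_le_trans _ _ (c - e / 2))//; last by rewrite /s le_max lexx orbT.
    by rewrite ltrD2l ltrN2 gtr_pMr// invf_lt1// ltr1n.
  have -> : g c - g 0 = (g c - g s) + (g s - g 0) by rewrite addrA subrK.
  rewrite (le_trans (ler_normD _ _))//.
  have := He _ sce; rewrite distrC [`|s - c|]distrC gtr0_norm ?subr_gt0// => H1.
  rewrite (le_trans (lerD H1 (below _ s0 sc)))//.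
  by rewrite -mulrDr subrK.
have Ac : A c.
  split; first by rewrite c0.
  move=> s /andP[s0]; rewrite le_eqVlt => /predU1P[->//|]; exact: below.
have [c_eq1|c_neq1] := eqVneq c 1.
  by have := atc; rewrite c_eq1 mulr1.
have clt1 : c < 1 by rewrite lt_neqAle c_neq1.
pose t := Num.min 1 (c + e / 2).
have ct : c < t by rewrite /t lt_min clt1 ltrDl divr_gt0.
suff At : A t.
  have : t <= c by apply: ub_le_sup => //; case: hsA.
  by rewrite leNgt ct.
split; first by rewrite (le_trans c0 (ltW ct)) /t ge_min lexx.
move=> s /andP[s0 st].
have [sc|cs] := leP s c; first by apply: Ac.2; rewrite s0.
have -> : g s - g 0 = (g s - g c) + (g c - g 0) by rewrite addrA subrK.
rewrite (le_trans (ler_normD _ _))//.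
have : `|s - c| < e.
  rewrite gtr0_norm ?subr_gt0// ltrBlDl (le_lt_trans st)//.
  rewrite (@le_lt_trans _ _ (c + e / 2))//; first by rewrite /t ge_min lexx orbT.
  by rewrite ltrD2l gtr_pMr// invf_lt1// ltr1n.
move=> /He; rewrite gtr0_norm ?subr_gt0// => H1.
by rewrite (le_trans (lerD H1 atc))// -mulrDr subrK.
Qed.

Lemma is_derive_slope (E : normedModType R) (g : R -> E) (s : R) (dg : E) :
  is_derive s 1 g dg -> forall e, 0 < e -> exists2 r, 0 < r &
    forall u, `|u - s| < r -> `|g u - g s - (u - s) *: dg| <= e * `|u - s|.
Proof.
move=> [gs <-] e e0.
have /cvgrPdist_le /(_ _ e0) := gs.
rewrite !near_withinE => /nbhs_ballP[r /= r0 Hr]; exists r => // u us.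
have [->|u_neq_s] := eqVneq u s.
  by rewrite !subrr scale0r subr0 !normr0 mulr0.
have us0 : u - s != 0 by rewrite subr_eq0.
have := Hr (u - s); rewrite /ball/= sub0r normrN => /(_ us us0).
rewrite /shift/= [_%:A]mulr1 subrK => H.
rewrite -ler_pdivrMr ?normr_gt0// mulrC -normfV -normrZ scalerBr scalerA.
by rewrite mulVf// scale1r distrC.
Qed.

Lemma mean_value_inequality (E : normedModType R) (g dg : R -> E) (C : R) :
  (forall s : R, is_derive s 1 g (dg s)) ->
  (forall s, 0 <= s <= 1 -> `|dg s| <= C) ->
  `|g 1 - g 0| <= C.
Proof.
move=> gdg dgC; apply/ler_addgt0Pr => e e0.
apply: pointwise_slope_bound => s s01.
have [r r0 Hr] := is_derive_slope (gdg s) e0.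
exists r => // u /Hr H.
rewrite -[g u - g s](subrK ((u - s) *: dg s)) (le_trans (ler_normD _ _))//.
rewrite mulrDl addrC lerD// normrZ mulrC ler_wpM2r//; exact: dgC.
Qed.

Lemma is_derive_line (V E : normedModType R) (f : V -> E) (x h : V) (s : R) :
  differentiable f (x + s *: h) ->
  is_derive s 1 (fun t : R => f (x + t *: h)) (Dtot f (x + s *: h) h).
Proof.
move=> df.
have E1 : (fun t : R => t^-1 *: (((fun t : R => f (x + t *: h)) \o shift s) (t *: 1)
             - f (x + s *: h))) =
    (fun t : R => t^-1 *: ((f \o shift (x + s *: h)) (t *: h) - f (x + s *: h))).
  apply/funext => t /=; congr (_ *: (f _ - _)).
  by rewrite [t%:A]mulr1 scalerDl addrCA.
have D1 : derivable f (x + s *: h) h by exact: diff_derivable.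
split.
  by rewrite /derivable /= E1.
rewrite /derive /= E1 -[lim _]/('D_h f (x + s *: h)) deriveE//.
by rewrite (DtotE df).
Qed.

Lemma is_derive_scale (E : normedModType R) (a : E) (s : R) :
  is_derive s 1 (fun t : R => t *: a) a.
Proof.
have E1 : (fun t : R => t^-1 *: (((fun t : R => t *: a) \o shift s) (t *: 1)
             - s *: a)) @ 0^' --> a.
  apply: cvg_near_cst; rewrite near_withinE; near=> t => t0 /=.
  rewrite [t%:A]mulr1.
  by rewrite scalerDl addrK scalerA mulVf// scale1r.
split; first by apply/cvg_ex; exists a.
by apply: cvg_lim.
Unshelve. all: by end_near. Qed.

Section Taylor.
Context (V E : normedModType R) (f : V -> E).
Hypothesis df : forall x, differentiable f x.

Lemma Dtot_lipschitz (M : R) : (forall x, `|Dtot f x| <= M) ->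
  forall x y, `|f x - f y| <= M * `|x - y|.
Proof.
move=> fM x y.
have := @mean_value_inequality E (fun t => f (y + t *: (x - y)))
  (fun t => Dtot f (y + t *: (x - y)) (x - y)) (M * `|x - y|).
rewrite /= scale1r scale0r addr0 addrCA subrr addr0; apply.
  by move=> s; exact: is_derive_line.
move=> s _; rewrite (le_trans (opnormP _ _))// ler_wpM2r//; exact: fM.
Qed.

Definition taylor1 (x h : V) : E := f (x + h) - f x - Dtot f x h.

(** Difference of the increments of [f] from two base points: the quantity
    that measures how [f] transports the distance of two paths. *)
Definition incr2 (x1 h1 x2 h2 : V) : E :=
  f (x1 + h1) - f x1 - (f (x2 + h2) - f x2).

Lemma taylor1_lipschitz (M : R) : (forall x, `|Dtot f x| <= M) ->
  forall x h, `|taylor1 x h| <= 2 * M * `|h|.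
Proof.
move=> fM x h; rewrite /taylor1 (le_trans (ler_normB _ _))//.
rewrite -mulrA mulr2n [leRHS]mulrDl mul1r lerD//.
  by rewrite (le_trans (Dtot_lipschitz fM _ _))// addrAC subrr add0r.
by rewrite (le_trans (opnormP _ _))// ler_wpM2r//; exact: fM.
Qed.

Lemma taylor1_quadratic (M : R) :
  (forall x y, `|Dtot f x - Dtot f y| <= M * `|x - y|) ->
  forall x h, `|taylor1 x h| <= M * `|h| ^+ 2.
Proof.
move=> fM x h.
have M0 : 0 <= M * `|h|.
  by have := fM (x + h) x; rewrite (addrAC x) subrr add0r; apply: le_trans.
have := @mean_value_inequality E
  ((fun t : R => f (x + t *: h)) - (fun t : R => t *: Dtot f x h))
  (fun t => Dtot f (x + t *: h) h - Dtot f x h) (M * `|h| ^+ 2).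
rewrite !fctE /= !scale1r !scale0r !addr0 subr0 addrAC; apply.
  by move=> s; apply: is_deriveB; [exact: is_derive_line|exact: is_derive_scale].
move=> s /andP[s0 s1]; rewrite -[_ - _]/((Dtot f (x + s *: h) - Dtot f x) h).
rewrite (le_trans (opnormP _ _))// expr2 mulrA ler_wpM2r//.
rewrite (le_trans (fM _ _))// addrAC subrr add0r normrZ ger0_norm//.
by rewrite mulrCA ler_piMl.
Qed.

(** The increment by [h1] has derivative [Dtot f (x + h1) - Dtot f x], of size
    [`|h1|], in its base point; changing [h1] into [h2] costs [`|h1 - h2|]. *)
Lemma incr2_bound (M : R) : (forall x, `|Dtot f x| <= M) ->
  (forall x y, `|Dtot f x - Dtot f y| <= M * `|x - y|) ->
  forall x1 h1 x2 h2,
    `|incr2 x1 h1 x2 h2| <= M * (`|h1| * `|x1 - x2| + `|h1 - h2|).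
Proof.
move=> fM dfM x1 h1 x2 h2.
have -> : incr2 x1 h1 x2 h2 =
    incr2 x1 h1 x2 h1 + (f (x2 + h1) - f (x2 + h2)).
  by rewrite /incr2; abelian.
rewrite (le_trans (ler_normD _ _))// mulrDr lerD//; last first.
  by rewrite (le_trans (Dtot_lipschitz fM _ _))// opprD addrACA subrr add0r.
have := @mean_value_inequality E
  ((fun t : R => f (x2 + h1 + t *: (x1 - x2))) - (fun t => f (x2 + t *: (x1 - x2))))
  (fun t => Dtot f (x2 + h1 + t *: (x1 - x2)) (x1 - x2) -
            Dtot f (x2 + t *: (x1 - x2)) (x1 - x2)) (M * (`|h1| * `|x1 - x2|)).
rewrite !fctE /= !scale1r !scale0r !addr0.
have -> : x2 + h1 + (x1 - x2) = x1 + h1 by rewrite addrAC addrCA subrr addr0.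
have -> : x2 + (x1 - x2) = x1 by rewrite addrCA subrr addr0.
apply.
  by move=> s; apply: is_deriveB; exact: is_derive_line.
move=> s _.
set a := x2 + h1 + _; set b := x2 + _.
rewrite -[_ - _]/((Dtot f a - Dtot f b) (x1 - x2)).
rewrite (le_trans (opnormP _ _))// mulrA ler_wpM2r//.
rewrite (le_trans (dfM _ _))//.
by have -> : a - b = h1 by rewrite /a /b opprD addrACA subrr addr0 addrAC subrr add0r.
Qed.

End Taylor.

(** Both Taylor remainders are followed along the segments issued from [x1]
    and [x2] simultaneously, with the same parameter: the derivative in this
    parameter is made of increments of [Dtot f] only. *)
Lemma taylor1_diff (V E : normedModType R) (f : V -> E) (M : R) :
  (forall x, differentiable f x) ->
  (forall x y, `|Dtot f x - Dtot f y| <= M * `|x - y|) ->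
  (forall x1 h1 x2 h2,
    `|incr2 (Dtot f) x1 h1 x2 h2| <= M * (`|h1| * `|x1 - x2| + `|h1 - h2|)) ->
  forall x1 h1 x2 h2, `|taylor1 f x1 h1 - taylor1 f x2 h2| <=
    M * (`|h1| * `|x1 - x2| + `|h1 - h2|) * `|h1| + M * `|h2| * `|h1 - h2|.
Proof.
move=> df dfM d2M x1 h1 x2 h2.
set C := leRHS.
have := @mean_value_inequality E
  (((fun t : R => f (x1 + t *: h1)) - (fun t : R => t *: Dtot f x1 h1)) -
   ((fun t : R => f (x2 + t *: h2)) - (fun t : R => t *: Dtot f x2 h2)))
  (fun t => (Dtot f (x1 + t *: h1) h1 - Dtot f x1 h1) -
            (Dtot f (x2 + t *: h2) h2 - Dtot f x2 h2)) C.
rewrite !fctE /= !scale1r !scale0r !addr0 !subr0.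
have -> : f (x1 + h1) - Dtot f x1 h1 - (f (x2 + h2) - Dtot f x2 h2) -
   (f x1 - f x2) = taylor1 f x1 h1 - taylor1 f x2 h2.
  by rewrite /taylor1; abelian.
apply.
  move=> s; apply: is_deriveB; apply: is_deriveB;
    by [exact: is_derive_line|exact: is_derive_scale].
move=> s /andP[s0 s1].
have sh (h : V) : `|s *: h| <= `|h| by rewrite normrZ ger0_norm// ler_piMl.
have M0 : forall h : V, 0 <= M * `|h|.
  move=> h; have := dfM (x1 + h) x1; rewrite (addrAC x1) subrr add0r.
  exact: le_trans.
have -> : Dtot f (x1 + s *: h1) h1 - Dtot f x1 h1 -
     (Dtot f (x2 + s *: h2) h2 - Dtot f x2 h2) =
   (incr2 (Dtot f) x1 (s *: h1) x2 (s *: h2)) h1 +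
   (Dtot f (x2 + s *: h2) - Dtot f x2) (h1 - h2).
  rewrite /incr2 !clin_subE !clin_appB; abelian.
rewrite (le_trans (ler_normD _ _))// /C lerD//.
  rewrite (le_trans (opnormP _ _))// ler_wpM2r// (le_trans (d2M _ _ _ _))//.
  rewrite -scalerBr !mulrDr lerD//.
    by rewrite mulrA [leRHS]mulrA ler_wpM2r// normrZ ger0_norm// mulrCA ler_piMl.
  rewrite normrZ ger0_norm// mulrCA ler_piMl//.
rewrite (le_trans (opnormP _ _))// ler_wpM2r// (le_trans (dfM _ _))//.
rewrite addrAC subrr add0r normrZ ger0_norm// mulrCA ler_piMl//.
Qed.

End MeanValue.

(** * Finite-dimensional spaces and tensors *)

Section FiniteDimension.
Context {R : realType}.

Lemma clin_sumE (A B : normedModType R) (I : finType) (G : I -> 'L(A, B)) x :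
  (\sum_i G i) x = \sum_i G i x.
Proof. exact: (@big_morph _ _ (fun h : 'L(A, B) => h x) 0 +%R 0 +%R). Qed.

Lemma clin_appZ (A B : normedModType R) (h : 'L(A, B)) a x : h (a *: x) = a *: h x.
Proof. exact: linearZ. Qed.

Lemma clin_appsum (A B : normedModType R) (I : finType) (h : 'L(A, B)) (x : I -> A) :
  h (\sum_i x i) = \sum_i h (x i).
Proof. exact: raddf_sum. Qed.

Lemma clin_pred_bounded (V W : normedModType R) (f : V -> W) (M : R) :
  linear f -> (forall x, `|f x| <= M * `|x|) -> f \in @clin_pred R V W.
Proof.
move=> lf fM; rewrite inE; split=> //=.
pose g : {linear V -> W} := HB.pack f (GRing.isLinear.Build R V W _ _ lf).
apply: (@bounded_linear_continuous _ _ _ g).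
apply/linear_boundedP; near=> r => x /=.
by rewrite (le_trans (fM x))// ler_wpM2r//; near: r; exact: nbhs_pinfty_ge.
Unshelve. all: by end_near. Qed.

(** A spanning family of minimal size is free: a relation would express one
    of its members through the others. *)
Lemma finite_dimensional_basis (E : normedModType R) : finite_dimensional E ->
  exists (n : nat) (e : 'I_n -> E),
    (forall x, exists c : 'rV[R]_n, x = \sum_(i < n) c 0 i *: e i) /\
    (forall c : 'rV[R]_n, \sum_(i < n) c 0 i *: e i = 0 -> c = 0).
Proof.
move=> fd.
pose spans n := `[< exists e : 'I_n -> E, forall x,
  exists c : 'rV[R]_n, x = \sum_(i < n) c 0 i *: e i >].
have ex_spans : exists n, spans n.
  case: fd => n [e He]; exists n; apply/asboolP; exists e => x.
  have [c cx] := He x; exists (\row_i c i); rewrite cx.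
  by apply: eq_bigr => i _; rewrite mxE.
(* if [c0] is a relation with a nonzero coefficient at [i0], [e i0] can be
   eliminated, which contradicts the minimality of [n] *)
case: (ex_minnP ex_spans) => n /asboolP[e He] nmin.
exists n, e; split=> // c c0; apply/eqP/negP => /negP cn0.
have [i0 ci0] : exists i0, c 0 i0 != 0.
  apply/not_existsP => all0; move: cn0 => /negP; apply; apply/eqP/rowP => i.
  by rewrite mxE; apply/eqP; apply: contra_notT (all0 i).
have n0 : (0 < n)%N by apply: leq_ltn_trans (ltn_ord i0).
case: n e He nmin c c0 cn0 i0 ci0 n0 => // n e He nmin c c0 _ i0 ci0 _.
suff /nmin : spans n by rewrite ltnn.
apply/asboolP; exists (fun i => e (lift i0 i)) => x.
have [b ->] := He x.
exists (\row_i (b 0 (lift i0 i) - b 0 i0 / c 0 i0 * c 0 (lift i0 i))).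
have : e i0 = - (\sum_i ((c 0 i0)^-1 * c 0 (lift i0 i)) *: e (lift i0 i)).
  move: c0; rewrite (bigD1_ord i0)//= => /eqP; rewrite addr_eq0 => /eqP c0.
  rewrite -[LHS]scale1r -(mulVf ci0) -scalerA c0 scalerN scaler_sumr.
  by congr (- _); apply: eq_bigr => i _; rewrite scalerA.
rewrite (bigD1_ord i0)//= => ->.
rewrite scalerN addrC scaler_sumr -sumrB; apply: eq_bigr => i _.
by rewrite mxE scalerBl scalerA mulrA.
Qed.

(** The unit sphere of the coordinate space is compact and its image under the
    coordinate isomorphism avoids 0; so coordinates are continuous. *)
Lemma finite_dimensional_frame (E : normedModType R) : finite_dimensional E ->
  exists (n : nat) (e : 'I_n -> E) (f : 'I_n -> 'L(E, R^o)),
    forall x, x = \sum_(i < n) f i x *: e i.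
Proof.
move=> /finite_dimensional_basis[n [e [spane freee]]].
pose g (c : 'rV[R]_n) : E := \sum_(i < n) c 0 i *: e i.
have g_lin : linear g.
  move=> a c d; rewrite /g scaler_sumr -big_split /=; apply: eq_bigr => i _.
  by rewrite !mxE scalerDl scalerA.
have coord_le (c : 'rV[R]_n) i : `|c 0 i| <= `|c|.
  rewrite [leRHS]/Num.norm /= mx_normrE.
  by apply/bigmax_geP; right => /=; exists (0, i).
have g_cont : continuous g.
  have : g \in @clin_pred R 'rV[R]_n E.
    apply: (@clin_pred_bounded _ _ _ (\sum_(i < n) `|e i|)) => // c.
    rewrite /g (le_trans (ler_norm_sum _ _ _))// mulr_suml; apply: ler_sum => i _.
    by rewrite normrZ mulrC ler_wpM2l.
  by rewrite inE => -[].
have gZ a c : g (a *: c) = a *: g c.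
  have := g_lin a c 0; rewrite addr0 => ->.
  by rewrite /g [X in _ + X]big1 ?addr0// => i _; rewrite mxE scale0r.
have [m m0 Hm] : exists2 m : R, 0 < m & forall c, m * `|c| <= `|g c|.
  pose S := [set c : 'rV[R]_n | `|c| = 1].
  have [[c0 Sc0]|/set0P/negP] := pselect (S !=set0); last first.
    rewrite negbK => /eqP S0; exists 1 => // c.
    have [->|cn0] := eqVneq c 0; first by rewrite normr0 mulr0.
    suff : S (`|c|^-1 *: c) by rewrite S0.
    by rewrite /S/= normrZ normfV normr_id mulVf ?normr_eq0.
  have cS : compact S.
    apply: bounded_closed_compact.
      by exists 1; split=> // y y1 c /= ->; exact: ltW.
    rewrite (_ : S = (fun c : 'rV[R]_n => `|c|) @^-1` [set 1])//.
    apply: closed_comp => [c _|]; [exact: norm_continuous|exact: closed_eq].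
  have normg_cont : {within S, continuous (fun c => `|g c|)}.
    apply: continuous_subspaceT => c; apply: continuous_comp; first exact: g_cont.
    exact: norm_continuous.
  have [c + cmin] := EVT_min_rV (ex_intro _ c0 Sc0) cS normg_cont.
  rewrite inE => Sc.
  exists `|g c|.
    rewrite normr_gt0; apply/eqP => /freee c_eq0.
    by move: Sc; rewrite /S/= c_eq0 normr0 => /esym/eqP; rewrite oner_eq0.
  move=> d; have [->|dn0] := eqVneq d 0; first by rewrite normr0 mulr0.
  have nd : 0 < `|d| by rewrite normr_gt0.
  have := cmin (`|d|^-1 *: d); rewrite inE /S /= normrZ normfV normr_id mulVf ?gt_eqF//.
  by rewrite gZ normrZ normfV normr_id ler_pdivlMl// mulrC => /(_ erefl).
have coordE x : {c : 'rV[R]_n | x = g c} by apply: cid; exact: spane.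
pose k x := sval (coordE x).
have kK x : g (k x) = x by rewrite /k; case: (coordE x).
have g_inj c d : g c = g d -> c = d.
  move=> cd; apply/eqP; rewrite -subr_eq0; apply/eqP/freee.
  rewrite -[LHS]/(g (c - d)) -scaleN1r addrC g_lin cd.
  by rewrite scaleN1r addNr.
have k_lin : linear k.
  by move=> a x y; apply: g_inj; rewrite kK g_lin !kK.
have f_pred i : (fun x : E => k x 0 i : R^o) \in @clin_pred R E R^o.
  apply: (@clin_pred_bounded _ _ _ m^-1).
    by move=> a x y; rewrite k_lin !mxE.
  move=> x; rewrite ler_pdivlMl//.
  rewrite -[in leRHS](kK x) (le_trans _ (Hm _))////.
  by apply: ler_wpM2l; [exact: ltW|exact: coord_le].
exists n, e, (fun i => CLin (f_pred i)) => x.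
by rewrite -{1}(kK x).
Qed.

Lemma finite_dimensional_fin (I : finType) (E : normedModType R) (e : I -> E) :
  (forall x, exists c : I -> R, x = \sum_i c i *: e i) -> finite_dimensional E.
Proof.
move=> He; exists #|I|, (fun i => e (enum_val i)) => x.
have [c ->] := He x; exists (fun i => c (enum_val i)).
by rewrite (reindex (enum_val (A := I)))//=; apply: onW_bij; exact: enum_val_bij.
Qed.

Lemma finite_dimensional_real : finite_dimensional (R^o : normedModType R).
Proof.
exists 1%N, (fun=> (1 : R^o)) => x; exists (fun=> x : R).
by rewrite big_ord1 [x%:A]mulr1.
Qed.

Lemma rank1_subproof (V U : normedModType R) (f : 'L(V, R^o)) (u : U) :
  (fun x => (f x : R) *: u) \in @clin_pred R V U.
Proof.
apply: (@clin_pred_bounded _ _ _ (`|f| * `|u|)).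
  by move=> a x y; rewrite linearP scalerDl -scalerA.
by move=> x; rewrite normrZ mulrAC ler_wpM2r//; exact: opnormP.
Qed.

Definition rank1 (V U : normedModType R) (f : 'L(V, R^o)) (u : U) : 'L(V, U) :=
  CLin (rank1_subproof f u).

Lemma finite_dimensional_clin (V U : normedModType R) :
  finite_dimensional V -> finite_dimensional U -> finite_dimensional 'L(V, U).
Proof.
move=> /finite_dimensional_frame[n [e [f fe]]].
move=> /finite_dimensional_frame[m [e' [f' fe']]].
apply: (@finite_dimensional_fin ('I_n * 'I_m)%type _
  (fun p => rank1 (f p.1) (e' p.2))) => A.
exists (fun p => f' p.2 (A (e p.1))); apply: clinP => x.
rewrite [in LHS](fe x) raddf_sum/=.
rewrite clin_sumE.
rewrite -(pair_big xpredT xpredT (fun i j => (f' j (A (e i)) *: rank1 (f i) (e' j)) x))/=.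
apply: eq_bigr => i _.
rewrite linearZ /= {1}(fe' (A (e i))) scaler_sumr; apply: eq_bigr => j _.
by rewrite fctE !scalerA mulrC.
Qed.

Definition separable (E : normedModType R) : Prop :=
  exists q : nat -> E, forall x (e : R), 0 < e -> exists k, `|x - q k| < e.

Lemma finite_dimensional_separable (E : normedModType R) :
  finite_dimensional E -> separable E.
Proof.
move=> [n [e He]].
pose v (g : {ffun 'I_n -> rat}) : E := \sum_(i < n) (ratr (g i) : R) *: e i.
exists (fun k => oapp v 0 (unpickle k)) => x r r0.
have [c ->] := He x.
pose S := 1 + \sum_(i < n) `|e i|.
have S0 : 0 < S by rewrite ltr_pwDl// sumr_ge0.
have [g Hg] : {g : 'I_n -> rat & forall i, `|c i - ratr (g i)| <= r / 2 / S}.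
  apply: (@choice _ _ (fun i (q : rat) => `|c i - ratr q| <= r / 2 / S)) => i.
  have lt : c i < c i + r / 2 / S by rewrite ltrDl !divr_gt0.
  have [q] := rat_in_itvoo lt; rewrite in_itv/= => /andP[q1 q2].
  exists q; rewrite distrC ger0_norm ?subr_ge0 ?(ltW q1)//.
  by rewrite lerBlDl ltW.
exists (pickle [ffun i => g i]); rewrite pickleK /= /v -sumrB.
rewrite (@le_lt_trans _ _ (\sum_(i < n) r / 2 / S * `|e i|))//.
  rewrite (le_trans (ler_norm_sum _ _ _))//; apply: ler_sum => i _.
  by rewrite -scalerBl normrZ ffunE ler_wpM2r.
rewrite -mulr_sumr mulrAC ltr_pdivrMr// (@le_lt_trans _ _ (r / 2 * S))//.
  by rewrite ler_wpM2l ?divr_ge0 ?(ltW r0)// /S lerDr.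
by rewrite ltr_pM2r// gtr_pMr// invf_lt1// ltr1n.
Qed.

End FiniteDimension.

Section TensorLift.
Context {R : realType} {V : normedModType R}.

Lemma clin_eval_subproof (A B : normedModType R) (x : A) :
  (fun h : 'L(A, B) => h x) \in @clin_pred R 'L(A, B) B.
Proof.
apply: (@clin_pred_bounded _ _ _ _ `|x|) => // h; rewrite mulrC; exact: opnormP.
Qed.

Definition clin_eval (A B : normedModType R) (x : A) : 'L('L(A, B), B) :=
  CLin (clin_eval_subproof B x).

(** By duality: an element of [tensor2 V] is determined by its values on
    bilinear forms, and those are combinations of products of coordinates. *)
Lemma tensor2_frame n (e : 'I_n -> V) (f : 'I_n -> 'L(V, R^o)) :
  (forall x, x = \sum_(i < n) f i x *: e i) ->
  forall T : tensor2 V,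
    T = \sum_(i < n) \sum_(j < n) (T (rank1 (f i) (f j)) : R) *: tens (e i) (e j).
Proof.
move=> fe T; apply: clinP => B.
have BE : B = \sum_(i < n) \sum_(j < n) (B (e i) (e j) : R) *: rank1 (f i) (f j).
  apply: clinP => x; apply: clinP => y.
  rewrite !clin_sumE {1}(fe x) clin_appsum clin_sumE; apply: eq_bigr => i _.
  rewrite !clin_sumE clin_appZ clin_scaleE {1}(fe y) clin_appsum scaler_sumr.
  apply: eq_bigr => j _; rewrite !clin_scaleE clin_appZ /=.
  by rewrite /GRing.scale /=; ring.
rewrite {1}BE clin_appsum clin_sumE; apply: eq_bigr => i _.
rewrite clin_appsum clin_sumE; apply: eq_bigr => j _.
by rewrite clin_appZ clin_scaleE /= /GRing.scale /= mulrC.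
Qed.

Definition bilinear_map (E : normedModType R) (b : V -> V -> E) : Prop :=
  (forall v, linear (b v)) /\ (forall w, linear (b^~ w)).

(** The linear map that [tensor_lift] selects exists: it is given by the
    coordinates of a frame. *)
Lemma tensor_lift_tens (E : normedModType R) (b : V -> V -> E) :
  finite_dimensional V -> bilinear_map b ->
  forall v w, tensor_lift b (tens v w) = b v w.
Proof.
move=> /finite_dimensional_frame[n [e [f fe]]] [br bl].
pose Lr v : {linear V -> E} := HB.pack (b v) (GRing.isLinear.Build R V E _ _ (br v)).
pose Ll w : {linear V -> E} := HB.pack (b^~ w) (GRing.isLinear.Build R V E _ _ (bl w)).
pose l : 'L(tensor2 V, E) := \sum_(i < n) \sum_(j < n)
  rank1 (clin_eval R^o (rank1 (f i) (f j))) (b (e i) (e j)).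
have blZ w a x : b (a *: x) w = a *: b x w.
  by rewrite -[LHS]/(Ll w (a *: x)) linearZ.
have brZ v a x : b v (a *: x) = a *: b v x.
  by rewrite -[LHS]/(Lr v (a *: x)) linearZ.
apply: (@getPex _ [set l : 'L(tensor2 V, E) | forall v w, l (tens v w) = b v w]).
exists l => v w /=.
rewrite /l clin_sumE {2}(fe v) [RHS](raddf_sum (Ll w)); apply: eq_bigr => i _.
rewrite clin_sumE /= blZ {2}(fe w) [b _ _](raddf_sum (Lr (e i))) scaler_sumr.
by apply: eq_bigr => j _; rewrite /= brZ scalerA.
Qed.

(** This formula makes [tensor_lift] additive in [b] and bounded. *)
Lemma tensor_liftE (E : normedModType R) (b : V -> V -> E) n
    (e : 'I_n -> V) (f : 'I_n -> 'L(V, R^o)) :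
  finite_dimensional V -> bilinear_map b ->
  (forall x, x = \sum_(i < n) f i x *: e i) ->
  forall T, tensor_lift b T =
    \sum_(i < n) \sum_(j < n) (T (rank1 (f i) (f j)) : R) *: b (e i) (e j).
Proof.
move=> fdV bb fe T.
rewrite {1}(tensor2_frame fe T) clin_appsum; apply: eq_bigr => i _.
rewrite clin_appsum; apply: eq_bigr => j _.
by rewrite clin_appZ tensor_lift_tens.
Qed.

End TensorLift.

(** * Partitions and the sewing estimate *)

Section Partitions.
Context {R : realType} {E : normedModType R}.
Implicit Types (G H : R -> R -> E) (a b : R) (s : seq R).

Lemma partition_sum_cons G a b s :
  partition_sum G a (b :: s) = G a b + partition_sum G b s.
Proof.
rewrite /partition_sum /= big_nat_recl//; congr (_ + _).
rewrite !big_nat; apply: eq_bigr => i /andP[_ il].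
congr (G _ _); first by apply: set_nth_default; rewrite /= ltnS ltnW.
by apply: set_nth_default; rewrite /= ltnS.
Qed.

Lemma partition_sum_cat G a s1 s2 :
  partition_sum G a (s1 ++ s2) =
  partition_sum G a s1 + partition_sum G (last a s1) s2.
Proof.
elim: s1 a => [|b s1 IH] a /=; first by rewrite [partition_sum G a [::]]big_geq// add0r.
by rewrite !partition_sum_cons IH addrA.
Qed.

Lemma partition_sumB G H a s :
  partition_sum (fun u v => G u v - H u v) a s =
  partition_sum G a s - partition_sum H a s.
Proof. by rewrite /partition_sum -sumrB. Qed.

Lemma mesh_lt a s (e : R) : 0 < e ->
  (mesh a s < e) = all (fun i => nth a (a :: s) i.+1 - nth a (a :: s) i < e)
                       (iota 0 (size s)).
Proof.
move=> e0; rewrite /mesh /index_iota subn0.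
elim: (iota _ _) => [|i r IH]; first by rewrite big_nil e0.
by rewrite big_cons gt_max IH.
Qed.

Lemma mesh_lt_cons a b s (e : R) : 0 < e ->
  (mesh a (b :: s) < e) = (b - a < e) && (mesh b s < e).
Proof.
move=> e0; rewrite !mesh_lt//=; congr (_ && _).
rewrite -[1%N]/(1 + 0)%N iotaDl all_map; apply: eq_in_all => i.
rewrite mem_iota /= add0n => il.
rewrite (set_nth_default a b) // ?(set_nth_default a b (s := b :: s))//=.
by rewrite ltnW.
Qed.

Lemma mesh_lt_cat a s1 s2 (e : R) : 0 < e ->
  (mesh a (s1 ++ s2) < e) = (mesh a s1 < e) && (mesh (last a s1) s2 < e).
Proof.
move=> e0; elim: s1 a => [|b s1 IH] a /=.
  by rewrite [mesh a [::]]big_geq// e0.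
by rewrite !mesh_lt_cons// IH andbA.
Qed.

Fixpoint dyadic (n : nat) (a b : R) : seq R :=
  if n is n'.+1 then
    dyadic n' a ((a + b) / 2) ++ dyadic n' ((a + b) / 2) b
  else [:: b].

Lemma dyadic_partition n a b : a < b -> itv_partition a b (dyadic n a b).
Proof.
elim: n a b => [|n IH] a b ab /=; first exact: itv_partition1.
by apply: itv_partition_cat; apply: IH; [rewrite midf_lt|rewrite midf_lt].
Qed.

Lemma last_dyadic n a b x : last x (dyadic n a b) = b.
Proof. by elim: n a b x => [|n IH] a b x //=; rewrite last_cat !IH. Qed.

Lemma mesh_dyadic n a b (e : R) : 0 < e -> (b - a) / 2 ^+ n < e ->
  mesh a (dyadic n a b) < e.
Proof.
move=> e0; elim: n a b => [|n IH] a b /=.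
  rewrite expr0 divr1 => ab; rewrite mesh_lt_cons// ab.
  by rewrite /mesh big_geq.
rewrite exprS => ab; rewrite mesh_lt_cat// last_dyadic.
rewrite !IH//; apply: le_lt_trans ab;
  by rewrite invfM mulrA ler_wpM2r ?invr_ge0 ?exprn_ge0//; lra.
Qed.

Lemma fine_dyadic a b (e : R) : 0 < e -> exists n, mesh a (dyadic n a b) < e.
Proof.
move=> e0.
have [ab|ba] := leP a b; last first.
  exists 0%N; apply: mesh_dyadic => //; rewrite expr0 divr1.
  by rewrite (lt_trans _ e0)// subr_lt0.
pose n := (Num.trunc ((b - a) / e)).+1.
exists n; apply: mesh_dyadic => //.
rewrite ltr_pdivrMr ?exprn_gt0// mulrC -ltr_pdivrMr//.
apply: (@lt_trans _ _ n%:R).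
  by rewrite /n truncnS_gt.
by rewrite -natrX ltr_nat ltn_expl.
Qed.

Lemma fine_partition a b (e : R) : a <= b -> 0 < e ->
  exists2 s, itv_partition a b s & mesh a s < e.
Proof.
rewrite le_eqVlt => /predU1P[->|ab] e0.
  by exists [::]; [split=> /= | rewrite /mesh big_geq].
have [n ?] := fine_dyadic a b e0.
by exists (dyadic n a b) => //; exact: dyadic_partition.
Qed.

Lemma partition_limitB G H a b l m :
  is_partition_limit G a b l -> is_partition_limit H a b m ->
  is_partition_limit (fun u v => G u v - H u v) a b (l - m).
Proof.
move=> Gl Hm e e0; have e20 : 0 < e / 2 by rewrite divr_gt0.
have [d1 d10 H1] := Gl _ e20; have [d2 d20 H2] := Hm _ e20.
exists (Num.min d1 d2); first by rewrite lt_min d10.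
move=> s ss; rewrite lt_min => /andP[m1 m2].
rewrite partition_sumB.
have -> : partition_sum G a s - partition_sum H a s - (l - m) =
  (partition_sum G a s - l) - (partition_sum H a s - m) by abelian.
rewrite (le_lt_trans (ler_normB _ _))// [e]splitr ltrD//; [exact: H1|exact: H2].
Qed.

(** Fix one fine partition of the left part and vary the partition of the
    right part: concatenations are fine partitions of the whole. *)
Lemma partition_limit_right G a b c l m : a <= b ->
  is_partition_limit G a b l -> is_partition_limit G a c m ->
  is_partition_limit G b c (m - l).
Proof.
move=> ab Gl Gm e e0; have e20 : 0 < e / 2 by rewrite divr_gt0.
have [d1 d10 H1] := Gl _ e20; have [d2 d20 H2] := Gm _ e20.
have [s ss ms] := @fine_partition a b (Num.min d1 d2) ab
  ltac:(by rewrite lt_min d10).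
exists d2 => // t tt mt.
move: ms; rewrite lt_min => /andP[m1 m2].
have lasts : last a s = b by case: ss => _ /eqP.
have := H2 (s ++ t) (itv_partition_cat ss tt).
rewrite mesh_lt_cat// lasts m2 mt => /(_ isT).
rewrite partition_sum_cat lasts => h2; have h1 := H1 _ ss m1.
have -> : partition_sum G b t - (m - l) =
  (partition_sum G a s + partition_sum G b t - m) - (partition_sum G a s - l)
  by abelian.
by rewrite (le_lt_trans (ler_normB _ _))// [e]splitr ltrD.
Qed.

Lemma partition_limit_left G a b c l m : b <= c ->
  is_partition_limit G b c l -> is_partition_limit G a c m ->
  is_partition_limit G a b (m - l).
Proof.
move=> bc Gl Gm e e0; have e20 : 0 < e / 2 by rewrite divr_gt0.
have [d1 d10 H1] := Gl _ e20; have [d2 d20 H2] := Gm _ e20.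
have [s ss ms] := @fine_partition b c (Num.min d1 d2) bc
  ltac:(by rewrite lt_min d10).
exists d2 => // t tt mt.
move: ms; rewrite lt_min => /andP[m1 m2].
have lasts : last a t = b by case: tt => _ /eqP.
have := H2 (t ++ s) (itv_partition_cat tt ss).
rewrite mesh_lt_cat// lasts m2 mt => /(_ isT).
rewrite partition_sum_cat lasts => h2; have h1 := H1 _ ss m1.
have -> : partition_sum G a t - (m - l) =
  (partition_sum G a t + partition_sum G b s - m) - (partition_sum G b s - l)
  by abelian.
by rewrite (le_lt_trans (ler_normB _ _))// [e]splitr ltrD.
Qed.

Lemma partition_limit_shift G H a b c l :
  (forall u v, a <= u -> u < v -> v <= b -> G u v = H (u + c) (v + c)) ->
  is_partition_limit H (a + c) (b + c) l -> is_partition_limit G a b l.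
Proof.
move=> GH Hl e e0; have [r r0 Hr] := Hl _ e0; exists r => // s ss ms.
have mapsum x t : itv_partition x b t -> a <= x ->
    partition_sum G x t = partition_sum H (x + c) [seq y + c | y <- t].
  elim: t x => [|y t IH] x xt ax; first by rewrite /partition_sum !big_geq.
  have xy : x < y by case: xt => /= /andP[].
  have yt := itv_partition_cons xt.
  rewrite /= !partition_sum_cons GH//; last exact: itv_partition_le yt.
  by rewrite IH// (le_trans ax)// ltW.
have mapmesh x t : (mesh (x + c) [seq y + c | y <- t] < r) = (mesh x t < r).
  elim: t x => [|y t IH] x; first by rewrite /mesh !big_geq.
  by rewrite /= !mesh_lt_cons// IH opprD addrACA subrr addr0.
rewrite mapsum//; apply: Hr; last by rewrite mapmesh.
case: ss => ss1 /eqP ss2; split; last by rewrite (last_map (fun y => y + c)) ss2.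
rewrite -[X in path _ X _]/((fun y => y + c) a) path_map.
by rewrite (eq_path (e' := <%O))// => x y /=; rewrite ltrD2r.
Qed.

(** For [c = 0] this bounds an integral by the length of the interval; for [c]
    the value of the integrand at [a] it compares the integral with one step. *)
Lemma partition_limit_bound G a b l (c : E) (C : R) : a <= b ->
  (forall u v, a <= u -> u < v -> v <= b -> `|G u v - (v - u) *: c| <= C * (v - u)) ->
  is_partition_limit G a b l -> `|l - (b - a) *: c| <= C * (b - a).
Proof.
move=> ab GC Gl; apply/ler_addgt0Pr => e e0.
have [r r0 Hr] := Gl _ e0.
have [s ss ms] := fine_partition ab r0.
have bound x t : itv_partition x b t -> a <= x ->
    `|partition_sum G x t - (b - x) *: c| <= C * (b - x).
  elim: t x => [|y t IH] x xt ax.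
    by rewrite (itv_partition_nil xt) subrr scale0r subr0 /partition_sum big_geq// normr0 mulr0.
  have xy : x < y by case: xt => /= /andP[].
  have yt := itv_partition_cons xt.
  rewrite partition_sum_cons.
  have -> : (b - x) *: c = (y - x) *: c + (b - y) *: c.
    by rewrite -scalerDl; congr (_ *: _); lra.
  have -> : b - x = (y - x) + (b - y) by lra.
  rewrite opprD addrACA (le_trans (ler_normD _ _))// mulrDr lerD//.
    by apply: GC => //; exact: itv_partition_le yt.
  by apply: IH => //; rewrite (le_trans ax)// ltW.
have h1 := Hr _ ss ms; have h2 := bound _ _ ss (lexx _).
rewrite -[l - _](subrK (l - partition_sum G a s)).
have -> : l - (b - a) *: c - (l - partition_sum G a s) =
  partition_sum G a s - (b - a) *: c by abelian.
by rewrite (le_trans (ler_normD _ _))// lerD// distrC ltW.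
Qed.

(** The discrepancy between one step and the two half steps is [kappa * om], and
    halving the step divides [om] by more than two: along dyadic partitions
    the accumulated discrepancies form a geometric series. *)
Lemma sewing_estimate G a b l (om : R -> R) (kappa q : R) : a < b ->
  0 <= kappa -> q < 1 ->
  (forall x, 0 < x -> x <= b - a -> 2 * om (x / 2) <= q * om x) ->
  (forall x, 0 < x -> 0 <= om x) ->
  (forall u m v, a <= u -> u < m -> m < v -> v <= b ->
     `|G u v - G u m - G m v| <= kappa * om (v - u)) ->
  is_partition_limit G a b l ->
  `|l - G a b| <= kappa / (1 - q) * om (b - a).
Proof.
move=> ab k0 q1 omq om0 dG Gl.
have q10 : 0 < 1 - q by rewrite subr_gt0.
have C0 : 0 <= kappa / (1 - q) by rewrite divr_ge0// ltW.
have bound n x y : a <= x -> x < y -> y <= b ->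
    `|partition_sum G x (dyadic n x y) - G x y| <= kappa / (1 - q) * om (y - x).
  elim: n x y => [|n IH] x y ax xy yb.
    rewrite partition_sum_cons /partition_sum big_geq// addr0 subrr normr0.
    by rewrite mulr_ge0// om0// subr_gt0.
  rewrite /= partition_sum_cat last_dyadic; set m := (x + y) / 2.
  have xm : x < m by rewrite midf_lt.
  have my : m < y by rewrite midf_lt.
  have := IH x m ax xm (ltW (lt_le_trans my yb)).
  have := IH m y (ltW (le_lt_trans ax xm)) my yb.
  have := dG x m y ax xm my yb.
  have := omq (y - x); rewrite subr_gt0 xy => /(_ isT); rewrite lerB// => /(_ isT).
  have -> : m - x = (y - x) / 2 by rewrite /m; lra.
  have -> : y - m = (y - x) / 2 by rewrite /m; lra.
  set P1 := partition_sum G x _; set P2 := partition_sum G m _.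
  set o := om (y - x); set o2 := om (_ / 2); move=> h h1 h2 h3.
  have -> : P1 + P2 - G x y =
    - (G x y - G x m - G m y) + ((P1 - G x m) + (P2 - G m y)) by abelian.
  rewrite (le_trans (ler_normD _ _))// normrN (le_trans (lerD h1 (ler_normD _ _)))//.
  rewrite (le_trans (lerD (lexx _) (lerD h3 h2)))//.
  rewrite -mulr2n -mulr_natl mulrCA.
  rewrite (le_trans (lerD (lexx _) (ler_wpM2l C0 h)))//.
  suff -> : kappa * o = kappa / (1 - q) * ((1 - q) * o).
    by rewrite -mulrDr -mulrDl subrK mul1r.
  by rewrite mulrA divfK// gt_eqF.
apply/ler_addgt0Pr => e e0.
have [r r0 Hr] := Gl _ e0.
have [n mn] := fine_dyadic a b r0.
have h1 := Hr _ (dyadic_partition n ab) mn.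
have h2 := bound n a b (lexx _) ab (lexx _).
have -> : l - G a b = (partition_sum G a (dyadic n a b) - G a b)
   - (partition_sum G a (dyadic n a b) - l) by abelian.
by rewrite (le_trans (ler_normB _ _))// lerD// ltW.
Qed.

End Partitions.

(** * Bilinear maps, double increments and monomial bounds *)

Section BilinearMaps.
Context {R : realType}.

Lemma clin_le (A B : normedModType R) (f : 'L(A, B)) x : `|f x| <= `|f| * `|x|.
Proof. exact: opnormP. Qed.

Lemma clin_norm_le (A B : normedModType R) (f : 'L(A, B)) (M : R) : 0 <= M ->
  (forall x, `|f x| <= M * `|x|) -> `|f| <= M.
Proof. exact: opnorm_le. Qed.

(** Additivity is stated through differences, the form in which products are
    compared; [c] bounds the norm. *)
Definition bilinear_bound (A B C : normedModType R) (m : A -> B -> C) (c : R) :=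
  [/\ 0 <= c, forall a a' b, m (a - a') b = m a b - m a' b,
      forall a b b', m a (b - b') = m a b - m a b'
    & forall a b, `|m a b| <= c * `|a| * `|b|].

Lemma bilinear_bound_app (A B : normedModType R) :
  bilinear_bound (fun (f : 'L(A, B)) x => f x) 1.
Proof.
split=> //; first by move=> f x y; rewrite clin_appB.
by move=> f x; rewrite mul1r; exact: clin_le.
Qed.

Lemma bilinear_bound_comp (A B C : normedModType R) :
  bilinear_bound (@clin_comp R A B C) 1.
Proof.
split=> //; try by move=> *; apply: clinP => x /=; rewrite ?clin_subE//= clin_appB.
move=> g f; rewrite mul1r; apply: clin_norm_le => [|x /=]; first exact: mulr_ge0.
apply: (le_trans (clin_le g (f x))); rewrite -mulrA.
by apply: ler_wpM2l; [exact: normr_ge0|exact: (clin_le f x)].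
Qed.

(** The operator by which the second level of the driver enters the germ; it
    is bilinear in [B] and [A]. *)
Definition lift2 (U V W : normedModType R) (B : 'L(V, 'L(U, W))) (A : 'L(V, U)) :
  'L(tensor2 V, W) := tensor_lift (fun v1 v2 : V => B v1 (A v2)).

Lemma lift2_bilinear (U V W : normedModType R) (B : 'L(V, 'L(U, W))) (A : 'L(V, U)) :
  bilinear_map (fun v1 v2 : V => B v1 (A v2)).
Proof.
split=> [v|w] a x y; first by rewrite !linearP.
by rewrite linearP clin_addE clin_scaleE.
Qed.

Lemma rank1_norm (V U : normedModType R) (f : 'L(V, R^o)) (u : U) :
  `|rank1 f u| <= `|f| * `|u|.
Proof.
apply: clin_norm_le => [|x]; first exact: mulr_ge0.
by rewrite normrZ mulrAC ler_wpM2r//; exact: clin_le.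
Qed.

Lemma bilinear_bound_lift2 (V : normedModType R) : finite_dimensional V ->
  exists k : R, forall U W : normedModType R, bilinear_bound (@lift2 U V W) k.
Proof.
move=> fdV; have [n [e [f fe]]] := finite_dimensional_frame fdV.
pose k := \sum_(i < n) \sum_(j < n) (`|f i| * `|f j|) * (`|e i| * `|e j|).
have k0 : 0 <= k by do 2!apply: sumr_ge0 => ? _; rewrite !mulr_ge0.
have E U W (B : 'L(V, 'L(U, W))) A T : lift2 B A T =
    \sum_(i < n) \sum_(j < n) (T (rank1 (f i) (f j)) : R) *: B (e i) (A (e j)).
  by rewrite /lift2 (tensor_liftE fdV (lift2_bilinear B A) fe).
exists k => U W; split=> //.
- move=> B B' A; apply: clinP => T; rewrite clin_subE !E -sumrB.
  apply: eq_bigr => i _; rewrite -sumrB; apply: eq_bigr => j _.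
  by rewrite -scalerBr.
- move=> B A A'; apply: clinP => T; rewrite clin_subE !E -sumrB.
  apply: eq_bigr => i _; rewrite -sumrB; apply: eq_bigr => j _.
  by rewrite -scalerBr -clin_appB.
move=> B A; apply: clin_norm_le => [|T]; first by rewrite !mulr_ge0.
rewrite E (le_trans (ler_norm_sum _ _ _))// /k !mulr_suml; apply: ler_sum => i _.
rewrite (le_trans (ler_norm_sum _ _ _))// !mulr_suml; apply: ler_sum => j _.
rewrite normrZ.
have -> : `|f i| * `|f j| * (`|e i| * `|e j|) * `|B| * `|A| * `|T| =
  (`|T| * (`|f i| * `|f j|)) * (`|B| * `|e i| * (`|A| * `|e j|)) by ring.
apply: ler_pM => //.
  apply: (le_trans (clin_le T _)); apply: ler_wpM2l => //; exact: rank1_norm.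
apply: (le_trans (clin_le _ _)); apply: ler_pM => //; exact: clin_le.
Qed.

Lemma lift2_tens (U V W : normedModType R) (B : 'L(V, 'L(U, W))) (A : 'L(V, U)) v w :
  finite_dimensional V -> lift2 B A (tens v w) = B v (A w).
Proof. by move=> fdV; rewrite /lift2 tensor_lift_tens//; exact: lift2_bilinear. Qed.

(** Sizes of two paths at the two times [u] and [v]: values, increments in time,
    distance of the paths, and mixed increment. The mixed increment is what
    governs the difference of two solutions, and it requires the three others
    in order to be stable under products. *)
Definition quad (A : normedModType R) (f1 f2 : R -> A) (u v k a s b : R) :=
  [/\ [/\ `|f1 u| <= k, `|f1 v| <= k, `|f2 u| <= k & `|f2 v| <= k],
      `|f1 v - f1 u| <= a /\ `|f2 v - f2 u| <= a,
      `|f1 u - f2 u| <= s /\ `|f1 v - f2 v| <= s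
    & `|(f1 v - f1 u) - (f2 v - f2 u)| <= b].

Lemma quad_ge0 (A : normedModType R) (f1 f2 : R -> A) (u v k a s b : R) :
  quad f1 f2 u v k a s b -> [/\ 0 <= k, 0 <= a, 0 <= s & 0 <= b].
Proof.
move=> [[h1 _ _ _] [h2 _] [h3 _] h4].
by split; apply: le_trans (normr_ge0 _) _; [exact: h1|exact: h2|exact: h3|exact: h4].
Qed.

Lemma quad_le (A : normedModType R) (f1 f2 : R -> A) (u v k a s b k' a' s' b' : R) :
  k <= k' -> a <= a' -> s <= s' -> b <= b' ->
  quad f1 f2 u v k a s b -> quad f1 f2 u v k' a' s' b'.
Proof.
move=> kk aa ss bb [[? ? ? ?] [? ?] [? ?] ?].
by split; do ?split; first [apply: (@le_trans _ _ _ _ _ _ kk)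
  | apply: (@le_trans _ _ _ _ _ _ aa) | apply: (@le_trans _ _ _ _ _ _ ss)
  | apply: (@le_trans _ _ _ _ _ _ bb)].
Qed.

Lemma quad_cst (A : normedModType R) (f : R -> A) (u v k a : R) :
  `|f u| <= k -> `|f v| <= k -> `|f v - f u| <= a -> quad f f u v k a 0 0.
Proof. by move=> fu fv fa; split; rewrite ?subrr ?normr0. Qed.

(** Leibniz rule for double increments. *)
Lemma quad_bilinear (A B C : normedModType R) (m : A -> B -> C) (c : R)
    (f1 f2 : R -> A) (g1 g2 : R -> B) (u v k a s b k' a' s' b' : R) :
  bilinear_bound m c ->
  quad f1 f2 u v k a s b -> quad g1 g2 u v k' a' s' b' ->
  quad (fun t => m (f1 t) (g1 t)) (fun t => m (f2 t) (g2 t)) u v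
    (c * (k * k')) (c * (a * k' + k * a')) (c * (s * k' + k * s'))
    (c * (b * k' + a * s' + s * a' + k * b')).
Proof.
move=> [c0 mBl mBr mle] qf qg.
have [k0 a0 s0 b0] := quad_ge0 qf; have [k0' a0' s0' b0'] := quad_ge0 qg.
case: qf => -[f1u f1v f2u f2v] [fa1 fa2] [fs1 fs2] fb.
case: qg => -[g1u g1v g2u g2v] [ga1 ga2] [gs1 gs2] gb.
have le2 x y p q : `|x| <= p -> `|y| <= q -> `|m x y| <= c * (p * q).
  move=> xp yq; rewrite (le_trans (mle _ _))// -mulrA ler_wpM2l// ler_pM//.
have split2 x y x' y' p q p' q' : `|x - x'| <= p -> `|y| <= q -> `|x'| <= p' ->
    `|y - y'| <= q' -> `|m x y - m x' y'| <= c * (p * q + p' * q').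
  move=> h1 h2 h3 h4.
  have -> : m x y - m x' y' = m (x - x') y + m x' (y - y').
    by rewrite mBl mBr; abelian.
  by rewrite (le_trans (ler_normD _ _))// mulrDr lerD// le2.
split; first by split; exact: le2.
- by split; exact: split2.
- by split; exact: split2.
have -> : m (f1 v) (g1 v) - m (f1 u) (g1 u) - (m (f2 v) (g2 v) - m (f2 u) (g2 u)) =
  m ((f1 v - f1 u) - (f2 v - f2 u)) (g1 v) + m (f2 v - f2 u) (g1 v - g2 v) +
  m (f1 u - f2 u) (g1 v - g1 u) + m (f2 u) ((g1 v - g1 u) - (g2 v - g2 u)).
  by rewrite !(mBl, mBr); abelian.
rewrite !mulrDr (le_trans (ler_normD _ _))// lerD//; last exact: le2.
rewrite (le_trans (ler_normD _ _))// lerD//; last exact: le2.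
by rewrite (le_trans (ler_normD _ _))// lerD//; exact: le2.
Qed.

End BilinearMaps.

Section Monomials.
Context {R : realType}.

(** Domination by a monomial in a large [K], a scale [x] and a small [w]:
    constants are absorbed in the power of [K], so that only exponents matter. *)
Definition mono_bound (K x w y : R) (i j k : nat) := 0 <= y <= K ^+ i * x ^+ j * w ^+ k.

Variables (K x w : R).
Hypotheses (K2 : 2 <= K) (x0 : 0 <= x) (w0 : 0 <= w) (w1 : w <= 1).

Let K0 : 0 <= K. Proof. exact: le_trans K2. Qed.
Let K1 : 1 <= K. Proof. by apply: le_trans K2; rewrite ler1n. Qed.

Lemma mono_weaken y i j k i' k' : (i <= i')%N -> (k' <= k)%N ->
  mono_bound K x w y i j k -> mono_bound K x w y i' j k'.
Proof.
move=> ii kk /andP[y0 yle]; apply/andP; split=> //; apply: (le_trans yle).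
apply: ler_pM; rewrite ?mulr_ge0 ?exprn_ge0//; last by apply: ler_wiXn2l; rewrite ?w0.
by rewrite ler_wpM2r ?exprn_ge0// ler_weXn2l.
Qed.

Lemma monoD y z i j k i' j' k' : mono_bound K x w y i j k -> mono_bound K x w z i' j' k' ->
  j' = j -> mono_bound K x w (y + z) (maxn i i').+1 j (minn k k').
Proof.
move=> my mz jj; subst j'; move: my mz.
move=> /(mono_weaken (leq_maxl i i') (geq_minl k k'))/andP[y0 yle].
move=> /(mono_weaken (leq_maxr i i') (geq_minr k k'))/andP[z0 zle].
rewrite /mono_bound addr_ge0//= (le_trans (lerD yle zle))// exprS -!mulrA.
rewrite -mulr2n -mulr_natl ler_wpM2r// !mulr_ge0// exprn_ge0//.
Qed.

Lemma monoM y z i j k i' j' k' : mono_bound K x w y i j k -> mono_bound K x w z i' j' k' ->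
  mono_bound K x w (y * z) (i + i') (j + j') (k + k').
Proof.
move=> /andP[y0 yle] /andP[z0 zle]; rewrite /mono_bound mulr_ge0//=.
rewrite (le_trans (ler_pM y0 z0 yle zle))// !exprD.
by_ring.
Qed.

Lemma mono_K : mono_bound K x w K 1 0 0.
Proof. by rewrite /mono_bound K0 !expr0 expr1 !mulr1/=. Qed.
Lemma mono_Kn n : mono_bound K x w (K ^+ n) n 0 0.
Proof. by rewrite /mono_bound exprn_ge0// !expr0 !mulr1/=. Qed.
Lemma mono_x : mono_bound K x w x 0 1 0.
Proof. by rewrite /mono_bound x0 !expr0 expr1 mul1r mulr1/=. Qed.
Lemma mono_w : mono_bound K x w w 0 0 1.
Proof. by rewrite /mono_bound w0 !expr0 expr1 !mul1r/=. Qed.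
Lemma mono_wn n : mono_bound K x w (w ^+ n) 0 0 n.
Proof. by rewrite /mono_bound exprn_ge0// !expr0 !mul1r/=. Qed.
Lemma mono_1 : mono_bound K x w 1 0 0 0.
Proof. by rewrite /mono_bound !expr0 !mulr1/= ler01 lexx. Qed.
Lemma mono_2 : mono_bound K x w 2 1 0 0.
Proof. by rewrite /mono_bound !expr0 !mulr1/= ler0n. Qed.
Lemma mono_0 : mono_bound K x w 0 0 1 0.
Proof. by rewrite /mono_bound !expr0 !mulr1 mul1r lexx. Qed.

Definition mono_form (z : R) (i j k : nat) := z = K ^+ i * x ^+ j * w ^+ k.

Lemma mono_formM y z i j k i' j' k' : mono_form y i j k -> mono_form z i' j' k' ->
  mono_form (y * z) (i + i') (j + j') (k + k').
Proof. by rewrite /mono_form => -> ->; rewrite !exprD; ring. Qed.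

Lemma mono_form_K : mono_form K 1 0 0.
Proof. by rewrite /mono_form !expr0 expr1 !mulr1. Qed.
Lemma mono_form_Kn n : mono_form (K ^+ n) n 0 0.
Proof. by rewrite /mono_form !expr0 !mulr1. Qed.
Lemma mono_form_x : mono_form x 0 1 0.
Proof. by rewrite /mono_form !expr0 expr1 mul1r mulr1. Qed.
Lemma mono_form_w : mono_form w 0 0 1.
Proof. by rewrite /mono_form !expr0 expr1 !mul1r. Qed.
Lemma mono_form_wn n : mono_form (w ^+ n) 0 0 n.
Proof. by rewrite /mono_form !expr0 !mul1r. Qed.

Lemma mono_le y z i j k i' j' k' :
  mono_bound K x w y i j k -> mono_form z i' j' k' ->
  [&& (i <= i')%N, j == j' & (k' <= k)%N] -> y <= z.
Proof.
move=> my -> /and3P[ii /eqP <- kk].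
by have /andP[] := mono_weaken ii kk my.
Qed.

End Monomials.

Ltac mono_rec K x w K2 x0 w0 w1 :=
  lazymatch goal with
  | |- is_true (mono_bound _ _ _ ?y _ _ _) =>
    lazymatch y with
    | (_ + _)%R => eapply (monoD K2 x0 w0 w1);
      [mono_rec K x w K2 x0 w0 w1 | mono_rec K x w K2 x0 w0 w1 | reflexivity]
    | (_ * _)%R => eapply (monoM (K := K) (x := x) (w := w)); mono_rec K x w K2 x0 w0 w1
    | (K ^+ _)%R => exact: (mono_Kn _ _ K2)
    | (w ^+ _)%R => exact: (mono_wn _ _ w0)
    | K => exact: (mono_K _ _ K2)
    | x => exact: (mono_x _ _ x0)
    | w => exact: (mono_w _ _ w0)
    | 1%R => exact: (mono_1 _ _ _)
    | 2%R => exact: (mono_2 _ _ K2)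
    | 0%R => exact: (mono_0 _ _ _)
    end
  end.

Ltac mono_form_rec K x w :=
  lazymatch goal with
  | |- mono_form _ _ _ ?y _ _ _ =>
    lazymatch y with
    | (_ * _)%R => eapply mono_formM; mono_form_rec K x w
    | (K ^+ _)%R => exact: mono_form_Kn
    | (w ^+ _)%R => exact: mono_form_wn
    | K => exact: mono_form_K
    | x => exact: mono_form_x
    | w => exact: mono_form_w
    end
  end.

(** Bounds a polynomial in [K], [x] and [w] by a single monomial. *)
Ltac mono K2 x0 w0 w1 :=
  lazymatch type of K2 with (is_true (@Order.le _ _ _ ?K)) =>
  lazymatch type of x0 with (is_true (@Order.le _ _ _ ?x)) =>
  lazymatch type of w0 with (is_true (@Order.le _ _ _ ?w)) =>
    eapply (mono_le K2 x0 w0 w1);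
    [mono_rec K x w K2 x0 w0 w1 | mono_form_rec K x w | reflexivity]
  end end end.

(** * Absorption, the Hoelder scale and the vector fields *)

Section Absorb.
Context {R : realType}.

(** A finite bound [r0] that can be improved from [r] to [A + r / 2] can be
    improved to the fixed point [2 * A]. The finiteness comes with the
    definition of a controlled path; only the value of the bound is gained. *)
Lemma absorb_half (T : Type) (P : T -> Prop) (h e : T -> R) (A r0 : R) :
  0 <= r0 -> 0 <= A -> (forall x, P x -> 0 <= e x) ->
  (forall x, P x -> h x <= r0 * e x) ->
  (forall r, 0 <= r -> (forall x, P x -> h x <= r * e x) ->
     forall x, P x -> h x <= (A + r / 2) * e x) ->
  forall x, P x -> h x <= 2 * A * e x.
Proof.
move=> r00 A0 e0 b0 step.
have pos n : 0 <= 2 * A + r0 / 2 ^+ n by rewrite addr_ge0 ?mulr_ge0 ?invr_ge0 ?exprn_ge0.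
have bn n : forall x, P x -> h x <= (2 * A + r0 / 2 ^+ n) * e x.
  elim: n => [|n IH] x Px.
    rewrite (le_trans (b0 _ Px))// ler_wpM2r ?e0// expr0 divr1 lerDr.
    by rewrite mulr_ge0.
  rewrite (le_trans (step _ (pos n) IH _ Px))// ler_wpM2r ?e0//.
  rewrite exprS invfM; set t := _^-1; lra.
move=> x Px; apply/ler_addgt0Pr => eps eps0.
pose c := r0 * e x.
have c0 : 0 <= c by rewrite mulr_ge0// e0.
pose n := (Num.trunc (c / eps)).+1.
rewrite (le_trans (bn n _ Px))// mulrDl lerD2l mulrAC -/c.
rewrite ler_pdivrMr ?exprn_gt0// mulrC -ler_pdivrMr// ltW//.
apply: (@lt_trans _ _ n%:R); first by rewrite /n truncnS_gt.
by rewrite -natrX ltr_nat ltn_expl.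
Qed.

End Absorb.

Section HolderScale.
Context {R : realType}.
Variable alpha : R.
Hypotheses (alpha13 : 3^-1 < alpha) (alpha12 : alpha <= 2^-1).

Definition om (x : R) : R := x `^ alpha.

Let alpha0 : 0 < alpha. Proof. by apply: lt_trans alpha13; rewrite invr_gt0. Qed.

Lemma om_ge0 x : 0 <= om x. Proof. exact: powR_ge0. Qed.

Lemma om_le x y : 0 <= x -> x <= y -> om x <= om y.
Proof.
move=> x0 xy; apply: ge0_ler_powR => //; first exact: ltW.
by rewrite nnegrE (le_trans x0).
Qed.

Lemma om_le1 x : 0 <= x -> x <= 1 -> om x <= 1.
Proof. by move=> x0 x1; rewrite -[leRHS](_ : om 1 = 1) ?om_le// /om powR1. Qed.

Lemma om_sqr x : om x ^+ 2 = x `^ (2 * alpha).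
Proof. by rewrite -powR_mulrn ?om_ge0// -powRrM mulrC. Qed.

(** So the drift, of order 1 in time, is as small as the remainders, of order
    [2 * alpha]. *)
Lemma le_om_sqr x : 0 <= x -> x <= 1 -> x <= om x ^+ 2.
Proof.
rewrite le_eqVlt => /predU1P[<- _|x0 x1]; first by rewrite exprn_ge0// om_ge0.
rewrite om_sqr -[leLHS]powRr1 ?(ltW x0)//; apply: ger_powR; first by rewrite x0.
by rewrite mulrC -ler_pdivlMr// mul1r.
Qed.

(** The factor by which the sum of the cubes [om x ^+ 3] decreases when a step is
    halved; it is less than 1 exactly because [1 < 3 * alpha]. *)
Definition sewing_ratio : R := 2 * om 2^-1 ^+ 3.

Lemma sewing_ratio_lt1 : sewing_ratio < 1.
Proof.
rewrite /sewing_ratio mulrC -ltr_pdivlMr// mul1r -powR_mulrn ?om_ge0// -powRrM.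
rewrite /powR gt_eqF ?invr_gt0// -[ltRHS]lnK ?posrE ?invr_gt0// ltr_expR.
have ln2 : ln (2^-1 : R) < 0 by rewrite ln_lt0// invr_gt0 ltr0n/= invf_lt1// ltr1n.
rewrite -subr_gt0 -{1}[ln _]mul1r -mulrBl nmulr_lgt0// subr_lt0.
by rewrite -ltr_pdivrMr// mul1r.
Qed.

Lemma om_halve x : 0 < x -> 2 * om (x / 2) ^+ 3 <= sewing_ratio * om x ^+ 3.
Proof.
move=> x0; rewrite /sewing_ratio /om powRM ?invr_ge0 ?(ltW x0)// exprMn.
by_ring.
Qed.

End HolderScale.

Section VectorFields.
Context {R : realType} {U W : normedModType R}.

(** All that the estimates need to know of the vector fields, with a single
    constant. *)
Record vector_field_bounds (F : W -> 'L(U, W)) (F0 : W -> W) (K : R) : Prop := {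
  vf_F : forall x, `|F x| <= K ;
  vf_DF : forall x, `|Dtot F x| <= K ;
  vf_Flip : forall x y, `|F x - F y| <= K * `|x - y| ;
  vf_DFlip : forall x y, `|Dtot F x - Dtot F y| <= K * `|x - y| ;
  vf_Fincr2 : forall x1 h1 x2 h2,
    `|incr2 F x1 h1 x2 h2| <= K * (`|h1| * `|x1 - x2| + `|h1 - h2|) ;
  vf_DFincr2 : forall x1 h1 x2 h2,
    `|incr2 (Dtot F) x1 h1 x2 h2| <= K * (`|h1| * `|x1 - x2| + `|h1 - h2|) ;
  vf_taylor_lip : forall x h, `|taylor1 F x h| <= 2 * K * `|h| ;
  vf_taylor_sqr : forall x h, `|taylor1 F x h| <= K * `|h| ^+ 2 ;
  vf_taylor_diff : forall x1 h1 x2 h2, `|taylor1 F x1 h1 - taylor1 F x2 h2| <=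
    K * (`|h1| * `|x1 - x2| + `|h1 - h2|) * `|h1| + K * `|h2| * `|h1 - h2| ;
  vf_F0 : forall x, `|F0 x| <= K ;
  vf_F0lip : forall x y, `|F0 x - F0 y| <= K * `|x - y| }.

Lemma class_Cb_bounds (F : W -> 'L(U, W)) (F0 : W -> W) :
  class_Cb 3 F -> class_Cb 1 F0 ->
  exists K0, forall K, K0 <= K -> vector_field_bounds F F0 K.
Proof.
move=> /= [[M0 FM0] [dF [[M1 FM1] [d2F [[M2 FM2] [d3F [[M3 FM3] _]]]]]]].
move=> [[N0 GN0] [dF0 [[N1 GN1] _]]].
exists (Num.max (Num.max (Num.max M0 M1) (Num.max M2 M3)) (Num.max N0 N1)) => K.
rewrite !ge_max => /andP[/andP[/andP[M0K M1K] /andP[M2K M3K]] /andP[N0K N1K]].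
have {}FM0 x : `|F x| <= K by apply: le_trans M0K.
have {}FM1 x : `|Dtot F x| <= K by apply: le_trans M1K.
have {}FM2 x : `|Dtot (Dtot F) x| <= K by apply: le_trans M2K.
have {}FM3 x : `|Dtot (Dtot (Dtot F)) x| <= K by apply: le_trans M3K.
have {}GN0 x : `|F0 x| <= K by apply: le_trans N0K.
have {}GN1 x : `|Dtot F0 x| <= K by apply: le_trans N1K.
have L1 := Dtot_lipschitz d2F FM2.
have L2 := Dtot_lipschitz d3F FM3.
have I2 := incr2_bound d2F FM2 L2.
split=> //.
- exact: Dtot_lipschitz.
- exact: incr2_bound.
- exact: taylor1_lipschitz.
- exact: taylor1_quadratic.
- exact: taylor1_diff.
- exact: Dtot_lipschitz.
Qed.

End VectorFields.

(** * Solutions on short intervals *)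

Section Estimates.
Context {R : realType} {U V W : normedModType R}.
Variables (alpha K : R) (F : W -> 'L(U, W)) (F0 : W -> W).
Variables (X : R -> V) (XX : R -> R -> tensor2 V) (Z : R -> U) (Z' : R -> 'L(V, U)).
Implicit Types (Y : R -> W) (a b s t u v : R).

Local Notation om := (om alpha).

(** The Gubinelli derivative of a solution, determined by its trace. *)
Definition gubinelli Y t : 'L(V, W) := clin_comp (F (Y t)) (Z' t).
Local Notation "Y ^'" := (gubinelli Y) (at level 1, format "Y ^'").

(** The coefficient of the second level of the driver in the germ. *)
Definition second_level Y t : 'L(tensor2 V, W) :=
  lift2 (clin_comp (Dtot F (Y t)) (Y^' t)) (Z' t).

Definition germ Y : R -> R -> W := rough_germ F XX Z Z' Y (Y^').

Definition path_rem Y : R -> R -> W := remainder X Y (Y^').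

Record driver_bounds a b : Prop := {
  dr_chen : forall s u t, s <= u -> u <= t ->
    XX s t = XX s u + XX u t + tens (incr X s u) (incr X u t) ;
  dr_X : forall s t, a <= s -> s < t -> t <= b -> `|incr X s t| <= K * om (t - s) ;
  dr_XX : forall s t, a <= s -> s < t -> t <= b -> `|XX s t| <= K * om (t - s) ^+ 2 ;
  dr_rem : forall s t, a <= s -> s < t -> t <= b ->
    `|remainder X Z Z' s t| <= K * om (t - s) ^+ 2 ;
  dr_incr : forall s t, a <= s -> s < t -> t <= b -> `|incr Z' s t| <= K * om (t - s) ;
  dr_Z' : forall t, a <= t -> t <= b -> `|Z' t| <= K }.

(** Solutions on an interval, without reference to a time 0: this is stable
    under restriction and under shifts of time. The bound [r] is arbitrary,
    only its existence is required. *)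
Record solves a b Y : Prop := {
  sv_rem : exists2 r, 0 <= r & forall s t, a <= s -> s < t -> t <= b ->
    `|path_rem Y s t| <= r * om (t - s) ^+ 2 ;
  sv_int : forall s t, a <= s -> s <= t -> t <= b -> exists I J : W,
    [/\ is_partition_limit (germ Y) s t I,
        is_partition_limit (drift_germ F0 Y) s t J & Y t - Y s = I + J] }.

Hypothesis (fdV : finite_dimensional V).
Hypotheses (alpha13 : 3^-1 < alpha) (alpha12 : alpha <= 2^-1).
Hypothesis (K2 : 2 <= K).
Hypothesis (Ksew : (1 - sewing_ratio alpha)^-1 <= K).
Hypothesis (Klift : bilinear_bound (@lift2 R U V W) K).
Hypothesis (vf : vector_field_bounds F F0 K).

Let K0 : 0 <= K. Proof. exact: le_trans K2. Qed.
Let K1 : 1 <= K. Proof. by apply: le_trans K2; rewrite ler1n. Qed.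

(** After Chen's relation, what is left are the second order remainder of
    [F] along the path, the controlled remainder of [Z], and the increment of
    the second level coefficient: each is small enough for a total of order
    [3 * alpha]. *)
Lemma germ_defect Y a b u m v : driver_bounds a b -> u <= m -> m <= v ->
  germ Y u v - germ Y u m - germ Y m v =
  - ((taylor1 F (Y u) (incr Y u m) + Dtot F (Y u) (path_rem Y u m)) (incr Z m v)
     + Dtot F (Y u) (Y^' u (incr X u m))
         (remainder X Z Z' m v + (Z' m - Z' u) (incr X m v))
     + (second_level Y m - second_level Y u) (XX m v)).
Proof.
move=> dr um mv.
rewrite /germ /rough_germ.
rewrite -!/(lift2 (clin_comp (Dtot F (Y _)) (Y^' _)) (Z' _)) -!/(second_level Y _).
rewrite (dr_chen dr um mv).
have sl_tens : second_level Y u (tens (incr X u m) (incr X m v)) =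
    Dtot F (Y u) (Y^' u (incr X u m)) (Z' u (incr X m v)).
  exact: (lift2_tens _ _ _ _ fdV).
have -> : incr Z u v = incr Z u m + incr Z m v by rewrite /incr; abelian.
have -> : remainder X Z Z' m v + (Z' m - Z' u) (incr X m v) =
    incr Z m v - Z' u (incr X m v) by rewrite /remainder clin_subE; abelian.
have -> : taylor1 F (Y u) (incr Y u m) + Dtot F (Y u) (path_rem Y u m) =
    F (Y m) - F (Y u) - Dtot F (Y u) (Y^' u (incr X u m)).
  rewrite /taylor1 /path_rem /remainder (clin_appB _ (incr Y u m) (Y^' u _)).
  have -> : Y u + incr Y u m = Y m by rewrite /incr; abelian.
  abelian.
have addE (A B : normedModType R) (f : 'L(A, B)) x y : f (x + y) = f x + f y.
  exact: raddfD.
move: sl_tens; move: (incr Z u m) (incr Z m v) (incr X u m) (incr X m v) => z1 z2 x1 x2 sl.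
rewrite clin_appB !addE sl !clin_subE; abelian.
Qed.

Lemma second_level_quad (Y1 Y2 : R -> W) u m (a s b z : R) :
  quad (F \o Y1) (F \o Y2) u m K a s b ->
  quad (Dtot F \o Y1) (Dtot F \o Y2) u m K a s b ->
  quad Z' Z' u m K z 0 0 ->
  quad (second_level Y1) (second_level Y2) u m (K * (K * (K * K) * K))
    (K * ((a * (K * K) + K * (a * K + K * z)) * K + K * (K * K) * z))
    (K * ((s * (K * K) + K * (s * K)) * K))
    (K * ((b * (K * K) + a * (s * K) + s * (a * K + K * z) + K * (b * K + s * z)) * K
          + (s * (K * K) + K * (s * K)) * z)).
Proof.
move=> qF qDF qZ.
have qY := quad_bilinear (bilinear_bound_comp _ _ _) qF qZ.
have qB := quad_bilinear (bilinear_bound_comp _ _ _) qDF qY.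
have := quad_bilinear Klift qB qZ.
by apply: quad_le; by_ring.
Qed.

Lemma gubinelli_le Y a b t : driver_bounds a b -> a <= t -> t <= b ->
  `|Y^' t| <= K * K.
Proof.
move=> dr at_ tb; have [_ _ _ /(_ (F (Y t)) (Z' t))] := bilinear_bound_comp V U W.
rewrite mul1r => /le_trans; apply; apply: ler_pM => //; first exact: vf_F vf _.
exact: dr_Z' dr _ _ _.
Qed.

Section OnePath.
Variables (a b : R) (Y : R -> W).
Hypothesis (dr : driver_bounds a b).

Section Step.
Variables (u m v r w : R).
Hypotheses (au : a <= u) (um : u < m) (mv : m < v) (vb : v <= b).
Hypotheses (w0 : 0 <= w) (w1 : w <= 1) (omw : om (v - u) <= w).

Let mb : m <= b. Proof. exact: ltW (lt_le_trans mv vb). Qed.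
Let am : a <= m. Proof. exact: le_trans au (ltW um). Qed.
Let omum : om (m - u) <= w.
Proof. by apply: le_trans omw; apply: (om_le alpha13); move: um mv; lra. Qed.
Let ommv : om (v - m) <= w.
Proof. by apply: le_trans omw; apply: (om_le alpha13); move: um mv; lra. Qed.

Lemma step_X : `|incr X u m| <= K * w /\ `|incr X m v| <= K * w.
Proof.
split; [have := dr_X dr au um mb|have := dr_X dr am mv vb];
  move=> /le_trans; apply; exact: ler_wpM2l.
Qed.

Lemma step_sqr (x y : R) : 0 <= x -> 0 <= y -> y <= w -> x * y ^+ 2 <= x * w ^+ 2.
Proof. by move=> x0 y0 yw; apply: ler_wpM2l => //; rewrite ler_pXn2r ?nnegrE. Qed.

Lemma step_XX : `|XX m v| <= K * w ^+ 2.
Proof.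
by apply: le_trans (dr_XX dr am mv vb) _; apply: step_sqr; rewrite ?om_ge0.
Qed.

Lemma step_rem : `|remainder X Z Z' m v| <= K * w ^+ 2.
Proof.
by apply: le_trans (dr_rem dr am mv vb) _; apply: step_sqr; rewrite ?om_ge0.
Qed.

Lemma step_Z'incr : `|Z' m - Z' u| <= K * w.
Proof. by apply: le_trans (dr_incr dr au um mb) _; exact: ler_wpM2l. Qed.

Lemma step_Z' : `|Z' u| <= K /\ `|Z' m| <= K.
Proof. by split; apply: (dr_Z' dr) => //; exact: le_trans (ltW um) mb. Qed.

Lemma step_Z : `|incr Z m v| <= K * (K * w) + K * w ^+ 2.
Proof.
have -> : incr Z m v = Z' m (incr X m v) + remainder X Z Z' m v.
  by rewrite /remainder; abelian.
apply: le_trans (ler_normD _ _) _; apply: lerD; last exact: step_rem.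
apply: le_trans (clin_le _ _) _; apply: ler_pM => //.
  exact: step_Z'.2.
exact: step_X.2.
Qed.

Lemma step_quadZ z : K * w <= z -> quad Z' Z' u m K z 0 0.
Proof.
move=> wz; apply: quad_cst; [exact: step_Z'.1|exact: step_Z'.2|].
exact: le_trans step_Z'incr wz.
Qed.

Lemma step_defect_Z' : `|remainder X Z Z' m v + (Z' m - Z' u) (incr X m v)|
  <= K * w ^+ 2 + K * w * (K * w).
Proof.
apply: le_trans (ler_normD _ _) _; apply: lerD; first exact: step_rem.
apply: le_trans (clin_le _ _) _; apply: ler_pM => //.
  exact: step_Z'incr.
exact: step_X.2.
Qed.

Lemma step_gubinelliX : `|Y^' u (incr X u m)| <= K * K * (K * w).
Proof.
apply: le_trans (clin_le _ _) _; apply: ler_pM => //.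
  by apply: (gubinelli_le Y dr au); exact: le_trans (ltW um) mb.
exact: step_X.1.
Qed.

Hypotheses (r0 : 0 <= r) (remY : `|path_rem Y u m| <= r * w ^+ 2).

Lemma step_incr : `|incr Y u m| <= K ^+ 3 * w + r * w ^+ 2.
Proof.
have -> : incr Y u m = Y^' u (incr X u m) + path_rem Y u m.
  by rewrite /path_rem /remainder; abelian.
apply: le_trans (ler_normD _ _) _; apply: lerD => //.
by apply: le_trans step_gubinelliX _; by_ring.
Qed.

Let x := 1 + r.
Let x0 : 0 <= x. Proof. by rewrite /x addr_ge0. Qed.
Let x1 : 1 <= x. Proof. by rewrite /x lerDl. Qed.
Let rx : r <= x. Proof. by rewrite /x lerDr. Qed.

Lemma step_incr_le : `|incr Y u m| <= K ^+ 4 * x * w.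
Proof.
apply: le_trans step_incr _.
apply: (@le_trans _ _ (K ^+ 3 * x * w + x * w ^+ 2)); last by mono K2 x0 w0 w1.
apply: lerD; last by apply: ler_wpM2r => //; rewrite exprn_ge0.
by apply: ler_wpM2r => //; rewrite ler_peMr// exprn_ge0.
Qed.

(** The quadratic bound of the Taylor remainder is used where the increment is
    dominated by its first order part, the linear one elsewhere, so that [r]
    enters linearly. *)
Lemma step_taylor : `|taylor1 F (Y u) (incr Y u m)| <= K ^+ 9 * x * w ^+ 2.
Proof.
set h := incr Y u m.
have hle := step_incr; rewrite -/h in hle.
have [qp|pq] := leP (r * w ^+ 2) (K ^+ 3 * w).
  apply: le_trans (vf_taylor_sqr vf _ _) _.
  have h2 : `|h| <= 2 * (K ^+ 3 * w).
    by rewrite (le_trans hle)// mulr2n mulrDl mul1r lerD2l.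
  apply: (@le_trans _ _ (K * (2 * (K ^+ 3 * w)) ^+ 2)).
    by apply: ler_wpM2l => //; rewrite ler_pXn2r ?nnegrE ?mulr_ge0 ?exprn_ge0.
  apply: (@le_trans _ _ (K * (2 * (K ^+ 3 * w)) ^+ 2 * x)).
    by rewrite ler_peMr// mulr_ge0// exprn_ge0// !mulr_ge0// exprn_ge0.
  by rewrite expr2; mono K2 x0 w0 w1.
apply: le_trans (vf_taylor_lip vf _ _) _.
have h2 : `|h| <= 2 * (x * w ^+ 2).
  rewrite (le_trans hle)// mulr2n mulrDl mul1r lerD//; last first.
    by rewrite ler_wpM2r// exprn_ge0.
  by rewrite (le_trans (ltW pq))// ler_wpM2r// exprn_ge0.
apply: (@le_trans _ _ (2 * K * (2 * (x * w ^+ 2)))).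
  by apply: ler_wpM2l => //; rewrite mulr_ge0.
by mono K2 x0 w0 w1.
Qed.

Lemma step_quadF (A : R) : `|incr Y u m| <= A ->
  quad (F \o Y) (F \o Y) u m K (K * A) 0 0 /\
  quad (Dtot F \o Y) (Dtot F \o Y) u m K (K * A) 0 0.
Proof.
move=> YA; split; apply: quad_cst.
- exact: (vf_F vf (Y u)).
- exact: (vf_F vf (Y m)).
- by apply: le_trans (vf_Flip vf _ _) _; exact: ler_wpM2l.
- exact: (vf_DF vf (Y u)).
- exact: (vf_DF vf (Y m)).
- by apply: le_trans (vf_DFlip vf _ _) _; exact: ler_wpM2l.
Qed.

(** All terms are bounded by monomials in [K], [1 + r] and [w]. Here and below
    the exponents of [K] are merely large enough. *)
Lemma step_germ_defect :
  `|germ Y u v - germ Y u m - germ Y m v| <= K ^+ 20 * x * w ^+ 3.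
Proof.
rewrite (germ_defect _ dr (ltW um) (ltW mv)) normrN.
have t1 : `|(taylor1 F (Y u) (incr Y u m) + Dtot F (Y u) (path_rem Y u m)) (incr Z m v)|
    <= (K ^+ 9 * x * w ^+ 2 + K * (x * w ^+ 2)) * (K * (K * w) + K * w ^+ 2).
  apply: le_trans (clin_le _ _) _; apply: ler_pM => //; last exact: step_Z.
  apply: le_trans (ler_normD _ _) _; apply: lerD; first exact: step_taylor.
  apply: le_trans (clin_le _ _) _; apply: ler_pM => //; first exact: vf_DF vf _.
  by apply: le_trans remY _; apply: ler_wpM2r => //; rewrite exprn_ge0.
have t2 : `|Dtot F (Y u) (Y^' u (incr X u m))
         (remainder X Z Z' m v + (Z' m - Z' u) (incr X m v))| <=
    K * (K * K * (K * w)) * (K * w ^+ 2 + K * w * (K * w)) * x.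
  apply: (@le_trans _ _ (K * (K * K * (K * w)) * (K * w ^+ 2 + K * w * (K * w)))).
    apply: le_trans (clin_le _ _) _; apply: ler_pM => //; last exact: step_defect_Z'.
    apply: le_trans (clin_le _ _) _; apply: ler_pM => //; first exact: vf_DF vf _.
    exact: step_gubinelliX.
  by rewrite ler_peMr// mulr_ge0// ?addr_ge0// ?mulr_ge0// exprn_ge0.
have [qF qDF] := step_quadF step_incr_le.
have qZ : quad Z' Z' u m K (K * (x * w)) 0 0.
  by apply: step_quadZ; apply: ler_wpM2l => //; rewrite ler_peMl.
have [_ [t3 _] _ _] := second_level_quad qF qDF qZ.
have {}t3 := le_trans (clin_le _ (XX m v)) (ler_pM (normr_ge0 _) (normr_ge0 _) t3 step_XX).
apply: le_trans (ler_normD _ _) _.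
apply: le_trans (lerD (le_trans (ler_normD _ _) (lerD t1 t2)) t3) _.
by mono K2 x0 w0 w1.
Qed.

End Step.
End OnePath.

(** The exponent exceeds those of the sewing errors, so that these are absorbed
    on such an interval. *)
Definition is_short a b : Prop := b - a <= 1 /\ K ^+ 40 * om (b - a) <= 1.

Lemma short_sub a b s t : is_short a b -> a <= s -> s <= t -> t <= b -> is_short s t.
Proof.
move=> [ab1 abK] as_ st tb; split; first by lra.
apply: le_trans abK; apply: ler_wpM2l; first exact: exprn_ge0.
by apply: (om_le alpha13); lra.
Qed.

Lemma short_om1 a b : a <= b -> is_short a b -> om (b - a) <= 1.
Proof. by move=> ab [ab1 _]; apply: (om_le1 alpha13); lra. Qed.

Lemma short_pow a b n : (n < 40)%N -> is_short a b -> K ^+ n * om (b - a) <= 2^-1.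
Proof.
move=> n40 [_ abK].
have : K ^+ n.+1 * om (b - a) <= 1.
  by apply: le_trans abK; rewrite ler_wpM2r ?om_ge0// ler_weXn2l.
rewrite exprS -mulrA; set y := K ^+ n * _ => Ky.
have y0 : 0 <= y by rewrite mulr_ge0 ?om_ge0// exprn_ge0.
by rewrite -[leRHS]mul1r ler_pdivlMr// mulrC (le_trans _ Ky)// ler_wpM2r.
Qed.

Lemma drift_bound Y s t J : s <= t ->
  is_partition_limit (drift_germ F0 Y) s t J -> `|J| <= K * (t - s).
Proof.
move=> st lJ; have := @partition_limit_bound _ _ _ s t J 0 K st _ lJ.
rewrite scaler0 subr0; apply => u v _ uv _.
rewrite /drift_germ scaler0 subr0 normrZ gtr0_norm ?subr_gt0// mulrC.
by rewrite ler_wpM2r ?(vf_F0 vf)// subr_ge0 ltW.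
Qed.

Lemma rem_expand Y s t I J : Y t - Y s = I + J ->
  path_rem Y s t = (I - germ Y s t) + J + F (Y s) (remainder X Z Z' s t)
              + second_level Y s (XX s t).
Proof.
move=> IJ.
have -> : germ Y s t = F (Y s) (incr Z s t) + second_level Y s (XX s t) by [].
have -> : F (Y s) (remainder X Z Z' s t) =
    F (Y s) (incr Z s t) - Y^' s (incr X s t).
  by rewrite /remainder (clin_appB _ (incr Z s t) (Z' s _)).
by rewrite /path_rem /remainder {1}/incr IJ; abelian.
Qed.

Section OnePathBounds.
Variables (a b : R) (Y : R -> W).
Hypothesis (dr : driver_bounds a b).

Definition rem_bound (r : R) := forall s t, a <= s -> s < t -> t <= b ->
  `|path_rem Y s t| <= r * om (t - s) ^+ 2.

Lemma rem_bound_sub r u m v : rem_bound r -> 0 <= r -> a <= u -> u < m -> m < v ->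
  v <= b -> `|path_rem Y u m| <= r * om (v - u) ^+ 2.
Proof.
move=> rY r0 au um mv vb; apply: le_trans (rY _ _ au um _) _; first lra.
apply: step_sqr => //; rewrite ?om_ge0//; apply: (om_le alpha13); lra.
Qed.

Lemma germ_sewing r s t I : is_short a b -> rem_bound r -> 0 <= r ->
  a <= s -> s < t -> t <= b -> is_partition_limit (germ Y) s t I ->
  `|I - germ Y s t| <= K ^+ 21 * (1 + r) * om (t - s) ^+ 3.
Proof.
move=> sab rY r0 as_ st tb lI.
have x0 : 0 <= 1 + r by rewrite addr_ge0.
have k0 : 0 <= K ^+ 20 * (1 + r) by rewrite mulr_ge0// exprn_ge0.
apply: (@le_trans _ _ (K ^+ 20 * (1 + r) / (1 - sewing_ratio alpha) * om (t - s) ^+ 3)).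
  apply: (@sewing_estimate _ _ (germ Y) s t I (fun d => om d ^+ 3)) => //.
  - exact: sewing_ratio_lt1.
  - by move=> d d0 _; exact: om_halve.
  - by move=> d _; rewrite exprn_ge0// om_ge0.
  move=> u m v su um mv vt.
  have au := le_trans as_ su; have vb := le_trans vt tb.
  apply: (@step_germ_defect a b Y dr u m v r (om (v - u))) => //.
  - exact: om_ge0.
  - apply: (om_le1 alpha13); first lra.
    by case: sab => ab1 _; lra.
  - exact: (@rem_bound_sub _ u m v).
apply: ler_wpM2r; first by rewrite exprn_ge0// om_ge0.
have -> : K ^+ 21 * (1 + r) = K ^+ 20 * (1 + r) * K by ring.
exact: ler_wpM2l.
Qed.

Lemma second_level_le s : a <= s -> s <= b -> `|second_level Y s| <= K ^+ 5.
Proof.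
move=> as_ sb.
have [_ _ _ /(_ (clin_comp (Dtot F (Y s)) (Y^' s)) (Z' s)) h] := Klift.
apply: le_trans h _.
have [_ _ _ /(_ (Dtot F (Y s)) (Y^' s))] := bilinear_bound_comp V W 'L(U, W).
rewrite mul1r => h.
have {}h := le_trans h (ler_pM (normr_ge0 _) (normr_ge0 _) (vf_DF vf _)
  (gubinelli_le Y dr as_ sb)).
apply: le_trans (ler_pM _ _ (ler_wpM2l K0 h) (dr_Z' dr as_ sb)) _ => //.
  by rewrite mulr_ge0.
by_ring.
Qed.

(** In the expansion of the remainder the unknown bound [r] comes only with the
    sewing error, which carries an additional factor [om (t - s)], small on a
    short interval. *)
Lemma rem_apriori : is_short a b -> solves a b Y -> rem_bound (K ^+ 9).
Proof.
move=> sab sv; have [r0 r00 rY0] := sv_rem sv.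
have half s t : a <= s -> s < t -> t <= b ->
  `|path_rem Y s t| <= 2 * (K ^+ 8 / 2) * om (t - s) ^+ 2.
  move=> as_ st tb.
  pose P (p : R * R) := [/\ a <= p.1, p.1 < p.2 & p.2 <= b].
  apply: (@absorb_half R _ P (fun p => `|path_rem Y p.1 p.2|)
    (fun p => om (p.2 - p.1) ^+ 2) (K ^+ 8 / 2) r0 r00 _ _ _ _ (s, t)) => //.
  - by rewrite divr_ge0// exprn_ge0.
  - by move=> p _; rewrite exprn_ge0// om_ge0.
  - by move=> p [p1 p2 p3]; exact: rY0.
  move=> r r_ge0 rY [{as_ st tb}s {}t] [/= as_ st tb].
  have [I [J [lI lJ IJ]]] := sv_int sv as_ (ltW st) tb.
  rewrite (rem_expand IJ).
  have sst : is_short s t by apply: (short_sub sab) => //; exact: ltW.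
  set w := om (t - s).
  have w0 : 0 <= w by exact: om_ge0.
  have w1 : w <= 1 by apply: short_om1 => //; exact: ltW.
  have e1 : `|I - germ Y s t| <= (1 + r) / 2 * w ^+ 2.
    apply: le_trans (@germ_sewing r s t I sab _ r_ge0 as_ st tb lI) _.
      by move=> s' t' h1 h2 h3; exact: (rY (s', t')).
    have := @short_pow s t 21 isT sst; rewrite -/w => h.
    have -> : K ^+ 21 * (1 + r) * w ^+ 3 = (1 + r) * (K ^+ 21 * w) * w ^+ 2 by ring.
    by rewrite ler_wpM2r ?exprn_ge0// ler_wpM2l// addr_ge0.
  have e2 : `|J| <= K * w ^+ 2.
    apply: le_trans (drift_bound (ltW st) lJ) _; apply: ler_wpM2l => //.
    by apply: le_om_sqr => //; case: sst => ? _; lra.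
  have e3 : `|F (Y s) (remainder X Z Z' s t)| <= K ^+ 2 * w ^+ 2.
    apply: le_trans (clin_le _ _) _.
    apply: le_trans (ler_pM _ _ (vf_F vf _) (dr_rem dr as_ st tb)) _ => //.
    by rewrite mulrA.
  have e4 : `|second_level Y s (XX s t)| <= K ^+ 6 * w ^+ 2.
    apply: le_trans (clin_le _ _) _.
    apply: le_trans (ler_pM _ _ (second_level_le as_ _) (dr_XX dr as_ st tb)) _ => //.
      by apply: le_trans tb; exact: ltW.
    by rewrite mulrA -exprSr.
  apply: (@le_trans _ _ ((1 + r) / 2 * w ^+ 2 + K * w ^+ 2 + K ^+ 2 * w ^+ 2 +
    K ^+ 6 * w ^+ 2)).
    by do 3!(apply: le_trans (ler_normD _ _) _; apply: lerD => //).
  rewrite -!mulrDl; apply: ler_wpM2r; first by rewrite exprn_ge0.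
  have : 2 * (1 + K + K ^+ 2 + K ^+ 6) <= K ^+ 8 by mono K2 w0 w0 w1.
  lra.
move=> s t as_ st tb; apply: le_trans (half s t as_ st tb) _.
apply: ler_wpM2r; first by rewrite exprn_ge0// om_ge0.
by rewrite mulrC divfK// ler_weXn2l.
Qed.

End OnePathBounds.

Section TwoPaths.
Variables (a b : R) (Y1 Y2 : R -> W).
Hypotheses (dr : driver_bounds a b) (sab : is_short a b).
Hypotheses (sv1 : solves a b Y1) (sv2 : solves a b Y2).

Section DiffStep.
Variables (u m v S rho : R).
Hypotheses (au : a <= u) (um : u < m) (mv : m < v) (vb : v <= b).
Let w := om (v - u).
Hypotheses (S0 : 0 <= S) (rho0 : 0 <= rho).
Hypothesis (DS : forall t, a <= t -> t <= b -> `|Y1 t - Y2 t| <= S).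
Hypothesis (Drho : `|path_rem Y1 u m - path_rem Y2 u m| <= rho * w ^+ 2).
Let x := S + rho.

Let w0 : 0 <= w. Proof. exact: om_ge0. Qed.
Let suv : is_short u v.
Proof. by apply: (short_sub sab) => //; move: um mv; lra. Qed.
Let w1 : w <= 1.
Proof. by apply: short_om1 => //; move: um mv; lra. Qed.
Let x0 : 0 <= x. Proof. by rewrite addr_ge0. Qed.
Let Sx : S <= x. Proof. by rewrite lerDl. Qed.
Let rx : rho <= x. Proof. by rewrite lerDr. Qed.
Let ub : u <= b. Proof. by move: um mv vb; lra. Qed.
Let am : a <= m. Proof. by move: au um; lra. Qed.
Let mb : m <= b. Proof. by move: mv vb; lra. Qed.

Lemma path_incr_le Y : solves a b Y -> `|incr Y u m| <= K ^+ 4 * w.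
Proof.
move=> sv; have rY := rem_apriori dr sab sv.
have K90 : 0 <= K ^+ 9 by rewrite exprn_ge0.
have remY : `|path_rem Y u m| <= K ^+ 9 * w ^+ 2 by apply: (rem_bound_sub rY K90 au um mv vb).
have := @step_incr a b Y dr u m v (K ^+ 9) w au um mv vb (lexx _) remY.
move=> /le_trans; apply.
have h := @short_pow u v 9 isT suv; rewrite -/w in h.
apply: (@le_trans _ _ (K ^+ 3 * w + 1 * w)).
  rewrite lerD2l expr2 mulrA; apply: ler_wpM2r => //; lra.
by mono K2 w0 w0 w1.
Qed.

Lemma gubinelli_diff t : a <= t -> t <= b -> `|Y1^' t - Y2^' t| <= K * S * K.
Proof.
move=> at_ tb.
have [_ mB _ mle] := bilinear_bound_comp V U W.
rewrite /gubinelli -mB (le_trans (mle _ _))// mul1r; apply: ler_pM => //.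
  by apply: le_trans (vf_Flip vf _ _) _; apply: ler_wpM2l => //; exact: DS.
exact: dr_Z' dr _ _ _.
Qed.

Lemma diff_incr_le : `|incr Y1 u m - incr Y2 u m| <= K ^+ 4 * x * w.
Proof.
have -> : incr Y1 u m - incr Y2 u m =
    (Y1^' u - Y2^' u) (incr X u m) + (path_rem Y1 u m - path_rem Y2 u m).
  by rewrite clin_subE /path_rem /remainder; abelian.
apply: le_trans (ler_normD _ _) _.
apply: (@le_trans _ _ (K * x * K * (K * w) + x * w ^+ 2)); last by mono K2 x0 w0 w1.
apply: lerD; last by apply: le_trans Drho _; apply: ler_wpM2r => //; rewrite exprn_ge0.
apply: le_trans (clin_le _ _) _; apply: ler_pM => //; last first.
  exact: (@step_X a b dr u m v w au um mv vb (lexx _)).1.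
apply: le_trans (gubinelli_diff au ub) _.
by apply: ler_wpM2r => //; exact: ler_wpM2l.
Qed.

Lemma diff_quad (E : normedModType R) (f : W -> E) :
  (forall y, `|f y| <= K) -> (forall y z, `|f y - f z| <= K * `|y - z|) ->
  (forall x1 h1 x2 h2,
    `|incr2 f x1 h1 x2 h2| <= K * (`|h1| * `|x1 - x2| + `|h1 - h2|)) ->
  quad (f \o Y1) (f \o Y2) u m K (K * (K ^+ 4 * w)) (K * x)
    (K * (K ^+ 4 * w * x + K ^+ 4 * x * w)).
Proof.
move=> fK flip fincr2.
have lip1 Y : solves a b Y -> `|f (Y m) - f (Y u)| <= K * (K ^+ 4 * w).
  move=> sv; apply: le_trans (flip _ _) _; apply: ler_wpM2l => //.
  exact: path_incr_le sv.
have lip2 t : a <= t -> t <= b -> `|f (Y1 t) - f (Y2 t)| <= K * x.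
  move=> at_ tb; apply: le_trans (flip _ _) _; apply: ler_wpM2l => //.
  by apply: le_trans Sx; exact: DS.
split=> /=; [by split|by split; exact: lip1|by split; exact: lip2|].
have mE Y : Y m = Y u + incr Y u m by rewrite /incr; abelian.
rewrite (mE Y1) (mE Y2); apply: le_trans (fincr2 _ _ _ _) _; apply: ler_wpM2l => //.
apply: lerD; last exact: diff_incr_le.
apply: ler_pM => //; first exact: path_incr_le sv1.
by apply: le_trans Sx; exact: DS.
Qed.

Lemma DF_diff t : a <= t -> t <= b -> `|Dtot F (Y1 t) - Dtot F (Y2 t)| <= K * x.
Proof.
move=> at_ tb; apply: le_trans (vf_DFlip vf _ _) _; apply: ler_wpM2l => //.
by apply: le_trans Sx; exact: DS.
Qed.

(** The same three terms as for one solution, with every product compared by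
    the Leibniz rule for double increments; the scale is the sum of the
    supremum [S] of the difference and of the bound [rho] of its remainder. *)
Lemma diff_germ_defect :
  `|(germ Y1 u v - germ Y2 u v) - (germ Y1 u m - germ Y2 u m)
    - (germ Y1 m v - germ Y2 m v)| <= K ^+ 28 * x * w ^+ 3.
Proof.
pose A Y := (taylor1 F (Y u) (incr Y u m) + Dtot F (Y u) (path_rem Y u m)) (incr Z m v).
pose B Y := Dtot F (Y u) (Y^' u (incr X u m))
         (remainder X Z Z' m v + (Z' m - Z' u) (incr X m v)).
pose C Y := (second_level Y m - second_level Y u) (XX m v).
have -> : germ Y1 u v - germ Y2 u v - (germ Y1 u m - germ Y2 u m)
    - (germ Y1 m v - germ Y2 m v) = - ((A Y1 - A Y2) + (B Y1 - B Y2) + (C Y1 - C Y2)).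
  have d1 := germ_defect Y1 dr (ltW um) (ltW mv).
  have d2 := germ_defect Y2 dr (ltW um) (ltW mv).
  transitivity ((germ Y1 u v - germ Y1 u m - germ Y1 m v) -
    (germ Y2 u v - germ Y2 u m - germ Y2 m v)); first by abelian.
  by rewrite d1 d2 -/(A Y1) -/(B Y1) -/(C Y1) -/(A Y2) -/(B Y2) -/(C Y2); abelian.
rewrite normrN.
have hZ := @step_Z a b dr u m v w au um mv vb w0 (lexx _).
have hXX := @step_XX a b dr u m v w au um mv vb w0 (lexx _).
have hX := (@step_X a b dr u m v w au um mv vb (lexx _)).1.
have hD := @step_defect_Z' a b dr u m v w au um mv vb w0 (lexx _).
have i1 := path_incr_le sv1; have i2 := path_incr_le sv2.
have r1 : `|path_rem Y1 u m| <= K ^+ 9 * w ^+ 2.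
  apply: (rem_bound_sub _ _ au um mv vb); last by rewrite exprn_ge0.
  exact: rem_apriori.
have h1 : `|A Y1 - A Y2| <=
  (K * (K ^+ 4 * w * x + K ^+ 4 * x * w) * (K ^+ 4 * w)
     + K * (K ^+ 4 * w) * (K ^+ 4 * x * w)
   + (K * x * (K ^+ 9 * w ^+ 2) + K * (x * w ^+ 2))) * (K * (K * w) + K * w ^+ 2).
  rewrite /A -clin_subE; apply: le_trans (clin_le _ _) _; apply: ler_pM => //.
  rewrite opprD addrACA; apply: le_trans (ler_normD _ _) _; apply: lerD.
    apply: le_trans (vf_taylor_diff vf _ _ _ _) _.
    have h : K * (`|incr Y1 u m| * `|Y1 u - Y2 u| + `|incr Y1 u m - incr Y2 u m|)
        <= K * (K ^+ 4 * w * x + K ^+ 4 * x * w).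
      apply: ler_wpM2l => //; apply: lerD; last exact: diff_incr_le.
      by apply: ler_pM => //; apply: le_trans Sx; exact: DS.
    apply: lerD; last by apply: ler_pM; rewrite ?mulr_ge0//;
      [exact: ler_wpM2l|exact: diff_incr_le].
    by apply: ler_pM => //; rewrite mulr_ge0// addr_ge0// mulr_ge0.
  have -> : Dtot F (Y1 u) (path_rem Y1 u m) - Dtot F (Y2 u) (path_rem Y2 u m) =
      (Dtot F (Y1 u) - Dtot F (Y2 u)) (path_rem Y1 u m)
      + Dtot F (Y2 u) (path_rem Y1 u m - path_rem Y2 u m).
    by rewrite clin_subE (clin_appB _ (path_rem Y1 u m)); abelian.
  apply: le_trans (ler_normD _ _) _; apply: lerD;
    apply: le_trans (clin_le _ _) _; apply: ler_pM => //.
  - exact: DF_diff.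
  - exact: vf_DF vf _.
  by apply: le_trans Drho _; apply: ler_wpM2r => //; rewrite exprn_ge0.
have h2 : `|B Y1 - B Y2| <= (K * x * (K * K * (K * w)) + K * (K * x * K * (K * w)))
    * (K * w ^+ 2 + K * w * (K * w)).
  rewrite /B -clin_subE; apply: le_trans (clin_le _ _) _; apply: ler_pM => //.
  have -> : Dtot F (Y1 u) (Y1^' u (incr X u m)) - Dtot F (Y2 u) (Y2^' u (incr X u m)) =
      (Dtot F (Y1 u) - Dtot F (Y2 u)) (Y1^' u (incr X u m))
      + Dtot F (Y2 u) ((Y1^' u - Y2^' u) (incr X u m)).
    by rewrite !clin_subE (clin_appB _ (Y1^' u _)); abelian.
  apply: le_trans (ler_normD _ _) _; apply: lerD;
    apply: le_trans (clin_le _ _) _; apply: ler_pM => //.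
  - exact: DF_diff.
  - exact: (@step_gubinelliX a b Y1 dr u m v w au um mv vb (lexx _)).
  - exact: vf_DF vf _.
  apply: le_trans (clin_le _ _) _; apply: ler_pM => //.
  apply: le_trans (gubinelli_diff au ub) _.
  by apply: ler_wpM2r => //; exact: ler_wpM2l.
have qF := diff_quad (vf_F vf) (vf_Flip vf) (vf_Fincr2 vf).
have qDF := diff_quad (vf_DF vf) (vf_DFlip vf) (vf_DFincr2 vf).
have qZ := @step_quadZ a b dr u m v w au um mv vb (lexx _) (K * w) (lexx _).
have [_ _ _ h3] := second_level_quad qF qDF qZ.
have h4 : `|C Y1 - C Y2| <= `|second_level Y1 m - second_level Y1 u -
    (second_level Y2 m - second_level Y2 u)| * `|XX m v|.
  by rewrite /C -clin_subE; exact: clin_le.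
have {}h4 := le_trans h4 (ler_pM (normr_ge0 _) (normr_ge0 _) h3 hXX).
apply: le_trans (ler_normD _ _) _.
apply: le_trans (lerD (le_trans (ler_normD _ _) (lerD h1 h2)) h4) _.
by mono K2 x0 w0 w1.
Qed.

End DiffStep.

Lemma diff_sewing (S rho : R) s t I1 I2 : 0 <= S -> 0 <= rho ->
  (forall t, a <= t -> t <= b -> `|Y1 t - Y2 t| <= S) ->
  (forall s t, a <= s -> s < t -> t <= b ->
     `|path_rem Y1 s t - path_rem Y2 s t| <= rho * om (t - s) ^+ 2) ->
  a <= s -> s < t -> t <= b ->
  is_partition_limit (germ Y1) s t I1 -> is_partition_limit (germ Y2) s t I2 ->
  `|I1 - I2 - (germ Y1 s t - germ Y2 s t)| <= K ^+ 29 * (S + rho) * om (t - s) ^+ 3.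
Proof.
move=> S0 rho0 DS Dr as_ st tb l1 l2.
have x0 : 0 <= S + rho by rewrite addr_ge0.
have k0 : 0 <= K ^+ 28 * (S + rho) by rewrite mulr_ge0// exprn_ge0.
apply: (@le_trans _ _ (K ^+ 28 * (S + rho) / (1 - sewing_ratio alpha) * om (t - s) ^+ 3)).
  apply: (@sewing_estimate _ _ (fun u v => germ Y1 u v - germ Y2 u v) s t _
    (fun d => om d ^+ 3)) => //; last exact: partition_limitB.
  - exact: sewing_ratio_lt1.
  - by move=> d d0 _; exact: om_halve.
  - by move=> d _; rewrite exprn_ge0// om_ge0.
  move=> u m v su um mv vt.
  have au := le_trans as_ su; have vb := le_trans vt tb.
  apply: diff_germ_defect => //.
  apply: le_trans (Dr u m au um _) _; first lra.
  apply: step_sqr => //; rewrite ?om_ge0//; apply: (om_le alpha13); lra.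
apply: ler_wpM2r; first by rewrite exprn_ge0// om_ge0.
have -> : K ^+ 29 * (S + rho) = K ^+ 28 * (S + rho) * K by ring.
exact: ler_wpM2l.
Qed.

Lemma second_level_diff t (S : R) : a <= t -> t <= b -> `|Y1 t - Y2 t| <= S ->
  `|second_level Y1 t - second_level Y2 t| <=
  K * ((K * S * (K * K) + K * (K * S * K)) * K).
Proof.
move=> at_ tb DS.
have S0 : 0 <= S by exact: le_trans DS.
(* double increments over the degenerate interval from [t] to [t] *)
have q (E : normedModType R) (f : W -> E) : (forall y, `|f y| <= K) ->
    (forall y z, `|f y - f z| <= K * `|y - z|) ->
    quad (f \o Y1) (f \o Y2) t t K 0 (K * S) 0.
  move=> fK flip; have h : `|f (Y1 t) - f (Y2 t)| <= K * S.
    by apply: le_trans (flip _ _) _; exact: ler_wpM2l.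
  split=> /=; [by split; exact: fK|by rewrite !subrr normr0|by split|].
  by rewrite !subrr normr0.
have qF := q _ _ (vf_F vf) (vf_Flip vf).
have qDF := q _ _ (vf_DF vf) (vf_DFlip vf).
have qZ : quad Z' Z' t t K 0 0 0.
  by apply: quad_cst; rewrite ?subrr ?normr0//; exact: dr_Z' dr _ _ _.
by have [_ _ [h _] _] := second_level_quad qF qDF qZ.
Qed.

(** The drift of the difference is only Lipschitz in its supremum, as [F0] has
    one derivative: it is bounded directly, outside the sewing estimate. *)
Lemma diff_rem (S : R) : 0 <= S ->
  (forall t, a <= t -> t <= b -> `|Y1 t - Y2 t| <= S) ->
  forall s t, a <= s -> s < t -> t <= b ->
    `|path_rem Y1 s t - path_rem Y2 s t| <= K ^+ 12 * S * om (t - s) ^+ 2.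
Proof.
move=> S0 DS s t as_ st tb.
pose P (p : R * R) := [/\ a <= p.1, p.1 < p.2 & p.2 <= b].
have -> : K ^+ 12 * S = 2 * (K ^+ 12 * S / 2) by rewrite [RHS]mulrC divfK.
have r00 : 0 <= K ^+ 9 + K ^+ 9 by rewrite addr_ge0// exprn_ge0.
apply: (@absorb_half R _ P (fun p => `|path_rem Y1 p.1 p.2 - path_rem Y2 p.1 p.2|)
    (fun p => om (p.2 - p.1) ^+ 2) (K ^+ 12 * S / 2) _ r00 _ _ _ _ (s, t)) => //.
- by rewrite divr_ge0// mulr_ge0// exprn_ge0.
- by move=> p _; rewrite exprn_ge0// om_ge0.
- move=> [{as_ st tb}s {}t] [/= as_ st tb].
  rewrite mulrDl; apply: le_trans (ler_normB _ _) _; apply: lerD.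
    exact: (rem_apriori dr sab sv1).
  exact: (rem_apriori dr sab sv2).
move=> r r_ge0 rY [{as_ st tb}s {}t] [/= as_ st tb].
have [I1 [J1 [lI1 lJ1 IJ1]]] := sv_int sv1 as_ (ltW st) tb.
have [I2 [J2 [lI2 lJ2 IJ2]]] := sv_int sv2 as_ (ltW st) tb.
have sst : is_short s t by apply: (short_sub sab) => //; exact: ltW.
have sb : s <= b by lra.
have Ss := DS _ as_ sb.
rewrite (rem_expand IJ1) (rem_expand IJ2).
set w := om (t - s).
have w0 : 0 <= w by exact: om_ge0.
have w1 : w <= 1 by apply: short_om1 => //; exact: ltW.
have -> : I1 - germ Y1 s t + J1 + F (Y1 s) (remainder X Z Z' s t)
      + second_level Y1 s (XX s t) -
    (I2 - germ Y2 s t + J2 + F (Y2 s) (remainder X Z Z' s t)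
      + second_level Y2 s (XX s t)) =
  (I1 - I2 - (germ Y1 s t - germ Y2 s t)) + (J1 - J2)
   + (F (Y1 s) - F (Y2 s)) (remainder X Z Z' s t)
   + (second_level Y1 s - second_level Y2 s) (XX s t).
  by rewrite !clin_subE; abelian.
have e1 : `|I1 - I2 - (germ Y1 s t - germ Y2 s t)| <= (S + r) / 2 * w ^+ 2.
  have DR s' t' : a <= s' -> s' < t' -> t' <= b ->
      `|path_rem Y1 s' t' - path_rem Y2 s' t'| <= r * om (t' - s') ^+ 2.
    by move=> h1 h2 h3; exact: (rY (s', t')).
  apply: le_trans (diff_sewing S0 r_ge0 DS DR as_ st tb lI1 lI2) _.
  have := @short_pow s t 29 isT sst; rewrite -/w => h.
  have -> : K ^+ 29 * (S + r) * w ^+ 3 = (S + r) * (K ^+ 29 * w) * w ^+ 2 by ring.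
  by rewrite ler_wpM2r ?exprn_ge0// ler_wpM2l// addr_ge0.
have e2 : `|J1 - J2| <= K * S * w ^+ 2.
  have := @partition_limit_bound _ _ _ s t (J1 - J2) 0 (K * S) (ltW st) _
    (partition_limitB lJ1 lJ2).
  rewrite scaler0 subr0 => /(_ _)/le_trans; apply.
    move=> u v su uv vt; rewrite /drift_germ scaler0 subr0 -scalerBr normrZ mulrC.
    rewrite gtr0_norm ?subr_gt0//; apply: ler_wpM2r; first by rewrite subr_ge0 ltW.
    apply: le_trans (vf_F0lip vf _ _) _; apply: ler_wpM2l => //.
    by apply: DS; lra.
  apply: ler_wpM2l; first by rewrite mulr_ge0.
  by apply: le_om_sqr => //; case: sst => ? _; lra.
have e3 : `|(F (Y1 s) - F (Y2 s)) (remainder X Z Z' s t)| <= K * S * K * w ^+ 2.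
  apply: le_trans (clin_le _ _) _; rewrite -mulrA; apply: ler_pM => //.
    by apply: le_trans (vf_Flip vf _ _) _; exact: ler_wpM2l.
  exact: dr_rem dr _ _ as_ st tb.
have e4 : `|(second_level Y1 s - second_level Y2 s) (XX s t)| <=
    K * ((K * S * (K * K) + K * (K * S * K)) * K) * (K * w ^+ 2).
  apply: le_trans (clin_le _ _) _; apply: ler_pM => //.
    exact: second_level_diff.
  exact: dr_XX dr _ _ as_ st tb.
apply: (@le_trans _ _ ((S + r) / 2 * w ^+ 2 + K * S * w ^+ 2 + K * S * K * w ^+ 2 +
  K * ((K * S * (K * K) + K * (K * S * K)) * K) * (K * w ^+ 2))).
  by do 3!(apply: le_trans (ler_normD _ _) _; apply: lerD => //).
have : 2 * (S + (K * S + K * S * K +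
   K * ((K * S * (K * K) + K * (K * S * K)) * K) * K)) <= K ^+ 12 * S.
  by mono K2 S0 w0 w1.
set B := K * ((K * S * (K * K) + K * (K * S * K)) * K) => h.
have -> : (S + r) / 2 * w ^+ 2 + K * S * w ^+ 2 + K * S * K * w ^+ 2
    + B * (K * w ^+ 2) =
  ((S + r) / 2 + K * S + K * S * K + B * K) * w ^+ 2 by ring.
by apply: ler_wpM2r; [rewrite exprn_ge0|lra].
Qed.

Lemma diff_incr (S : R) : 0 <= S ->
  (forall t, a <= t -> t <= b -> `|Y1 t - Y2 t| <= S) ->
  forall s t, a <= s -> s < t -> t <= b ->
    `|(Y1 t - Y2 t) - (Y1 s - Y2 s)| <= K ^+ 13 * S * om (t - s).
Proof.
move=> S0 DS s t as_ st tb.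
have sst : is_short s t by apply: (short_sub sab) => //; exact: ltW.
have sb : s <= b by lra.
set w := om (t - s).
have w0 : 0 <= w by exact: om_ge0.
have w1 : w <= 1 by apply: short_om1 => //; exact: ltW.
have -> : Y1 t - Y2 t - (Y1 s - Y2 s) =
    (Y1^' s - Y2^' s) (incr X s t) + (path_rem Y1 s t - path_rem Y2 s t).
  rewrite clin_subE /path_rem /remainder.
  by rewrite -[incr Y1 s t]/(Y1 t - Y1 s) -[incr Y2 s t]/(Y2 t - Y2 s); abelian.
apply: le_trans (ler_normD _ _) _.
apply: (@le_trans _ _ (K * S * K * (K * w) + K ^+ 12 * S * w ^+ 2)).
  apply: lerD; last exact: diff_rem.
  apply: le_trans (clin_le _ _) _; apply: ler_pM => //.
    exact: gubinelli_diff.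
  exact: dr_X dr _ _ as_ st tb.
by mono K2 S0 w0 w1.
Qed.

Lemma path_incr Y s t : solves a b Y -> a <= s -> s < t -> t <= b ->
  `|Y t - Y s| <= K ^+ 4 * om (t - s).
Proof.
move=> sv as_ st tb.
have sst : is_short s t by apply: (short_sub sab) => //; exact: ltW.
have sb : s <= b by lra.
set w := om (t - s).
have w0 : 0 <= w by exact: om_ge0.
have w1 : w <= 1 by apply: short_om1 => //; exact: ltW.
have -> : Y t - Y s = Y^' s (incr X s t) + path_rem Y s t.
  by rewrite /path_rem /remainder -[incr Y s t]/(Y t - Y s); abelian.
apply: le_trans (ler_normD _ _) _.
have h := @short_pow s t 9 isT sst; rewrite -/w in h.
apply: (@le_trans _ _ (K * K * (K * w) + 1 * w)); last by mono K2 w0 w0 w1.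
apply: lerD.
  apply: le_trans (clin_le _ _) _; apply: ler_pM => //.
    exact: gubinelli_le dr _ _.
  exact: dr_X dr _ _ as_ st tb.
apply: le_trans (rem_apriori dr sab sv as_ st tb) _.
by rewrite expr2 mulrA; apply: ler_wpM2r => //; rewrite -/w; lra.
Qed.

(** On a short interval the distance of two solutions is governed by its value
    at an arbitrary point, in particular forwards and backwards in time. *)
Lemma local_lipschitz c t : a <= c -> c <= b -> a <= t -> t <= b ->
  `|Y1 t - Y2 t| <= 2 * `|Y1 c - Y2 c|.
Proof.
move=> ac cb at_ tb.
pose P (p : R) := a <= p /\ p <= b.
have S00 : 0 <= `|Y1 a - Y2 a| + (K ^+ 4 + K ^+ 4).
  by rewrite addr_ge0// addr_ge0// exprn_ge0.
have ab : a <= b by lra.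
rewrite -[leRHS]mulr1.
apply: (@absorb_half R _ P (fun t => `|Y1 t - Y2 t|) (fun=> 1) _ _ S00) => //.
- move=> {ac cb at_ tb}s [as_ sb]; rewrite mulr1.
  move: as_; rewrite le_eqVlt => /predU1P[<-|as_].
    by rewrite lerDl addr_ge0// exprn_ge0.
  have -> : Y1 s - Y2 s = (Y1 a - Y2 a) + ((Y1 s - Y1 a) - (Y2 s - Y2 a)).
    by abelian.
  apply: le_trans (ler_normD _ _) _; apply: lerD => //.
  have ssas : is_short a s by apply: (short_sub sab) => //; exact: ltW.
  have o1 : om (s - a) <= 1 by apply: short_om1 => //; exact: ltW.
  have K40 : 0 <= K ^+ 4 by rewrite exprn_ge0.
  apply: le_trans (ler_normB _ _) _; apply: lerD.
    by apply: le_trans (path_incr sv1 _ as_ sb) _ => //; rewrite ler_piMr.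
  by apply: le_trans (path_incr sv2 _ as_ sb) _ => //; rewrite ler_piMr.
move=> S S0 DS s [as_ sb]; rewrite mulr1.
have {}DS u : a <= u -> u <= b -> `|Y1 u - Y2 u| <= S.
  by move=> au ub; rewrite -[S]mulr1; apply: DS.
have half u v : a <= u -> u < v -> v <= b ->
    `|(Y1 v - Y2 v) - (Y1 u - Y2 u)| <= S / 2.
  move=> au uv vb; apply: le_trans (diff_incr S0 DS au uv vb) _.
  have suv : is_short u v by apply: (short_sub sab) => //; exact: ltW.
  have h := @short_pow u v 13 isT suv.
  by rewrite mulrAC mulrC ler_wpM2l.
have -> : Y1 s - Y2 s = (Y1 c - Y2 c) + ((Y1 s - Y2 s) - (Y1 c - Y2 c)) by abelian.
apply: le_trans (ler_normD _ _) _; apply: lerD => //.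
have [sc|cs|->] := ltgtP s c.
- by rewrite distrC; exact: half.
- exact: half.
- by rewrite subrr normr0 divr_ge0.
Qed.

Lemma local_incr s t : a <= s -> s < t -> t <= b ->
  `|(Y1 t - Y2 t) - (Y1 s - Y2 s)| <= K ^+ 14 * `|Y1 s - Y2 s| * om (t - s).
Proof.
move=> as_ st tb.
have S0 : 0 <= 2 * `|Y1 s - Y2 s| by rewrite mulr_ge0.
have sb : s <= b by lra.
have DS u : a <= u -> u <= b -> `|Y1 u - Y2 u| <= 2 * `|Y1 s - Y2 s|.
  by move=> au ub; exact: local_lipschitz.
apply: le_trans (diff_incr S0 DS as_ st tb) _.
apply: ler_wpM2r; first exact: om_ge0.
rewrite mulrA; apply: ler_wpM2r => //; rewrite [K ^+ 14]exprSr.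
by apply: ler_wpM2l => //; rewrite exprn_ge0.
Qed.

End TwoPaths.

(** One step of the Milstein scheme; it involves the value of [Y] at [s] only. *)
Definition milstein Y s t : W := germ Y s t + (t - s) *: F0 (Y s).

(** The rough part is the sewing error; the drift varies by [om (t - s)] along the
    interval, over a length at most [om (t - s) ^+ 2]. *)
Lemma milstein_error a b Y s t : driver_bounds a b -> is_short a b -> solves a b Y ->
  a <= s -> s < t -> t <= b ->
  `|Y t - Y s - milstein Y s t| <= K ^+ 32 * om (t - s) ^+ 3.
Proof.
move=> dr sab sv as_ st tb.
have sst : is_short s t by apply: (short_sub sab) => //; exact: ltW.
set w := om (t - s).
have w0 : 0 <= w by exact: om_ge0.
have w1 : w <= 1 by apply: short_om1 => //; exact: ltW.
have [I [J [lI lJ IJ]]] := sv_int sv as_ (ltW st) tb.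
have K90 : 0 <= K ^+ 9 by rewrite exprn_ge0.
have e1 := germ_sewing dr sab (rem_apriori dr sab sv) K90 as_ st tb lI.
have e2 : `|J - (t - s) *: F0 (Y s)| <= K * (K ^+ 4 * w) * w ^+ 2.
  apply: (@le_trans _ _ (K * (K ^+ 4 * w) * (t - s))).
    apply: (partition_limit_bound (ltW st) _ lJ) => u v su uv vt.
    rewrite /drift_germ -scalerBr normrZ gtr0_norm ?subr_gt0// mulrC.
    apply: ler_wpM2r; first by rewrite subr_ge0 ltW.
    apply: le_trans (vf_F0lip vf _ _) _; apply: ler_wpM2l => //.
    move: su; rewrite le_eqVlt => /predU1P[<-|su].
      by rewrite subrr normr0 mulr_ge0// exprn_ge0.
    apply: le_trans (path_incr dr sab sv as_ su _) _; first lra.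
    apply: ler_wpM2l; first exact: exprn_ge0.
    by apply: (om_le alpha13); lra.
  apply: ler_wpM2l; first by rewrite mulr_ge0// mulr_ge0// exprn_ge0.
  by apply: le_om_sqr => //; case: sst => ? _; lra.
have -> : Y t - Y s - milstein Y s t = (I - germ Y s t) + (J - (t - s) *: F0 (Y s)).
  by rewrite IJ /milstein; abelian.
apply: le_trans (ler_normD _ _) _; apply: le_trans (lerD e1 e2) _.
have h0 : 0 <= 3^-1 :> R by rewrite invr_ge0.
by rewrite -/w; mono K2 h0 w0 w1.
Qed.

End Estimates.

(** * Solutions on long intervals and the Milstein scheme *)

Section HolderBounds.
Context {R : realType}.

Lemma holder_norm_le (E : normedModType R) (beta : R) (G : R -> R -> E) (a b r : R) :
  (holder_norm beta G a b <= r%:E)%E ->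
  forall s t, a <= s -> s < t -> t <= b -> `|G s t| <= r * (t - s) `^ beta.
Proof.
move=> Gr s t as_ st tb.
rewrite -ler_pdivrMr ?powR_gt0 ?subr_gt0// -lee_fin; apply: le_trans Gr.
by apply: ereal_sup_ubound; exists s, t.
Qed.

Lemma holder_norm_lty (E : normedModType R) (beta : R) (G : R -> R -> E) (a b : R) :
  (holder_norm beta G a b < +oo)%E -> exists2 r, 0 <= r &
  forall s t, a <= s -> s < t -> t <= b -> `|G s t| <= r * (t - s) `^ beta.
Proof.
move=> Gfin; have [r r0 Gr] : exists2 r, 0 <= r & (holder_norm beta G a b <= r%:E)%E.
  move: Gfin; case: holder_norm => [x _||_];
    [|by rewrite ltxx|by exists 0 => //; rewrite leNye].
  by exists `|x| => //; rewrite lee_fin ler_norm.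
by exists r => //; exact: holder_norm_le.
Qed.

Lemma sup_norm_le (E : normedModType R) (f : R -> E) (a b r : R) :
  (sup_norm f a b <= r%:E)%E -> forall t, a <= t -> t <= b -> `|f t| <= r.
Proof.
move=> fr t at_ tb; rewrite -lee_fin; apply: le_trans fr.
by apply: ereal_sup_ubound; exists t => //=; rewrite in_itv/= at_.
Qed.

Lemma norms_driver_bounds (U V : normedModType R) (alpha K rho c a b : R)
    (X : R -> V) (XX : R -> R -> tensor2 V) (Z : R -> U) (Z' : R -> 'L(V, U)) :
  rough_path alpha X XX -> (rough_norm alpha X XX a b <= rho%:E)%E ->
  (controlled_norm alpha X Z Z' a b <= c%:E)%E ->
  rho <= K -> rho ^+ 2 <= K -> c <= K -> 0 <= rho ->
  driver_bounds alpha K X XX Z Z' a b.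
Proof.
move=> [chen _]; rewrite /rough_norm /controlled_norm !ge_max.
move=> /andP[Xrho XXrho] /andP[/andP[_ Z'c] /andP[Rc Z'ic]] rK r2K cK r0.
have e0 (d beta : R) : 0 <= d `^ beta by exact: powR_ge0.
split=> //.
- move=> s t as_ st tb; apply: le_trans (holder_norm_le Xrho as_ st tb) _.
  exact: ler_wpM2r.
- move=> s t as_ st tb.
  have XX2 : (holder_norm (2 * alpha) XX a b <= (rho ^+ 2)%:E)%E.
    move: XXrho; case E: holder_norm => [x||]; last by rewrite leNye.
      rewrite poweR_EFin !lee_fin => xr.
      have x0 : 0 <= x.
        rewrite -lee_fin -E; apply: (@le_trans _ _ (`|XX s t| / (t - s) `^ (2 * alpha))%:E).
          by rewrite lee_fin divr_ge0.
        by apply: ereal_sup_ubound; exists s, t.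
      have -> : x = (x `^ 2^-1) ^+ 2.
        by rewrite -powR_mulrn ?powR_ge0// -powRrM mulVf// powRr1.
      by rewrite ler_pXn2r ?nnegrE.
    by rewrite poweRyr ?leye_eq// gt_eqF// invr_gt0.
  apply: le_trans (holder_norm_le XX2 as_ st tb) _; rewrite om_sqr.
  exact: ler_wpM2r.
- move=> s t as_ st tb; apply: le_trans (holder_norm_le Rc as_ st tb) _.
  by rewrite om_sqr; exact: ler_wpM2r.
- move=> s t as_ st tb; apply: le_trans (holder_norm_le Z'ic as_ st tb) _.
  exact: ler_wpM2r.
- by move=> t at_ tb; apply: le_trans cK; exact: (sup_norm_le Z'c).
Qed.

End HolderBounds.

Section Solutions.
Context {R : realType} {U V W : normedModType R}.
Variables (alpha : R) (F : W -> 'L(U, W)) (F0 : W -> W).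
Variables (X : R -> V) (XX : R -> R -> tensor2 V) (Z : R -> U) (Z' : R -> 'L(V, U)).

Lemma partition_limit_point (G : R -> R -> W) (a : R) l : is_partition_limit G a a l -> l = 0.
Proof.
move=> lG; apply/eqP; rewrite -normr_le0.
have := @partition_limit_bound _ _ G a a l 0 0 (lexx _) _ lG.
by rewrite scaler0 subr0 mul0r; apply => u v u0 uv v0; lra.
Qed.

Lemma is_solution_start y Y Y' :
  is_solution alpha F F0 X XX Z Z' y Y Y' -> Y 0 = y.
Proof.
move=> [_ [/(_ 0)[I [J [+ + ->]]] _]].
rewrite /is_integral_from0 lexx => lI lJ.
by rewrite (partition_limit_point lI) (partition_limit_point lJ) !addr0.
Qed.

(** Integrals over subintervals are obtained as differences of integrals with
    one end at 0; the two sides of 0 are kept apart. *)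
Lemma is_solution_solves y Y Y' : is_solution alpha F F0 X XX Z Z' y Y Y' ->
  forall T, 0 < T -> solves alpha F F0 X XX Z Z' 0 T Y /\
                     solves alpha F F0 X XX Z Z' (- T) 0 Y.
Proof.
move=> [ctr [int YE]] T T0.
have Y'E : Y' = gubinelli F Z' Y by apply/funext.
have rem_fin a b : a < b -> exists2 r, 0 <= r & forall s t, a <= s -> s < t -> t <= b ->
    `|path_rem F X Z' Y s t| <= r * om alpha (t - s) ^+ 2.
  move=> ab; have := ctr _ _ ab; rewrite /controlled_norm !gt_max.
  move=> /andP[_ /andP[+ _]] => /holder_norm_lty[r r0 Hr]; exists r => // s t as_ st tb.
  by rewrite om_sqr /path_rem -Y'E; exact: Hr.
rewrite Y'E in int.
split; split; try by apply: rem_fin; lra.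
  move=> s t s0 st tT.
  have [I1 [J1 [+ + E1]]] := int s; have [I2 [J2 [+ + E2]]] := int t.
  rewrite /is_integral_from0 s0 (le_trans s0 st) => lI2 lJ2 lI1 lJ1.
  exists (I2 - I1), (J2 - J1); split.
  - exact: partition_limit_right lI1 lI2.
  - exact: partition_limit_right lJ1 lJ2.
  by rewrite E1 E2; abelian.
have int0 u : u <= 0 -> exists I J, [/\ is_partition_limit (germ F XX Z Z' Y) u 0 (- I),
    is_partition_limit (drift_germ F0 Y) u 0 (- J) & Y u = y + I + J].
  move=> u0; have [I [J]] := int u; rewrite /is_integral_from0.
  case: ifPn => [u0'|_]; last by exists I, J.
  have -> : u = 0 by apply/le_anti; rewrite u0 u0'.
  move=> [lI lJ E]; exists I, J.
  have I0 := partition_limit_point lI; have J0 := partition_limit_point lJ.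
  by rewrite E; split=> //; [move: lI|move: lJ]; rewrite ?I0 ?J0 oppr0.
move=> s t Ts st t0.
have [I1 [J1 [lI1 lJ1 E1]]] := int0 s (le_trans st t0).
have [I2 [J2 [lI2 lJ2 E2]]] := int0 t t0.
exists (- I1 - - I2), (- J1 - - J2); split.
- exact: partition_limit_left lI2 lI1.
- exact: partition_limit_left lJ2 lJ1.
by rewrite E1 E2; abelian.
Qed.

End Solutions.

Section Shift.
Context {R : realType} {U V W : normedModType R}.
Variables (alpha : R) (F : W -> 'L(U, W)) (F0 : W -> W).

Lemma driver_bounds_sub K (X : R -> V) XX (Z : R -> U) Z' a b a' b' :
  a <= a' -> b' <= b ->
  driver_bounds alpha K X XX Z Z' a b -> driver_bounds alpha K X XX Z Z' a' b'.
Proof.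
move=> aa bb [h1 h2 h3 h4 h5 h6].
by split=> // [s t sa st tb|s t sa st tb|s t sa st tb|s t sa st tb|t ta tb];
  [apply: h2|apply: h3|apply: h4|apply: h5|apply: h6] => //; lra.
Qed.

Lemma solves_sub (X : R -> V) XX (Z : R -> U) Z' a b a' b' (Y : R -> W) :
  a <= a' -> b' <= b ->
  solves alpha F F0 X XX Z Z' a b Y -> solves alpha F F0 X XX Z Z' a' b' Y.
Proof.
move=> aa bb [[r r0 h1] h2]; split.
  by exists r => // s t sa st tb; apply: h1 => //; lra.
by move=> s t sa st tb; apply: h2 => //; lra.
Qed.

Lemma solves_shift (X1 X2 : R -> V) XX1 XX2 (Z1 Z2 : R -> U) Z1' Z2' a b c (Y : R -> W) :
  (forall u v, a <= u -> u <= v -> v <= b ->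
    [/\ incr X1 u v = incr X2 (u + c) (v + c), XX1 u v = XX2 (u + c) (v + c),
        incr Z1 u v = incr Z2 (u + c) (v + c) & Z1' u = Z2' (u + c)]) ->
  solves alpha F F0 X2 XX2 Z2 Z2' (a + c) (b + c) Y ->
  solves alpha F F0 X1 XX1 Z1 Z1' a b (fun t => Y (t + c)).
Proof.
move=> sh [[r r0 h1] h2]; split.
  exists r => // s t sa st tb; have [E1 _ _ E4] := sh s t sa (ltW st) tb.
  have -> : t - s = (t + c) - (s + c) by lra.
  have := h1 (s + c) (t + c); rewrite !lerD2r ltrD2r => /(_ sa st tb).
  by rewrite /path_rem /remainder /gubinelli E1 E4.
move=> s t sa st tb.
have [I [J [lI lJ E]]] : exists I J, [/\
    is_partition_limit (germ F XX2 Z2 Z2' Y) (s + c) (t + c) I,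
    is_partition_limit (drift_germ F0 Y) (s + c) (t + c) J &
    Y (t + c) - Y (s + c) = I + J] by apply: h2; rewrite lerD2r.
exists I, J; split=> //.
  apply: partition_limit_shift lI => u v su uv vt.
  have [_ E2 E3 E4] := sh u v (le_trans sa su) (ltW uv) (le_trans vt tb).
  by rewrite /germ /rough_germ /gubinelli E2 E3 E4.
apply: partition_limit_shift lJ => u v su uv vt.
by rewrite /drift_germ; congr (_ *: _); lra.
Qed.

End Shift.

Section Global.
Context {R : realType} {U V W : normedModType R}.
Variables (alpha K : R) (F : W -> 'L(U, W)) (F0 : W -> W).
Variables (X : R -> V) (XX : R -> R -> tensor2 V) (Z : R -> U) (Z' : R -> 'L(V, U)).
Hypothesis (fdV : finite_dimensional V).
Hypotheses (alpha13 : 3^-1 < alpha) (alpha12 : alpha <= 2^-1).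
Hypothesis (K2 : 2 <= K).
Hypothesis (Ksew : (1 - sewing_ratio alpha)^-1 <= K).
Hypothesis (Klift : bilinear_bound (@lift2 R U V W) K).
Hypothesis (vf : vector_field_bounds F F0 K).
Local Notation solves := (solves alpha F F0 X XX Z Z').
Local Notation om := (om alpha).

Let K0 : 0 < K. Proof. by apply: lt_le_trans K2. Qed.
Let K1 : 1 <= K. Proof. by apply: le_trans K2; rewrite ler1n. Qed.

Definition step_size : R := K ^- 120.

Lemma step_size_gt0 : 0 < step_size.
Proof. by rewrite invr_gt0 exprn_gt0. Qed.

(** As [1 / 3 < alpha], the step [K ^- 120] is short enough for [om] of it to
    be at most [K ^- 40]. *)
Lemma step_size_short u v : u <= v -> v - u <= step_size -> is_short alpha K u v.
Proof.
move=> uv uvs.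
have k40 : 0 < K ^- 40 by rewrite invr_gt0 exprn_gt0.
have k401 : K ^- 40 <= 1 by rewrite invf_le1 ?exprn_gt0// exprn_ege1.
have uv0 : 0 <= v - u by rewrite subr_ge0.
have s3 : step_size = (K ^- 40) ^+ 3 by rewrite /step_size exprVn -exprM.
split; first by rewrite (le_trans uvs)// s3 exprn_ile1// ltW.
rewrite mulrC -ler_pdivlMr ?exprn_gt0// div1r.
apply: (le_trans (om_le alpha13 uv0 uvs)).
rewrite s3 /om -(powR_mulrn 3 (ltW k40)) -powRrM.
rewrite -[leRHS]powRr1 ?(ltW k40)//; apply: ger_powR; first by rewrite k40.
by rewrite mulrC -ler_pdivrMr// mul1r ltW.
Qed.

(** Each step of length [step_size] at most doubles the distance, in either
    direction of time. *)
Lemma global_lipschitz a b (Y1 Y2 : R -> W) (N : nat) s t :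
  driver_bounds alpha K X XX Z Z' a b -> solves a b Y1 -> solves a b Y2 ->
  a <= s -> s <= b -> a <= t -> t <= b -> `|t - s| <= N%:R * step_size ->
  `|Y1 t - Y2 t| <= 2 ^+ N * `|Y1 s - Y2 s|.
Proof.
move=> dr sv1 sv2 as_ sb; elim: N t => [|N IH] t at_ tb.
  rewrite mul0r normr_le0 subr_eq0 => /eqP ->; rewrite expr0 mul1r//.
move=> tsN.
have N0 : 0 < N.+1%:R :> R by rewrite ltr0n.
(* the point [m] leaves one step between [m] and [t], and [N] before *)
pose lam : R := N%:R / N.+1%:R.
pose m := s + lam * (t - s).
have lam0 : 0 <= lam by rewrite divr_ge0.
have lam1 : lam <= 1 by rewrite ler_pdivrMr// mul1r ler_nat.
have lamE : 1 - lam = N.+1%:R^-1.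
  by rewrite /lam -[X in X - _](divff (lt0r_neq0 N0)) -mulrBl -natrB// subSnn mul1r.
have am : a <= m by rewrite /m; nra.
have mb : m <= b by rewrite /m; nra.
have ms : `|m - s| <= N%:R * step_size.
  rewrite /m addrAC subrr add0r normrM ger0_norm// /lam mulrAC ler_pdivrMr//.
  by rewrite mulrAC -mulrA ler_wpM2l.
have tm : `|t - m| <= step_size.
  have -> : t - m = (1 - lam) * (t - s) by rewrite /m; ring.
  rewrite lamE normrM ger0_norm ?invr_ge0 ?(ltW N0)// mulrC ler_pdivrMr// mulrC.
  by [].
rewrite exprS -mulrA; apply: (@le_trans _ _ (2 * `|Y1 m - Y2 m|)); last first.
  by rewrite ler_wpM2l// IH.
have loc c d : a <= c -> d <= b -> c <= d -> d - c <= step_size ->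
    forall p q, c <= p -> p <= d -> c <= q -> q <= d ->
    `|Y1 q - Y2 q| <= 2 * `|Y1 p - Y2 p|.
  move=> ac db cd dc p q cp pd cq qd.
  apply: (local_lipschitz fdV alpha13 alpha12 K2 Ksew Klift vf (driver_bounds_sub ac db dr)
    (step_size_short cd dc) (solves_sub ac db sv1) (solves_sub ac db sv2) cp pd cq qd).
have [mt|tm'] := leP m t.
  by apply: (loc m t) => //; move: tm; rewrite ger0_norm ?subr_ge0.
by apply: (loc t m) => //; rewrite ?(ltW tm')//; move: tm; rewrite distrC gtr0_norm ?subr_gt0.
Qed.

(** Only steps shorter than [step_size] are considered: this is enough for the
    continuity in time. *)
Lemma global_incr a b (Y1 Y2 : R -> W) (N : nat) s t :
  driver_bounds alpha K X XX Z Z' a b -> solves a b Y1 -> solves a b Y2 ->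
  a <= s -> s < t -> t <= b -> t - s <= step_size -> b - a <= N%:R * step_size ->
  `|(Y1 t - Y2 t) - (Y1 s - Y2 s)| <=
  K ^+ 14 * (2 ^+ N * `|Y1 a - Y2 a|) * om (t - s).
Proof.
move=> dr sv1 sv2 as_ st tb tss baN; have sb : s <= b by lra.
apply: le_trans (local_incr fdV alpha13 alpha12 K2 Ksew Klift vf
  (driver_bounds_sub as_ tb dr) (step_size_short (ltW st) tss)
  (solves_sub as_ tb sv1) (solves_sub as_ tb sv2) (lexx _) st (lexx _)) _.
apply: ler_wpM2r; first exact: om_ge0.
apply: ler_wpM2l; first by rewrite exprn_ge0// ltW.
apply: (global_lipschitz dr sv1 sv2) => //; first lra.
by rewrite ger0_norm ?subr_ge0//; lra.
Qed.

Section Scheme.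
Variable (a b : R).
Hypothesis (dr : driver_bounds alpha K X XX Z Z' a b).

Definition milstein_map u v (y : W) : W := y + milstein F F0 XX Z Z' (fun=> y) u v.

Definition grid (j k : nat) : R := a + (b - a) / 2 ^+ j * k%:R.

Fixpoint scheme (j : nat) (y : W) (k : nat) : W :=
  if k is k'.+1 then milstein_map (grid j k') (grid j k'.+1) (scheme j y k') else y.

(** The exact solutions issued from the successive points of the scheme
    interpolate between the solution and the scheme; two consecutive ones
    differ by a local error transported by the flow, which is Lipschitz. Over
    [2 ^ j] steps the cubes [om h ^+ 3] sum to the power [j] of a ratio less
    than 1. *)
Lemma scheme_error (Y : R -> W) (N j : nat) : a < b ->
  (forall s y, a <= s -> s <= b -> exists2 P, solves s b P & P s = y) ->
  solves a b Y -> b - a <= N%:R * step_size -> (b - a) / 2 ^+ j <= step_size ->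
  `|Y b - scheme j (Y a) (2 ^ j)| <=
    2 ^+ N * (K ^+ 32 * (sewing_ratio alpha ^+ j * om (b - a) ^+ 3)).
Proof.
move=> ab flow sv baN hj; set h := (b - a) / 2 ^+ j.
have h0 : 0 < h by rewrite divr_gt0 ?subr_gt0// exprn_gt0.
have gridS k : grid j k.+1 = grid j k + h by rewrite /grid -/h -natr1; ring.
have gridb : grid j (2 ^ j) = b.
  by rewrite /grid natrX divfK ?expf_neq0 ?pnatr_eq0//; ring.
have grid_ge k : a <= grid j k by rewrite /grid lerDl mulr_ge0// ltW.
have grid_le k : (k <= 2 ^ j)%N -> grid j k <= b.
  move=> kj; rewrite -[leRHS]gridb /grid lerD2l; apply: ler_wpM2l; first exact: ltW.
  by rewrite ler_nat.
pose E := 2 ^+ N * (K ^+ 32 * om h ^+ 3).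
have [P [svP Pb PE]] : exists P, [/\ solves (grid j (2 ^ j)) b P,
    P (grid j (2 ^ j)) = scheme j (Y a) (2 ^ j) & `|Y b - P b| <= (2 ^ j)%:R * E].
  suff H k : (k <= 2 ^ j)%N -> exists P, [/\ solves (grid j k) b P,
      P (grid j k) = scheme j (Y a) k & `|Y b - P b| <= k%:R * E] by exact: H.
  elim: k => [_|k IH kj].
    exists Y; have -> : grid j 0 = a by rewrite /grid; ring.
    by rewrite /= subrr normr0 mul0r.
  have [P [svP Pk PE]] := IH (ltnW kj).
  have t1 := grid_ge k.+1; have t2 := grid_le _ kj; have t0 := grid_ge k.
  have t01 : grid j k < grid j k.+1 by rewrite gridS ltrDl.
  have hE : grid j k.+1 - grid j k = h by rewrite gridS addrAC subrr add0r.
  have [Q svQ Qk] := flow _ (scheme j (Y a) k.+1) t1 t2.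
  exists Q; split=> //.
  have -> : Y b - Q b = (Y b - P b) + (P b - Q b) by abelian.
  apply: le_trans (ler_normD _ _) _; rewrite -natr1 mulrDl mul1r; apply: lerD => //.
  have sbN : `|b - grid j k.+1| <= N%:R * step_size.
    by rewrite ger0_norm ?subr_ge0//; lra.
  have lipPQ : `|P b - Q b| <= 2 ^+ N * `|P (grid j k.+1) - Q (grid j k.+1)|.
    apply: (global_lipschitz (driver_bounds_sub t1 (lexx b) dr)
      (solves_sub (ltW t01) (lexx b) svP) svQ) => //.
  apply: le_trans lipPQ _; apply: ler_wpM2l; first by rewrite exprn_ge0.
  have drk := driver_bounds_sub t0 t2 dr.
  have sm : is_short alpha K (grid j k) (grid j k.+1).
    by apply: step_size_short; [exact: ltW|rewrite hE].
  have := milstein_error fdV alpha13 alpha12 K2 Ksew Klift vf drk sm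
    (solves_sub (lexx _) t2 svP) (lexx _) t01 (lexx _).
  rewrite hE; apply: le_trans.
  rewrite Qk /= /milstein_map -Pk; set M := milstein _ _ _ _ _ _ _ _.
  have -> : milstein F F0 XX Z Z' P (grid j k) (grid j k.+1) = M by [].
  rewrite le_eqVlt; apply/orP; left; apply/eqP; congr `|_|; abelian.
rewrite gridb in svP Pb.
rewrite -Pb; apply: le_trans PE _; rewrite /E mulrCA; apply: ler_wpM2l.
  by rewrite exprn_ge0.
rewrite mulrCA; apply: ler_wpM2l; first by rewrite exprn_ge0// ltW.
rewrite /h natrX; elim: j {hj h h0 gridS gridb grid_ge grid_le E P svP Pb} => [|j IH].
  by rewrite !expr0 !mul1r divr1.
have x0 : 0 < (b - a) / 2 ^+ j by rewrite divr_gt0 ?subr_gt0// exprn_gt0.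
have := om_halve alpha x0.
have -> : (b - a) / 2 ^+ j / 2 = (b - a) / 2 ^+ j.+1.
  by rewrite exprS invfM mulrA mulrAC.
set o := om ((b - a) / 2 ^+ j.+1); move=> hh; rewrite exprSr -mulrA.
have p0 : 0 <= 2 ^+ j :> R by rewrite exprn_ge0.
apply: le_trans (ler_wpM2l p0 hh) _.
rewrite mulrCA [in leRHS]exprS -[leRHS]mulrA; apply: ler_wpM2l => //.
by rewrite /sewing_ratio mulr_ge0// exprn_ge0// om_ge0.
Qed.

Lemma scheme_cvg (Y : R -> W) : a < b ->
  (forall s y, a <= s -> s <= b -> exists2 P, solves s b P & P s = y) ->
  solves a b Y -> scheme j (Y a) (2 ^ j) @[j --> \oo] --> Y b.
Proof.
move=> ab flow sv; apply/cvgrPdist_le => e e0.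
pose N := (Num.trunc ((b - a) / step_size)).+1.
have baN : b - a <= N%:R * step_size.
  rewrite -ler_pdivrMr ?step_size_gt0// ltW// truncnS_gt//.
pose C := 2 ^+ N * (K ^+ 32 * om (b - a) ^+ 3).
have q0 : 0 <= sewing_ratio alpha.
  by rewrite /sewing_ratio mulr_ge0// exprn_ge0// om_ge0.
(* used for the error and for the condition that the steps be short *)
have geo (q c eps : R) : 0 <= q -> q < 1 -> 0 < eps ->
    \forall j \near \oo, `|c| * q ^+ j <= eps.
  move=> q00 q1 eps0.
  have /cvgrPdist_le/(_ _ eps0) : (fun j : nat => c * q ^+ j) @ \oo --> c * 0.
    by apply: cvgMl_tmp; apply: cvg_expr; rewrite ger0_norm.
  apply: filterS => j; rewrite mulr0 sub0r normrN normrM (ger0_norm (exprn_ge0 _ _))//.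
have n1 := geo _ C e q0 (sewing_ratio_lt1 alpha13) e0.
have n2 := geo 2^-1 (b - a) step_size (ltac:(by rewrite invr_ge0))
  (ltac:(by rewrite invf_lt1// ltr1n)) step_size_gt0.
near=> j.
have hj : (b - a) / 2 ^+ j <= step_size.
  rewrite -exprVn -[b - a]ger0_norm ?subr_ge0 ?(ltW ab)//; near: j; exact: n2.
apply: le_trans (scheme_error ab flow sv baN hj) _.
have -> : 2 ^+ N * (K ^+ 32 * (sewing_ratio alpha ^+ j * om (b - a) ^+ 3)) =
  C * sewing_ratio alpha ^+ j by rewrite /C; ring.
apply: (@le_trans _ _ (`|C| * sewing_ratio alpha ^+ j)).
  by rewrite ler_wpM2r ?exprn_ge0// ler_norm.
near: j; exact: n1.
Unshelve. all: by end_near. Qed.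

End Scheme.
End Global.

(** * Borel maps into separable normed spaces *)

Section BorelMaps.
Context {R : realType} {d : measure_display} {Omega : measurableType d}.

Lemma borel_measurableP (E : normedModType R) (f : Omega -> E) :
  borel_measurable f <-> forall D, open D -> measurable (f @^-1` D).
Proof.
split=> [mf D oD|mf].
  rewrite -[f @^-1` D]setTI; apply: mf => //; exact: sub_sigma_algebra.
apply: (@measurability _ _ Omega (g_sigma_algebraType (@open E)) setT f (@open E)) => //.
move=> _ [D oD <-].
by rewrite setTI; exact: mf.
Qed.

Lemma borel_cst (E : normedModType R) (x : E) :
  borel_measurable (fun _ : Omega => x).
Proof. exact: measurable_cst. Qed.

Lemma borel_comp (E1 E2 : normedModType R) (g : E1 -> E2) (f : Omega -> E1) :
  continuous g -> borel_measurable f -> borel_measurable (g \o f).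
Proof.
move=> cg /borel_measurableP mf; apply/borel_measurableP => D oD.
rewrite comp_preimage; apply: mf; apply: open_comp => // x _; exact: cg.
Qed.

Lemma borel_ball (E : normedModType R) (f : Omega -> E) x (r : R) :
  borel_measurable f -> measurable [set w | `|x - f w| < r].
Proof.
move=> /borel_measurableP mf; apply: (mf [set y | `|x - y| < r]).
apply: (@open_comp _ R (fun y => `|x - y|) [set z | z < r]); last exact: open_lt.
move=> y _; apply: cvg_norm; apply: cvgB => //; exact: cvg_cst.
Qed.

(** In separable spaces an open set of the product is a countable union of
    products of balls. *)
Lemma borel_pair (E1 E2 : normedModType R) (f : Omega -> E1) (g : Omega -> E2) :
  separable E1 -> separable E2 -> borel_measurable f -> borel_measurable g ->
  borel_measurable (fun w => (f w, g w) : (E1 * E2)%type).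
Proof.
move=> [q Hq] [p Hp] mf mg; apply/borel_measurableP => D oD.
pose good k n m := forall x y, `|q n - x| < k.+1%:R^-1 -> `|p m - y| < k.+1%:R^-1 ->
  D (x, y).
have -> : (fun w => (f w, g w)) @^-1` D =
    \bigcup_k \bigcup_n \bigcup_(m in [set m | good k n m])
      ([set w | `|q n - f w| < k.+1%:R^-1] `&` [set w | `|p m - g w| < k.+1%:R^-1]).
  apply/seteqP; split=> w /=; last first.
    by move=> [k _ [n _ [m gd [h1 h2]]]]; exact: gd.
  move=> Ow; have : nbhs (f w, g w) D by exact: open_nbhs_nbhs.
  move=> [[A B] /= [/nbhs_normP[e1 e10 He1] /nbhs_normP[e2 e20 He2]] AB].
  pose e := Num.min e1 e2.
  have e0 : 0 < e by rewrite lt_min e10.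
  pose k := Num.trunc (2 / e).
  have ke : k.+1%:R^-1 < e / 2.
    by rewrite -[e / 2]invrK ltf_pV2 ?posrE ?invr_gt0 ?divr_gt0// invf_div truncnS_gt.
  have k0 : 0 < k.+1%:R^-1 :> R by rewrite invr_gt0.
  have [n Hn] := Hq (f w) _ k0; have [m Hm] := Hp (g w) _ k0.
  exists k => //; exists n => //; exists m; last first.
    by split=> /=; rewrite distrC.
  move=> x y qx py; apply: (AB (x, y)); split=> /=.
    apply: He1 => /=; rewrite (@lt_le_trans _ _ e)//; last by rewrite ge_min lexx.
    rewrite -[f w - x](subrKA (q n)) (le_lt_trans (ler_normD _ _))// [e]splitr.
    by rewrite ltrD// (lt_trans _ ke).
  apply: He2 => /=; rewrite (@lt_le_trans _ _ e)//; last by rewrite ge_min lexx orbT.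
  rewrite -[g w - y](subrKA (p m)) (le_lt_trans (ler_normD _ _))// [e]splitr.
  by rewrite ltrD// (lt_trans _ ke).
apply: bigcupT_measurable => k; apply: bigcupT_measurable => n.
apply: bigcup_measurable => m _.
by apply: measurableI; exact: borel_ball.
Qed.

(** Near a limit in an open set, the sequence eventually stays in the points
    that are well inside this open set. *)
Lemma borel_lim (E : normedModType R) (f : nat -> Omega -> E) (g : Omega -> E) :
  (forall n, borel_measurable (f n)) -> (forall w, f n w @[n --> \oo] --> g w) ->
  borel_measurable g.
Proof.
move=> mf fg; apply/borel_measurableP => D oD.
(* points whose distance to the complement exceeds [1 / (k + 1)] *)
pose In k := [set x | exists2 e : R, k.+1%:R^-1 < e &
  forall y, `|x - y| < e -> D y].
have oIn k : open (In k).
  rewrite openE => x [e]; rewrite /In; set c := k.+1%:R^-1 => ke He; apply/nbhs_normP.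
  exists ((e - c) / 2) => /=; first by rewrite divr_gt0// subr_gt0.
  move=> y /= xy; exists ((e + c) / 2); first by move: ke; clearbody c; lra.
  move=> z yz; apply: He; rewrite -[x - z](subrKA y) (le_lt_trans (ler_normD _ _))//.
  by move: xy yz; clearbody c; lra.
have -> : g @^-1` D = \bigcup_k \bigcup_N \bigcap_(n in [set n | (N <= n)%N])
    (f n @^-1` In k).
  apply/seteqP; split=> w /=.
    move=> Ow; have /nbhs_normP[e /= e0 He] : nbhs (g w) D by exact: open_nbhs_nbhs.
    pose k := Num.trunc (2 / e).
    have ke : k.+1%:R^-1 < e / 2.
      by rewrite -[e / 2]invrK ltf_pV2 ?posrE ?invr_gt0 ?divr_gt0// invf_div truncnS_gt.
    have e20 : 0 < e / 2 by rewrite divr_gt0.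
    have /cvgrPdist_lt/(_ _ e20)[N _ HN] := fg w.
    exists k => //; exists N => // n /= Nn; exists (e / 2) => // y fy.
    apply: He => /=; rewrite -[g w - y](subrKA (f n w)) (le_lt_trans (ler_normD _ _))//.
    by rewrite [e]splitr ltrD//; exact: HN.
  move=> [k _ [N _ HN]].
  have k0 : 0 < k.+1%:R^-1 :> R by rewrite invr_gt0.
  have /cvgrPdist_lt/(_ _ k0)[M _ HM] := fg w.
  have [e ke He] := HN (maxn N M) (leq_maxl _ _).
  by apply: He; rewrite distrC (lt_trans _ ke)//; apply: HM; exact: leq_maxr.
apply: bigcupT_measurable => k; apply: bigcupT_measurable => N.
apply: bigcap_measurable; first by exists N => /=.
by move=> n _; move/borel_measurableP: (mf n); apply.
Qed.

Lemma bilinear_continuous (A B C : normedModType R) (m : A -> B -> C) (c : R) :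
  bilinear_bound m c -> continuous (fun p : A * B => m p.1 p.2).
Proof.
move=> [c0 mBl mBr mle] [x y]; apply/cvgrPdist_le => e e0.
have h : (fun p : A * B => c * `|x - p.1| * `|p.2| + c * `|x| * `|y - p.2|) p
    @[p --> (x, y)] --> c * `|x - x| * `|y| + c * `|x| * `|y - y|.
  have c1 : p.1 @[p --> (x, y)] --> x by exact: cvg_fst.
  have c2 : p.2 @[p --> (x, y)] --> y by exact: cvg_snd.
  apply: cvgD; apply: cvgM.
  - apply: cvgMl_tmp; apply: cvg_norm; apply: cvgB => //; exact: cvg_cst.
  - exact: cvg_norm.
  - exact: cvg_cst.
  - apply: cvg_norm; apply: cvgB => //; exact: cvg_cst.
have /cvgrPdist_le/(_ _ e0) := h; apply: filterS => -[x' y'] /=.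
rewrite !subrr !normr0 !mulr0 mul0r addr0 sub0r normrN => h1.
have -> : m x y - m x' y' = m (x - x') y' + m x (y - y').
  by rewrite mBl mBr; abelian.
apply: le_trans (ler_normD _ _) _; apply: le_trans (lerD (mle _ _) (mle _ _)) _.
by apply: le_trans h1; rewrite ler_norm.
Qed.

Lemma borel_bilinear (A B C : normedModType R) (m : A -> B -> C) (c : R)
    (f : Omega -> A) (g : Omega -> B) :
  separable A -> separable B -> bilinear_bound m c ->
  borel_measurable f -> borel_measurable g -> borel_measurable (fun w => m (f w) (g w)).
Proof.
move=> sA sB mc mf mg.
exact: (borel_comp (bilinear_continuous mc) (borel_pair sA sB mf mg)).
Qed.

Lemma borel_add (E : normedModType R) (f g : Omega -> E) : separable E ->
  borel_measurable f -> borel_measurable g -> borel_measurable (fun w => f w + g w).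
Proof.
move=> sE mf mg.
exact: (borel_comp (fun p => @add_continuous E p) (borel_pair sE sE mf mg)).
Qed.

Lemma borel_scale (E : normedModType R) (a : R) (f : Omega -> E) :
  borel_measurable f -> borel_measurable (fun w => a *: f w).
Proof. by apply: (borel_comp (g := *:%R a)) => x; exact: cvgZl_tmp. Qed.

Lemma borel_sub (E : normedModType R) (f g : Omega -> E) : separable E ->
  borel_measurable f -> borel_measurable g -> borel_measurable (fun w => f w - g w).
Proof.
move=> sE mf mg; apply: borel_add => //.
by apply: (borel_comp (g := -%R)) mg => x; exact: opp_continuous.
Qed.

Lemma borel_norm_le (E1 E2 : normedModType R) (f : Omega -> E1) (g : Omega -> E2)
    (c : R) : separable E1 -> separable E2 ->
  borel_measurable f -> borel_measurable g -> measurable [set w | `|f w| <= c * `|g w|].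
Proof.
move=> s1 s2 mf mg.
pose h (p : E1 * E2) : R^o := `|p.1| - c * `|p.2|.
have ch : continuous h.
  move=> p; apply: cvgB; last apply: cvgMl_tmp; apply: cvg_norm;
    [exact: cvg_fst|exact: cvg_snd].
have /borel_measurableP/(_ [set x : R^o | 0 < x]) := borel_comp ch (borel_pair s1 s2 mf mg).
move=> /(_ (@open_gt R 0)).
move=> /measurableC; rewrite (_ : ~` _ = [set w | `|f w| <= c * `|g w|])//.
apply/seteqP; split=> w /=; rewrite /h /= subr_gt0.
  by move=> /negP; rewrite -leNgt.
by move=> fg; apply/negP; rewrite -leNgt.
Qed.

End BorelMaps.

(** * Derivatives of maps and of states *)

Section Derivatives.
Context {R : realType}.

Lemma is_diff_Dtot (A B : normedModType R) (f : A -> B) x :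
  differentiable f x -> is_diff x f (Dtot f x).
Proof. by move=> df; split=> //; rewrite DtotE. Qed.

Lemma Dtot_is_diff (A B : normedModType R) (f df : A -> B) x :
  is_diff x f df -> Dtot f x = df :> (A -> B).
Proof. by move=> [h <-]; exact: DtotE. Qed.

Lemma is_diff_clin (A B : normedModType R) (h : 'L(A, B)) x : is_diff x h h.
Proof.
have hc := @clin_continuous R A B h.
by split; [exact: linear_differentiable|exact: diff_lin].
Qed.

Lemma is_diff_slope (A B : normedModType R) (f df : A -> B) x v :
  is_diff x f df -> forall e : R, 0 < e -> exists2 r, 0 < r & forall u : R, `|u| < r ->
    `|f (x + u *: v) - f x - u *: df v| <= e * `|u|.
Proof.
move=> fx e e0; have [dfx _] := fx.
have dfx0 : differentiable f (x + 0 *: v) by rewrite scale0r addr0.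
have [r r0 Hr] := is_derive_slope (is_derive_line dfx0) e0.
exists r => // u ur; have := Hr u; rewrite subr0 scale0r addr0 => /(_ ur).
by rewrite (Dtot_is_diff fx).
Qed.

Lemma is_diff_lipschitz (A B : normedModType R) (f df : A -> B) x (L : R) :
  is_diff x f df -> (forall y, `|f y - f x| <= L * `|y - x|) ->
  forall v, `|df v| <= L * `|v|.
Proof.
move=> fx fL v; apply/ler_addgt0Pr => e e0.
have [r r0 Hr] := is_diff_slope v fx e0.
pose u := r / 2.
have u0 : 0 < u by rewrite divr_gt0.
have ur : `|u| < r by rewrite gtr0_norm// /u; lra.
have h1 := Hr u ur; have h2 := fL (x + u *: v).
have : `|u *: df v| <= (L * `|v| + e) * u.
  have -> : u *: df v = (f (x + u *: v) - f x) - (f (x + u *: v) - f x - u *: df v).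
    by abelian.
  apply: le_trans (ler_normB _ _) _; rewrite mulrDl; apply: lerD.
    apply: le_trans h2 _; rewrite (addrAC x) subrr add0r normrZ gtr0_norm//.
    by rewrite mulrCA mulrC.
  by apply: le_trans h1 _; rewrite gtr0_norm.
by rewrite normrZ gtr0_norm// mulrC ler_pM2r.
Qed.

Lemma is_diff_quotient (A B : normedModType R) (f df : A -> B) x v :
  is_diff x f df ->
  n.+1%:R *: (f (x + n.+1%:R^-1 *: v) - f x) @[n --> \oo] --> df v.
Proof.
move=> fx; apply/cvgrPdist_le => e e0.
have [r r0 Hr] := is_diff_slope v fx e0.
near=> n.
have n0 : 0 < n.+1%:R :> R by rewrite ltr0n.
have nr : `|n.+1%:R^-1 : R| < r.
  rewrite gtr0_norm ?invr_gt0// -[r]invrK ltf_pV2 ?posrE ?invr_gt0//.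
  rewrite (@lt_le_trans _ _ (Num.trunc r^-1).+1%:R)//; first exact: truncnS_gt.
  by rewrite ler_nat ltnS; near: n; exact: nbhs_infty_ge.
have := Hr _ nr; rewrite gtr0_norm ?invr_gt0// ler_pdivlMr// => h.
rewrite distrC.
have -> : n.+1%:R *: (f (x + n.+1%:R^-1 *: v) - f x) - df v =
    n.+1%:R *: (f (x + n.+1%:R^-1 *: v) - f x - n.+1%:R^-1 *: df v).
  by rewrite [RHS]scalerBr scalerA mulfV ?gt_eqF// scale1r.
by rewrite normrZ gtr0_norm// mulrC.
Unshelve. all: by end_near. Qed.

Lemma is_diff_cancel (A : normedModType R) (f g df dg : A -> A) x :
  is_diff x g dg -> is_diff (g x) f df -> cancel g f -> cancel dg df.
Proof.
move=> gx fx gK v.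
have [_ E] := is_diff_comp gx fx.
have idE : f \o g = id by apply/funext => y; exact: gK.
have [_ E'] := @is_diff_id R A x.
by have := congr1 (fun h => h v) E; rewrite idE E' => /= <-.
Qed.

Lemma precomp_subproof (U V W : normedModType R) (A : 'L(V, U)) :
  (fun B : 'L(U, W) => clin_comp B A) \in @clin_pred R 'L(U, W) 'L(V, W).
Proof.
apply: (@clin_pred_bounded _ _ _ _ `|A|).
  by move=> a B B'; apply: clinP.
by move=> B; have [_ _ _ /(_ B A)] := bilinear_bound_comp V U W; rewrite mul1r mulrC.
Qed.

Definition precomp (U V W : normedModType R) (A : 'L(V, U)) : 'L('L(U, W), 'L(V, W)) :=
  CLin (precomp_subproof W A).

(** A state depends on the initial one through its first component, and its
    second component is a function of the first: the chain rule gives both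
    components of the derivative. *)
Lemma state_diff (U V W : normedModType R) (phit : W -> W * 'L(V, W))
    (F : W -> 'L(U, W)) (A : 'L(V, U)) :
  (forall y, (phit y).2 = clin_comp (F (phit y).1) A) ->
  (forall y, differentiable F y) ->
  (forall p, differentiable (fun p : W * 'L(V, W) => phit p.1) p) ->
  (forall y, differentiable (fun y => (phit y).1) y) /\
  (forall p v, Dtot (fun p : W * 'L(V, W) => phit p.1) p v =
    let k := Dtot (fun y => (phit y).1) p.1 v.1 in
    (k, clin_comp (Dtot F (phit p.1).1 k) A)).
Proof.
move=> phi2 dF dphi.
have fst_lin : (fun p : W * 'L(V, W) => p.1) \in @clin_pred R (W * 'L(V, W))%type W.
  by apply: (@clin_pred_bounded _ _ _ _ 1) => // p; rewrite mul1r prod_normE le_max lexx.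
pose fstL : 'L((W * 'L(V, W))%type, W) := CLin fst_lin.
have df y : differentiable (fun y => (phit y).1) y.
  have d1 : is_diff y (fun y : W => (y, 0 : 'L(V, W))) (fun v : W => (v, 0 : 'L(V, W))).
    exact: is_diff_pair.
  have d2 := is_diff_comp d1 (is_diff_Dtot (dphi (y, 0))).
  have [] := is_diff_comp d2 (is_diff_clin fstL _).
  by [].
split=> // p v.
have d1 := is_diff_comp (is_diff_clin fstL p) (is_diff_Dtot (df p.1)).
have d2 := is_diff_comp d1 (is_diff_Dtot (dF _)).
have d3 := is_diff_comp d2 (is_diff_clin (precomp W A) _).
have d4 := is_diff_pair d1 d3.
have := Dtot_is_diff d4.
have -> : (fun p : W * 'L(V, W) => phit p.1) =
  (fun y => (((fun y => (phit y).1) \o fstL) y,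
     (precomp W A \o (F \o ((fun y => (phit y).1) \o fstL))) y)).
  by apply/funext => q /=; rewrite [LHS]surjective_pairing phi2.
by move=> ->.
Qed.

End Derivatives.

(** * Suprema over an interval of times *)

Section ContinuityOnInterval.
Context {R : realType}.
Variable (t0 : R).
Hypothesis (t0_gt0 : 0 < t0).

(** Neighbourhoods of [t] inside [[0, t0]]: solutions are only controlled
    there. *)
Definition near_interval (t : R) : set_system R := within `[0, t0] (nbhs t).

Definition continuous_on (E : normedModType R) (f : R -> E) : Prop :=
  forall t, 0 <= t -> t <= t0 -> f s @[s --> near_interval t] --> f t.

Lemma near_interval_proper t : 0 <= t -> t <= t0 -> ProperFilter (near_interval t).
Proof.
move=> h1 h2; apply: within_nbhs_proper.
by apply: subset_closure; rewrite /= in_itv/= h1.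
Qed.

Lemma holder_continuous_on (E : normedModType R) (alpha : R) (f : R -> E) (C r : R) :
  0 < alpha -> 0 < r ->
  (forall s t, 0 <= s -> s < t -> t <= t0 -> t - s <= r ->
     `|f t - f s| <= C * (t - s) `^ alpha) -> continuous_on f.
Proof.
move=> a0 r0 hf t h1 h2; apply/cvgrPdist_le => e e0.
pose D := `|C| + 1; have D0 : 0 < D by rewrite ltr_wpDl.
pose dl := Num.min r ((e / D) `^ alpha^-1).
have dl0 : 0 < dl by rewrite lt_min r0 powR_gt0// divr_gt0.
have key u v : 0 <= u -> u < v -> v <= t0 -> v - u < dl -> `|f v - f u| <= e.
  move=> u0 uv vt; rewrite lt_min => /andP[/ltW vur vue].
  apply: le_trans (hf u v u0 uv vt vur) _.
  apply: (@le_trans _ _ (D * (v - u) `^ alpha)).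
    by rewrite ler_wpM2r ?powR_ge0// /D (le_trans (ler_norm C))// lerDl.
  rewrite mulrC -ler_pdivlMr//.
  have -> : e / D = ((e / D) `^ alpha^-1) `^ alpha.
    by rewrite -powRrM mulVf ?gt_eqF// powRr1// divr_ge0// ltW.
  apply: ge0_ler_powR; rewrite ?nnegrE ?powR_ge0//; [exact: ltW| |exact: ltW].
  by rewrite subr_ge0 ltW.
rewrite near_withinE; apply/nbhs_normP; exists dl => // s /= ts.
rewrite in_itv/= => /andP[s0 st].
have [lts|lst|->] := ltgtP t s.
- by rewrite distrC; apply: key => //; rewrite -[X in X < _]gtr0_norm ?subr_gt0// distrC.
- by apply: key => //; rewrite -[X in X < _]gtr0_norm ?subr_gt0.
- by rewrite subrr normr0 ltW.
Qed.

Lemma continuous_on_comp (E1 E2 : normedModType R) (g : E1 -> E2) (f : R -> E1) :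
  continuous g -> continuous_on f -> continuous_on (g \o f).
Proof. by move=> cg cf t h1 h2; exact: (cvg_comp _ _ (cf t h1 h2) (cg (f t))). Qed.

Lemma continuous_on_pair (E1 E2 : normedModType R) (f : R -> E1) (g : R -> E2) :
  continuous_on f -> continuous_on g ->
  continuous_on (fun t => (f t, g t) : (E1 * E2)%type).
Proof.
move=> cf cg t h1 h2; have := near_interval_proper h1 h2 => pf.
by apply: cvg_pair; [exact: cf|exact: cg].
Qed.

(** Enumeration of the rational points of [[0, t0]]; other indices give 0. *)
Definition dense_time (n : nat) : R :=
  let q := oapp ratr 0 (unpickle n : option rat) in
  if (0 <= q) && (q <= t0) then q else 0.

Lemma dense_time_itv n : 0 <= dense_time n /\ dense_time n <= t0.
Proof.
rewrite /dense_time; case: ifPn => [/andP[]//|_]; split=> //; exact: ltW.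
Qed.

Lemma dense_time_near t (e : R) : 0 <= t -> t <= t0 -> 0 < e ->
  exists n, `|t - dense_time n| < e.
Proof.
move=> h1 h2 e0.
have lt : Num.max 0 (t - e) < Num.min t0 (t + e).
  rewrite gt_max !lt_min t0_gt0/=; apply/andP; split; first lra.
  by apply/andP; split; lra.
have [q] := rat_in_itvoo lt; rewrite in_itv/= gt_max lt_min.
move=> /andP[/andP[q1 q2] /andP[q3 q4]].
exists (pickle q); rewrite /dense_time pickleK /= (ltW q1) (ltW q3)/=.
by rewrite ltr_norml; apply/andP; split; lra.
Qed.

Lemma dense_time_le (E1 E2 : normedModType R) (f : R -> E1) (g : R -> E2) (c : R) :
  continuous_on f -> continuous_on g ->
  (forall n, `|f (dense_time n)| <= c * `|g (dense_time n)|) ->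
  forall t, 0 <= t -> t <= t0 -> `|f t| <= c * `|g t|.
Proof.
move=> cf cg fg t h1 h2; rewrite leNgt; apply/negP => lt.
have pf := near_interval_proper h1 h2.
pose h s := `|f s| - c * `|g s|.
have hc : h s @[s --> near_interval t] --> h t.
  apply: cvgB; first by apply: cvg_norm; exact: cf.
  by apply: cvgMl_tmp; apply: cvg_norm; exact: cg.
have h0 : 0 < h t by rewrite subr_gt0.
have /cvgrPdist_lt/(_ _ h0) := hc; rewrite near_withinE => /nbhs_normP[e /= e0 He].
have [n tn] := dense_time_near h1 h2 e0.
have [n1 n2] := dense_time_itv n.
have := He (dense_time n) tn; rewrite /= in_itv/= n1 n2 => /(_ isT).
rewrite ltr_norml => /andP[_]; rewrite ltrBlDr ltrDl.
by rewrite ltNge subr_le0 fg.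
Qed.

Lemma dense_point_le (W E1 E2 : normedModType R) (q : nat -> W) (f : W -> E1)
    (g : W -> E2) (c : R) :
  (forall x (e : R), 0 < e -> exists k, `|x - q k| < e) ->
  continuous f -> continuous g ->
  (forall n, `|f (q n)| <= c * `|g (q n)|) -> forall x, `|f x| <= c * `|g x|.
Proof.
move=> Hq cf cg fg x; rewrite leNgt; apply/negP => lt.
pose h s := `|f s| - c * `|g s|.
have hc : h s @[s --> x] --> h x.
  apply: cvgB; first by apply: cvg_norm; exact: cf.
  by apply: cvgMl_tmp; apply: cvg_norm; exact: cg.
have h0 : 0 < h x by rewrite subr_gt0.
have /cvgrPdist_lt/(_ _ h0) := hc; move=> /nbhs_normP[e /= e0 He].
have [n tn] := Hq x e e0.
have := He (q n) tn.
rewrite ltr_norml => /andP[_]; rewrite ltrBlDr ltrDl.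
by rewrite ltNge subr_le0 fg.
Qed.

End ContinuityOnInterval.

Section SupLog.
Context {R : realType} {d : measure_display} {Omega : measurableType d}.

Lemma logp_ge0 (x : R) : 0 <= logp x.
Proof. by rewrite /logp le_max lexx orbT. Qed.

Lemma logp_le (x c : R) : 0 <= c -> 0 <= x -> (logp x <= c) = (x <= expR c).
Proof.
move=> c0 x_ge0; have [xE|xn0] := eqVneq x 0.
  by rewrite xE /logp ln0// maxxx c0 expR_ge0.
have x0 : 0 < x by rewrite lt_def xn0.
by rewrite /logp ge_max c0 andbT -[in RHS](@lnK _ x) ?posrE// ler_expR.
Qed.

(** [logp] is nonnegative, so only thresholds [c >= 0] matter, for which [logp]
    behaves as an increasing bijection. *)
Lemma sup_logp_le (T : R -> R) (t0 c : R) : 0 <= c -> (forall t, 0 <= T t) ->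
  (ereal_sup [set (logp (T t))%:E | t in `[0%R, t0]] <= c%:E)%E <->
  (forall t, 0 <= t -> t <= t0 -> T t <= expR c).
Proof.
move=> c0 T0; split=> [Sc t h1 h2|Tc].
  rewrite -logp_le// -lee_fin; apply: le_trans Sc.
  by apply: ereal_sup_ubound; exists t => //=; rewrite in_itv/= h1.
apply: ge_ereal_sup => x [t /=]; rewrite in_itv/= => /andP[h1 h2] <-{x}.
by rewrite lee_fin logp_le// Tc.
Qed.

Lemma sup_logp_ge0 (T : R -> R) (t0 : R) : 0 <= t0 ->
  (0 <= ereal_sup [set (logp (T t))%:E | t in `[0%R, t0]])%E.
Proof.
move=> h; apply: (@le_trans _ _ (logp (T 0))%:E); first by rewrite lee_fin logp_ge0.
by apply: ereal_sup_ubound; exists 0 => //=; rewrite in_itv/= lexx.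
Qed.

Lemma measurable_sup_logp (T : R -> Omega -> R) (t0 : R) : 0 <= t0 ->
  (forall t w, 0 <= T t w) ->
  (forall c, 0 <= c ->
    measurable [set w | forall t, 0 <= t -> t <= t0 -> T t w <= expR c]) ->
  measurable_fun [set: Omega]
    (fun w => ereal_sup [set (logp (T t w))%:E | t in `[0%R, t0]]).
Proof.
move=> t00 T0 mT; apply: (measurability _ (ErealGenOInfty.measurableE R)).
move=> /= _ [_ [c ->]] <-; rewrite setTI preimage_itvoy.
have [c0|c0] := leP 0 c; last first.
  rewrite (_ : [set _ | _] = setT)//; apply/seteqP; split=> // w _ /=.
  by apply: lt_le_trans (sup_logp_ge0 _ t00); rewrite lte_fin.
rewrite (_ : [set _ | _] = ~` [set w | forall t, 0 <= t -> t <= t0 -> T t w <= expR c]).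
  exact: measurableC (mT _ c0).
apply/seteqP; split=> w /=.
  move=> lt /(sup_logp_le _ c0 (fun t => T0 t w)).2; rewrite leNgt; move=> /negP; apply.
  exact: lt.
move=> h; rewrite ltNge; apply/negP => le; apply: h.
exact: (sup_logp_le _ c0 (fun t => T0 t w)).1.
Qed.

End SupLog.

(** * The flow of the equation *)

Section Flow.
Context {R : realType} {d : measure_display} {Omega : measurableType d}.
Context {U V W : normedModType R}.
Variables (theta : R -> Omega -> Omega) (alpha : R).
Variables (X : Omega -> R -> V) (XX : Omega -> R -> R -> tensor2 V).
Variables (Z : Omega -> R -> U) (Z' : Omega -> R -> 'L(V, U)).
Variables (F : W -> 'L(U, W)) (F0 : W -> W).
Variable (phi : R -> Omega -> W -> W * 'L(V, W)).
Hypotheses (theta0 : forall w, theta 0 w = w)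
  (thetaD : forall s t w, theta (s + t) w = theta s (theta t w)).
Hypothesis (rpc : rough_path_cocycle alpha theta X XX).
Hypothesis (cc : controlled_cocycle alpha theta X Z Z').
Hypothesis (sol : is_solution_cocycle alpha F F0 X XX Z Z' phi).

Definition flow (r : R) (w : Omega) (y : W) : W := (phi r w y).1.

Lemma flow0 w y : flow 0 w y = y.
Proof. exact: is_solution_start (sol w y).1. Qed.

Lemma phi_second r w y : (phi r w y).2 = clin_comp (F (flow r w y)) (Z' w r).
Proof. by have [_ [_ ->]] := (sol w y).1. Qed.

(** The cocycle relations, stated for increments over nonnegative times, are
    used at the base points [u] and [u - c] and combined. *)
Lemma driver_shift c w u v : u <= v ->
  [/\ incr (X w) u v = incr (X (theta c w)) (u - c) (v - c),
      XX w u v = XX (theta c w) (u - c) (v - c),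
      incr (Z w) u v = incr (Z (theta c w)) (u - c) (v - c)
    & Z' w u = Z' (theta c w) (u - c)].
Proof.
move=> uv; have [_ _ _ hX] := rpc; have [_ _ _ hZ] := cc.
have t0 : 0 <= v - u by rewrite subr_ge0.
have thc : theta (u - c) (theta c w) = theta u w by rewrite -thetaD subrK.
have e1 : v = u + (v - u) by rewrite addrC subrK.
have e2 : v - c = (u - c) + (v - u) by lra.
have [hX1 hXX1] := hX w u _ t0; have [hX2 hXX2] := hX (theta c w) (u - c) _ t0.
have [hZ1 _] := hZ w u _ t0; have [hZ2 _] := hZ (theta c w) (u - c) _ t0.
have [_ hZ'1] := hZ w u _ (lexx 0); have [_ hZ'2] := hZ (theta c w) (u - c) _ (lexx 0).
rewrite thc in hX2 hXX2 hZ2 hZ'2; rewrite !addr0 in hZ'1 hZ'2.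
rewrite -e1 in hX1 hXX1 hZ1; rewrite -e2 in hX2 hXX2 hZ2.
by rewrite hX1 hX2 hXX1 hXX2 hZ1 hZ2 hZ'1 hZ'2.
Qed.

Local Notation solves w := (solves alpha F F0 (X w) (XX w) (Z w) (Z' w)).

(** The solution driven by the shifted noise, read on the original time scale,
    is a solution issued from time [c]. *)
Lemma solves_flow c w a b y : (c <= a \/ b <= c) ->
  solves w a b (fun r => flow (r - c) (theta c w) y).
Proof.
move=> cab; apply: (@solves_shift _ U V W alpha F F0 _ (X (theta c w)) _ (XX (theta c w)) _
  (Z (theta c w)) _ (Z' (theta c w)) a b (- c) (fun r => flow r (theta c w) y)).
  by move=> u v au uv vb; exact: driver_shift.
have T0 : 0 < 1 + `|a - c| + `|b - c| by rewrite -addrA ltr_pwDl// addr_ge0.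
have [sf sb] := is_solution_solves (sol (theta c w) y).1 T0.
have na := ler_norm (a - c); have nb := ler_norm (b - c).
have na' := ler_norm (- (a - c)); have nb' := ler_norm (- (b - c)).
rewrite !normrN in na' nb'.
have a0 := normr_ge0 (a - c); have b0 := normr_ge0 (b - c).
case: cab => h; [apply: solves_sub sf|apply: solves_sub sb]; lra.
Qed.

Lemma solves_flow0 w b y : solves w 0 b (fun r => flow r w y).
Proof.
have := @solves_flow 0 w 0 b y (or_introl (lexx 0)); rewrite theta0.
by rewrite (_ : (fun r => flow (r - 0) w y) = fun r => flow r w y)//;
  apply/funext => r; rewrite subr0.
Qed.

Hypothesis (fdV : finite_dimensional V).
Hypotheses (alpha13 : 3^-1 < alpha) (alpha12 : alpha <= 2^-1).
Variable (t0 : R).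
Hypotheses (dF : forall y, differentiable F y).
Hypothesis (C1 : forall t w, class_C1 (on_states phi t w)).

Lemma driver_Z'0 t w : Z' (theta t w) (- t) = Z' w 0.
Proof. by have [_ _ _ ->] := @driver_shift t w 0 0 (lexx 0); rewrite sub0r. Qed.

Definition dflow (r : R) (w' : Omega) (y : W) : 'L(W, W) := Dtot (flow r w') y.

Lemma flow_diff r w' y : is_diff y (flow r w') (dflow r w' y).
Proof.
apply: is_diff_Dtot.
exact: (state_diff (@phi_second r w') dF (C1 r w').1).1.
Qed.

Lemma state_derivativeE r w' p v : Dtot (on_states phi r w') p v =
  (dflow r w' p.1 v.1, clin_comp (Dtot F (flow r w' p.1) (dflow r w' p.1 v.1)) (Z' w' r)).
Proof. exact: (state_diff (@phi_second r w') dF (C1 r w').1).2. Qed.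

Section FixedPath.
Variables (K : R) (w : Omega).
Hypothesis (K2 : 2 <= K).
Hypothesis (Ksew : (1 - sewing_ratio alpha)^-1 <= K).
Hypothesis (Klift : bilinear_bound (@lift2 R U V W) K).
Hypothesis (vf : vector_field_bounds F F0 K).
Hypothesis (dr : driver_bounds alpha K (X w) (XX w) (Z w) (Z' w) 0 t0).
Variable (N : nat).
Hypothesis (NK : t0 <= N%:R * step_size K).

Let K0 : 0 <= K. Proof. exact: le_trans K2. Qed.

Let lip := @global_lipschitz R U V W alpha K F F0 (X w) (XX w) (Z w) (Z' w)
  fdV alpha13 alpha12 K2 Ksew Klift vf.

Let drt t : t <= t0 -> driver_bounds alpha K (X w) (XX w) (Z w) (Z' w) 0 t.
Proof. by move=> tt0; exact: driver_bounds_sub dr. Qed.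

Lemma flow_lipschitz t y1 y2 : 0 <= t -> t <= t0 ->
  `|flow t w y1 - flow t w y2| <= 2 ^+ N * `|y1 - y2|.
Proof.
move=> t_ge0 tt0.
have := @lip 0 t _ _ N 0 t (drt tt0) (@solves_flow0 w t y1) (@solves_flow0 w t y2).
rewrite !flow0; apply => //; rewrite subr0 ger0_norm//; exact: le_trans tt0 NK.
Qed.

Lemma flow_incr_lipschitz s t y1 y2 : 0 <= s -> s < t -> t <= t0 ->
  t - s <= step_size K ->
  `|(flow t w y1 - flow t w y2) - (flow s w y1 - flow s w y2)| <=
  K ^+ 14 * (2 ^+ N * `|y1 - y2|) * om alpha (t - s).
Proof.
move=> s0 st tt0 tsK.
have := @global_incr R U V W alpha K F F0 (X w) (XX w) (Z w) (Z' w)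
  fdV alpha13 alpha12 K2 Ksew Klift vf 0 t0 _ _ N s t dr
  (@solves_flow0 w t0 y1) (@solves_flow0 w t0 y2).
by rewrite !flow0 subr0; apply.
Qed.

Lemma inverse_flow_lipschitz t y1 y2 : 0 <= t -> t <= t0 ->
  `|flow (- t) (theta t w) y1 - flow (- t) (theta t w) y2| <= 2 ^+ N * `|y1 - y2|.
Proof.
move=> t_ge0 tt0.
have sv y := @solves_flow t w 0 t y (or_intror (lexx t)).
have := @lip 0 t _ _ N t 0 (drt tt0) (sv y1) (sv y2).
rewrite subrr !sub0r !flow0; apply => //; rewrite normrN ger0_norm//; exact: le_trans tt0 NK.
Qed.

(** Two solutions on [[0, t]] that agree at one time agree throughout. *)
Lemma flowK t : 0 <= t -> t <= t0 -> cancel (flow t w) (flow (- t) (theta t w)).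
Proof.
move=> t_ge0 tt0 y; apply/eqP; rewrite -subr_eq0 -normr_le0.
have sv z := @solves_flow t w 0 t z (or_intror (lexx t)).
have := @lip 0 t _ _ N t 0 (drt tt0) (sv (flow t w y)) (@solves_flow0 w t y).
rewrite subrr sub0r !flow0 subrr normr0 mulr0; apply => //.
rewrite normrN ger0_norm//; exact: le_trans tt0 NK.
Qed.

Lemma inverse_flowK t : 0 <= t -> t <= t0 -> cancel (flow (- t) (theta t w)) (flow t w).
Proof.
move=> t_ge0 tt0 z; apply/eqP; rewrite -subr_eq0 -normr_le0.
have sv := @solves_flow t w 0 t z (or_intror (lexx t)).
have := @lip 0 t _ _ N 0 t (drt tt0)
  (@solves_flow0 w t (flow (- t) (theta t w) z)) sv.
rewrite subrr sub0r !flow0 subrr normr0 mulr0; apply => //.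
rewrite subr0 ger0_norm//; exact: le_trans tt0 NK.
Qed.

Lemma scheme_flow_cvg t y : 0 < t -> t <= t0 ->
  scheme F F0 (XX w) (Z w) (Z' w) 0 t j y (2 ^ j) @[j --> \oo] --> flow t w y.
Proof.
move=> t_gt0 tt0.
have := @scheme_cvg R U V W alpha K F F0 (X w) (XX w) (Z w) (Z' w)
  fdV alpha13 alpha12 K2 Ksew Klift vf 0 t (drt tt0) (fun r => flow r w y) t_gt0.
rewrite flow0; apply; last exact: solves_flow0.
move=> s z s0 st; exists (fun r => flow (r - s) (theta s w) z).
  by apply: solves_flow; left.
by rewrite subrr flow0.
Qed.

Lemma dflow_bound t y v : 0 <= t -> t <= t0 -> `|dflow t w y v| <= 2 ^+ N * `|v|.
Proof.
move=> h1 h2; apply: (is_diff_lipschitz (flow_diff t w y)) => z.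
exact: flow_lipschitz.
Qed.

Lemma inverse_dflow_bound t y v : 0 <= t -> t <= t0 ->
  `|dflow (- t) (theta t w) y v| <= 2 ^+ N * `|v|.
Proof.
move=> h1 h2; apply: (is_diff_lipschitz (flow_diff _ _ y)) => z.
exact: inverse_flow_lipschitz.
Qed.

(** The Hoelder bound for the difference of two solutions is proportional to
    their distance at time 0; dividing by it, it passes to the derivative. *)
Lemma dflow_incr s t y v : 0 <= s -> s < t -> t <= t0 -> t - s <= step_size K ->
  `|dflow t w y v - dflow s w y v| <= K ^+ 14 * 2 ^+ N * om alpha (t - s) * `|v|.
Proof.
move=> h1 h2 h3 h4.
have := is_diff_lipschitz (is_diffB (flow_diff t w y) (flow_diff s w y)).
apply => z; rewrite !fctE.
have := @flow_incr_lipschitz s t z y h1 h2 h3 h4.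
have -> : flow t w z - flow s w z - (flow t w y - flow s w y) =
  flow t w z - flow t w y - (flow s w z - flow s w y) by abelian.
move=> /le_trans; apply.
by_ring.
Qed.

(** The flow and the backward flow are inverse to each other and both are
    differentiable, so their derivatives are inverse to each other. *)
Lemma dflowK t y : 0 <= t -> t <= t0 ->
  cancel (dflow t w y) (dflow (- t) (theta t w) (flow t w y)).
Proof.
move=> h1 h2; apply: (is_diff_cancel (flow_diff t w y) (flow_diff _ _ _)).
exact: flowK.
Qed.

Lemma inverse_dflowK t y : 0 <= t -> t <= t0 ->
  cancel (dflow (- t) (theta t w) (flow t w y)) (dflow t w y).
Proof.
move=> h1 h2.
have := is_diff_cancel (flow_diff (- t) (theta t w) (flow t w y)) (flow_diff t w _).
by rewrite flowK//; apply; exact: inverse_flowK.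
Qed.

Lemma flow_incr s t y : 0 <= s -> s < t -> t <= t0 -> t - s <= step_size K ->
  `|flow t w y - flow s w y| <= K ^+ 4 * om alpha (t - s).
Proof.
move=> s0 st tt0 tsK.
have sst : is_short alpha K s t by apply: step_size_short => //; exact: ltW.
apply: (path_incr fdV alpha13 alpha12 K2 Ksew Klift vf (driver_bounds_sub s0 tt0 dr) sst
  (solves_sub s0 (lexx t) (@solves_flow0 w t y)) (lexx _) st (lexx _)).
Qed.

End FixedPath.

Section Measurability.
Hypotheses (fdU : finite_dimensional U) (fdW : finite_dimensional W).
Hypothesis (t0_gt0 : 0 < t0).
Hypotheses (cDF : continuous (Dtot F)) (cF0 : continuous F0).

(** The constant [K] depends on [w] through the norms of the driver: this is
    what makes the bounds random. *)
Definition tame (w : Omega) (K : R) : Prop :=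
  [/\ 2 <= K, (1 - sewing_ratio alpha)^-1 <= K,
      bilinear_bound (@lift2 R U V W) K, vector_field_bounds F F0 K
    & driver_bounds alpha K (X w) (XX w) (Z w) (Z' w) 0 t0].

Hypothesis (tameP : forall w, exists K, tame w K).

(** The number of steps is polynomial in [K]: this is the exponent that ends up
    in the logarithm of the Lipschitz constants. *)
Lemma step_count (K : R) : 2 <= K -> exists N : nat,
  t0 <= N%:R * step_size K /\ N%:R <= t0 * K ^+ 120 + 1.
Proof.
move=> K2; have K0 : 0 < K by apply: lt_le_trans K2.
have K120 : 0 < K ^+ 120 by rewrite exprn_gt0.
exists (Num.trunc (t0 * K ^+ 120)).+1; split.
  by rewrite /step_size ler_pdivlMr// ltW// truncnS_gt.
rewrite -natr1 lerD2r truncn_le; apply: mulr_ge0; exact: ltW.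
Qed.

Let sU : separable U := finite_dimensional_separable fdU.
Let sW : separable W := finite_dimensional_separable fdW.
Let fdUW := finite_dimensional_clin fdU fdW.
Let fdVU := finite_dimensional_clin fdV fdU.
Let fdVW := finite_dimensional_clin fdV fdW.
Let fdWUW := finite_dimensional_clin fdW fdUW.
Let fdVUW := finite_dimensional_clin fdV fdUW.
Let fdT : finite_dimensional (tensor2 V) :=
  finite_dimensional_clin
    (finite_dimensional_clin fdV (finite_dimensional_clin fdV (@finite_dimensional_real R)))
    (@finite_dimensional_real R).
Let fdTW := finite_dimensional_clin fdT fdW.
Let sep := @finite_dimensional_separable R.

Let cF : continuous F.
Proof. by move=> y; exact: differentiable_continuous. Qed.

Lemma borel_Z u : borel_measurable (fun w => Z w u).
Proof. by have [h _ _ _] := cc; exact: h. Qed.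

Lemma borel_Z' u : borel_measurable (fun w => Z' w u).
Proof. by have [_ h _ _] := cc; exact: h. Qed.

Lemma borel_milstein (y0 : Omega -> W) u v : u <= v -> borel_measurable y0 ->
  borel_measurable (fun w => milstein_map F F0 (XX w) (Z w) (Z' w) u v (y0 w)).
Proof.
move=> uv my.
have mF : borel_measurable (fun w => F (y0 w)) by exact: borel_comp cF my.
have mDF : borel_measurable (fun w => Dtot F (y0 w)) by exact: borel_comp cDF my.
have mF0 : borel_measurable (fun w => F0 (y0 w)) by exact: borel_comp cF0 my.
have mZ : borel_measurable (fun w => incr (Z w) u v).
  by apply: borel_sub => //; exact: borel_Z.
have mXX : borel_measurable (fun w => XX w u v) by have [_ h _ _] := rpc; exact: h.
have m1 := borel_bilinear (sep fdUW) (sep fdVU) (bilinear_bound_comp _ _ _) mF (borel_Z' u).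
have m2 := borel_bilinear (sep fdWUW) (sep fdVW) (bilinear_bound_comp _ _ _) mDF m1.
have [k Hk] := bilinear_bound_lift2 fdV.
have m3 := borel_bilinear (sep fdVUW) (sep fdVU) (Hk U W) m2 (borel_Z' u).
have m4 := borel_bilinear (sep fdTW) (sep fdT) (bilinear_bound_app _ _) m3 mXX.
have m5 := borel_bilinear (sep fdUW) sU (bilinear_bound_app _ _) mF mZ.
have m6 := borel_add sW m5 m4.
have m7 := borel_add sW m6 (borel_scale (v - u) mF0).
exact: borel_add sW my m7.
Qed.

(** The starting point may depend on [w]: the scheme is measurable step by
    step, and it converges for each [w]. *)
Lemma borel_flow t (y0 : Omega -> W) : 0 <= t -> t <= t0 -> borel_measurable y0 ->
  borel_measurable (fun w => flow t w (y0 w)).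
Proof.
move=> t_ge0 tt0 my; move: (t_ge0); rewrite le_eqVlt => /predU1P[<-|t_gt0].
  by rewrite (_ : (fun w => _) = y0)//; apply/funext => w; exact: flow0.
apply: (@borel_lim _ _ _ _
    (fun j w => scheme F F0 (XX w) (Z w) (Z' w) 0 t j (y0 w) (2 ^ j))); last first.
  move=> w; have [K [K2 Ks Kl vf dr]] := tameP w.
  by have [N [NK _]] := step_count K2; apply: (scheme_flow_cvg K2 Ks Kl vf dr).
move=> j; elim: (2 ^ j)%N => [//|k IH] /=.
apply: borel_milstein => //.
rewrite /grid lerD2l; apply: ler_wpM2l; last by rewrite ler_nat.
by rewrite divr_ge0 ?exprn_ge0// subr0.
Qed.

Lemma borel_dflow t (y0 : Omega -> W) v : 0 <= t -> t <= t0 -> borel_measurable y0 ->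
  borel_measurable (fun w => dflow t w (y0 w) v).
Proof.
move=> h1 h2 my.
apply: (@borel_lim _ _ _ _ (fun n w =>
   n.+1%:R *: (flow t w (y0 w + n.+1%:R^-1 *: v) - flow t w (y0 w)))); last first.
  by move=> w; apply: is_diff_quotient; exact: flow_diff.
move=> n; apply: borel_scale; apply: borel_sub => //; apply: borel_flow => //.
by apply: borel_add => //; exact: borel_cst.
Qed.

Lemma dflow_continuous_on w y v : continuous_on t0 (fun t => dflow t w y v).
Proof.
have [K [K2 Ks Kl vf dr]] := tameP w; have [N [NK _]] := step_count K2.
have a0 : 0 < alpha by apply: lt_trans alpha13; rewrite invr_gt0.
apply: (holder_continuous_on (C := K ^+ 14 * 2 ^+ N * `|v|) a0 (step_size_gt0 K2)).
move=> s t h1 h2 h3 h4.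
rewrite (le_trans (dflow_incr K2 Ks Kl vf dr NK y v h1 h2 h3 h4))// mulrAC//.
Qed.

Lemma flow_continuous_on w y : continuous_on t0 (fun t => flow t w y).
Proof.
have [K [K2 Ks Kl vf dr]] := tameP w.
have a0 : 0 < alpha by apply: lt_trans alpha13; rewrite invr_gt0.
apply: (holder_continuous_on (C := K ^+ 4) a0 (step_size_gt0 K2)).
by move=> s t h1 h2 h3 h4; exact: (flow_incr K2 Ks Kl vf dr).
Qed.

Lemma Z'_continuous_on w : continuous_on t0 (Z' w).
Proof.
have [K [K2 Ks Kl vf dr]] := tameP w.
have a0 : 0 < alpha by apply: lt_trans alpha13; rewrite invr_gt0.
apply: (holder_continuous_on (C := K) a0 (step_size_gt0 K2)).
by move=> s t h1 h2 h3 _; exact: (dr_incr dr).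
Qed.

Definition second_dflow t w y v : 'L(V, W) :=
  clin_comp (Dtot F (flow t w y) (dflow t w y v)) (Z' w t).

Lemma second_dflow_continuous_on w y v : continuous_on t0 (fun t => second_dflow t w y v).
Proof.
have c1 := continuous_on_comp cDF (@flow_continuous_on w y).
have c2 := continuous_on_comp (bilinear_continuous (bilinear_bound_app W 'L(U, W)))
  (continuous_on_pair c1 (@dflow_continuous_on w y v)).
exact: (continuous_on_comp (bilinear_continuous (bilinear_bound_comp V U W))
  (continuous_on_pair c2 (@Z'_continuous_on w))).
Qed.

Lemma borel_second_dflow t (y0 : Omega -> W) v : 0 <= t -> t <= t0 ->
  borel_measurable y0 -> borel_measurable (fun w => second_dflow t w (y0 w) v).
Proof.
move=> h1 h2 my.
have m1 : borel_measurable (fun w => Dtot F (flow t w (y0 w))).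
  by apply: (borel_comp cDF); exact: borel_flow.
have m2 := borel_bilinear (sep fdWUW) sW (bilinear_bound_app _ _) m1 (borel_dflow v h1 h2 my).
exact: (borel_bilinear (sep fdUW) (sep fdVU) (bilinear_bound_comp _ _ _) m2 (borel_Z' t)).
Qed.

Lemma state_norm_le (D : 'L(W * 'L(V, W), W * 'L(V, W))) (k : W -> W)
    (g : W -> 'L(V, W)) (c : R) : 0 <= c -> (forall v, D v = (k v.1, g v.1)) ->
  `|D| <= c <-> forall v, `|k v| <= c * `|v| /\ `|g v| <= c * `|v|.
Proof.
move=> c0 DE; split=> [Dc v|kg].
  have := le_trans (clin_le D (v, 0)) (ler_wpM2r (normr_ge0 _) Dc).
  rewrite DE !prod_normE /= normr0 [Num.max `|v| 0]max_l// ge_max.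
  by move=> /andP.
apply: clin_norm_le => // v; rewrite DE prod_normE /= ge_max.
have [h1 h2] := kg v.1.
have le : `|v.1| <= `|v| by rewrite [leRHS]prod_normE le_max lexx.
by rewrite (le_trans h1) ?(le_trans h2)// ler_wpM2l.
Qed.

Variable (Y : Omega -> W * 'L(V, W)).
Hypothesis (mY : borel_measurable Y).

Let y0 w : W := (Y w).1.

Let my0 : borel_measurable y0.
Proof.
by apply: (borel_comp (g := fun p : W * 'L(V, W) => p.1)) mY => p; exact: cvg_fst.
Qed.

Lemma psi_le t w c : 0 <= c -> `|psi phi Y t w| <= c <->
  forall v, `|dflow t w (y0 w) v| <= c * `|v| /\ `|second_dflow t w (y0 w) v| <= c * `|v|.
Proof. by move=> c0; apply: state_norm_le => // v; exact: state_derivativeE. Qed.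

Definition start_dflow w (u : W) : 'L(V, W) := clin_comp (Dtot F (y0 w) u) (Z' w 0).

(** The vectors at which the inverse is evaluated are written as images under
    the derivative of the flow, so that the condition involves the forward
    flow and the unshifted noise. *)
Lemma psi_inv_le t w c : 0 <= t -> t <= t0 -> 0 <= c -> `|psi_inv theta phi Y t w| <= c <->
  forall u, `|u| <= c * `|dflow t w (y0 w) u| /\
    `|start_dflow w u| <= c * `|dflow t w (y0 w) u|.
Proof.
move=> h1 h2 c0.
have [K [K2 Ks Kl vf dr]] := tameP w; have [N [NK _]] := step_count K2.
have DK := dflowK K2 Ks Kl vf dr NK (y0 w) h1 h2.
have DVK := inverse_dflowK K2 Ks Kl vf dr NK (y0 w) h1 h2.
have fK := flowK K2 Ks Kl vf dr NK h1 h2 (y0 w).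
pose k := dflow (- t) (theta t w) (flow t w (y0 w)).
have := @state_norm_le (psi_inv theta phi Y t w) k (start_dflow w \o k) c c0.
move=> -> => [|v]; last first.
  by rewrite /psi_inv state_derivativeE fK driver_Z'0.
split=> [h u|h v].
  by have := h (dflow t w (y0 w) u); rewrite /= /k DK.
by have := h (k v); rewrite /= /k DVK.
Qed.

Lemma borel_start_dflow u : borel_measurable (fun w => start_dflow w u).
Proof.
have m1 : borel_measurable (fun w => Dtot F (y0 w)) by exact: borel_comp cDF my0.
have m2 := borel_bilinear (sep fdWUW) sW (bilinear_bound_app _ _) m1 (borel_cst u).
exact: (borel_bilinear (sep fdUW) (sep fdVU) (bilinear_bound_comp _ _ _) m2 (borel_Z' 0)).
Qed.

Let continuous_clin_second (B : 'L(W, 'L(U, W))) (k : 'L(W, W)) (A : 'L(V, U)) :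
  continuous (fun v => clin_comp (B (k v)) A).
Proof. exact: (clin_continuous (f := clin_comp (precomp W A) (clin_comp B k))). Qed.

(** Both sides of the inequality are continuous in the vector and in time. *)
Lemma measurable_psi c : 0 <= c ->
  measurable [set w | forall t, 0 <= t -> t <= t0 -> `|psi phi Y t w| <= expR c].
Proof.
move=> c0; have [q Hq] := sW; set e := expR c; have e0 : 0 <= e by exact: expR_ge0.
rewrite (_ : [set w | _] = \bigcap_n \bigcap_m
    ([set w | `|dflow (dense_time t0 n) w (y0 w) (q m)| <= e * `|q m|] `&`
     [set w | `|second_dflow (dense_time t0 n) w (y0 w) (q m)| <= e * `|q m|])).
  apply: bigcap_measurable => [|n _]; first by exists 0%N.
  apply: bigcap_measurable => [|m _]; first by exists 0%N.
  have [n1 n2] := dense_time_itv t0_gt0 n.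
  apply: measurableI; apply: borel_norm_le; try exact: borel_cst; try exact: sW.
  - exact: borel_dflow.
  - exact: sep.
  - exact: borel_second_dflow.
apply/seteqP; split=> w /=.
  move=> h n _ m _; have [n1 n2] := dense_time_itv t0_gt0 n.
  by have [h1 h2] := (psi_le _ w e0).1 (h _ n1 n2) (q m).
move=> h t h1 h2; apply/(psi_le t w e0) => v.
have cst_on (x : W) : continuous_on t0 (fun=> x) by move=> ? ? ?; exact: cvg_cst.
split.
  apply: (dense_point_le Hq (f := fun v => dflow t w (y0 w) v) (g := id)) => [x|x|m].
  - exact: clin_continuous.
  - exact: cvg_id.
  apply: (dense_time_le t0_gt0 (@dflow_continuous_on w (y0 w) (q m)) (cst_on (q m))) => // n.
  by have [] := h n I m I.
apply: (dense_point_le Hq (f := fun v => second_dflow t w (y0 w) v) (g := id)) => [x|x|m].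
- exact: continuous_clin_second.
- exact: cvg_id.
apply: (dense_time_le t0_gt0 (@second_dflow_continuous_on w (y0 w) (q m))
  (cst_on (q m))) => // n.
by have [] := h n I m I.
Qed.

Lemma measurable_psi_inv c : 0 <= c ->
  measurable [set w | forall t, 0 <= t -> t <= t0 -> `|psi_inv theta phi Y t w| <= expR c].
Proof.
move=> c0; have [q Hq] := sW; set e := expR c; have e0 : 0 <= e by exact: expR_ge0.
rewrite (_ : [set w | _] = \bigcap_n \bigcap_m
    ([set w | `|q m| <= e * `|dflow (dense_time t0 n) w (y0 w) (q m)|] `&`
     [set w | `|start_dflow w (q m)| <= e * `|dflow (dense_time t0 n) w (y0 w) (q m)|])).
  apply: bigcap_measurable => [|n _]; first by exists 0%N.
  apply: bigcap_measurable => [|m _]; first by exists 0%N.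
  have [n1 n2] := dense_time_itv t0_gt0 n.
  apply: measurableI; apply: borel_norm_le; try exact: borel_cst; try exact: sW;
    try exact: borel_dflow.
  - exact: sep.
  - exact: borel_start_dflow.
apply/seteqP; split=> w /=.
  move=> h n _ m _; have [n1 n2] := dense_time_itv t0_gt0 n.
  by have [h1 h2] := (psi_inv_le w n1 n2 e0).1 (h _ n1 n2) (q m).
move=> h t h1 h2; apply/(psi_inv_le w h1 h2 e0) => u.
have cst_on (E : normedModType R) (x : E) : continuous_on t0 (fun=> x).
  by move=> ? ? ?; exact: cvg_cst.
split.
  apply: (dense_point_le Hq (f := id) (g := fun v => dflow t w (y0 w) v)) => [x|x|m].
  - exact: cvg_id.
  - exact: clin_continuous.
  apply: (dense_time_le t0_gt0 (cst_on _ (q m)) (@dflow_continuous_on w (y0 w) (q m))) => // n.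
  by have [] := h n I m I.
apply: (dense_point_le Hq (f := start_dflow w) (g := fun v => dflow t w (y0 w) v)) => [x|x|m].
- exact: (clin_continuous (f := clin_comp (precomp W (Z' w 0)) (Dtot F (y0 w)))).
- exact: clin_continuous.
apply: (dense_time_le t0_gt0 (cst_on _ (start_dflow w (q m)))
  (@dflow_continuous_on w (y0 w) (q m))) => // n.
by have [] := h n I m I.
Qed.

Lemma measurable_M_lin : measurable_fun [set: Omega] (M_lin theta phi Y t0).
Proof.
apply: emeasurable_funD; apply: measurable_sup_logp => //; try exact: ltW.
  exact: measurable_psi.
exact: measurable_psi_inv.
Qed.

(** Both Lipschitz constants are [2 ^+ N], and the second component of a state
    costs a factor [K ^+ 2]. *)
Lemma M_lin_bound w K : tame w K ->
  (0 <= M_lin theta phi Y t0 w /\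
   M_lin theta phi Y t0 w <= ((2 * (2 + t0 + 1)) * K ^+ 120)%:E)%E.
Proof.
move=> [K2 Ks Kl vf dr]; have [N [NK NK']] := step_count K2.
have K0 : 0 <= K by exact: le_trans K2.
have K1 : 1 <= K by apply: le_trans K2; rewrite ler1n.
split; first by apply: adde_ge0; apply: sup_logp_ge0; exact: ltW.
(* [expR K >= K] and [expR 1 >= 2] *)
pose c := 2 * K + N%:R.
have c0 : 0 <= c by rewrite addr_ge0// mulr_ge0.
have ec : 2 ^+ N * K ^+ 2 <= expR c.
  rewrite /c expRD mulrC; apply: ler_pM; rewrite ?exprn_ge0//.
    have -> : expR (2 * K) = expR K ^+ 2 by rewrite expr2 -expRD; congr expR; ring.
    rewrite ler_pXn2r ?nnegrE ?expR_ge0//.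
    by apply: le_trans (expR_ge1Dx K); rewrite lerDr.
  have -> : expR N%:R = expR 1 ^+ N :> R by rewrite -expRM_natl mulr1.
  apply: lerXn2r; rewrite ?nnegrE ?expR_ge0//.
  by have := expR_ge1Dx (1 : R).
have NKK : 2 ^+ N <= 2 ^+ N * K ^+ 2.
  by rewrite ler_peMr ?exprn_ge0// exprn_ege1.
have e0 : 0 <= 2 ^+ N * K ^+ 2 by rewrite mulr_ge0 ?exprn_ge0.
have second (B : 'L(W, 'L(U, W))) (A : 'L(V, U)) (u : W) r :
    `|B| <= K -> `|A| <= K -> `|u| <= 2 ^+ N * r -> `|clin_comp (B u) A| <= 2 ^+ N * K ^+ 2 * r.
  move=> BK AK ur; have [_ _ _ /(_ (B u) A)] := bilinear_bound_comp V U W.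
  rewrite mul1r => /le_trans; apply.
  have h : `|B u| <= K * (2 ^+ N * r).
    by apply: le_trans (clin_le _ _) _; exact: ler_pM.
  apply: le_trans (ler_pM _ _ h AK) _ => //.
  by_ring.
have M1 : (ereal_sup [set (logp `|psi phi Y t w|)%:E | t in `[0%R, t0]] <= c%:E)%E.
  apply/sup_logp_le => // t h1 h2; apply: le_trans ec; apply/psi_le => // v.
  have dv := dflow_bound K2 Ks Kl vf dr NK (y0 w) v h1 h2.
  split; first by apply: le_trans dv _; exact: ler_wpM2r.
  apply: second => //; [exact: vf_DF vf _|exact: (dr_Z' dr)].
have M2 : (ereal_sup [set (logp `|psi_inv theta phi Y t w|)%:E | t in `[0%R, t0]] <= c%:E)%E.
  apply/sup_logp_le => // t h1 h2; apply: le_trans ec; apply/psi_inv_le => // u.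
  have du := inverse_dflow_bound K2 Ks Kl vf dr NK (flow t w (y0 w)) (dflow t w (y0 w) u) h1 h2.
  rewrite (dflowK K2 Ks Kl vf dr NK (y0 w) h1 h2) in du.
  split; first by apply: le_trans du _; exact: ler_wpM2r.
  apply: second => //; [exact: vf_DF vf _|apply: (dr_Z' dr) => //; exact: ltW].
apply: le_trans (leeD M1 M2) _; rewrite -EFinD lee_fin.
have K120 : K <= K ^+ 120 by rewrite -[leLHS]expr1 ler_weXn2l.
have K1201 : 1 <= K ^+ 120 by rewrite exprn_ege1.
rewrite /c; nra.
Qed.

End Measurability.
End Flow.

(** * Moments and the integrability of the supremum *)

Section Moments.
Context {R : realType} {d : measure_display} {Omega : measurableType d}.
Variable (P : probability Omega R).

Definition all_moments (h : Omega -> R) : Prop :=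
  [/\ forall w, 0 <= h w, measurable_fun [set: Omega] h
    & forall n, P.-integrable [set: Omega] (fun w => (h w ^+ n)%:E)].

Lemma all_moments_cst c : 0 <= c -> all_moments (fun=> c).
Proof.
move=> c0; split=> //.
by move=> n; exact: finite_measure_integrable_cst.
Qed.

Lemma all_moments_sqr h : all_moments h -> all_moments (fun w => h w ^+ 2).
Proof.
move=> [h0 mh ih]; split=> [w||n].
- by rewrite exprn_ge0.
- exact: measurable_funX.
by under eq_fun do rewrite -exprM; exact: ih.
Qed.

Lemma expr_add_le (x y : R) n : 0 <= x -> 0 <= y ->
  (x + y) ^+ n <= 2 ^+ n * (x ^+ n + y ^+ n).
Proof.
wlog xy : x y / x <= y => [H|x0 y0].
  have [xy|/ltW yx] := leP x y; first exact: H.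
  by move=> x0 y0; rewrite addrC [x ^+ n + _]addrC; exact: H.
apply: (@le_trans _ _ ((2 * y) ^+ n)).
  by apply: lerXn2r; rewrite ?nnegrE ?addr_ge0 ?mulr_ge0//; lra.
by rewrite exprMn ler_wpM2l ?exprn_ge0// lerDr exprn_ge0.
Qed.

(** By [(g + h) ^+ n <= 2 ^+ n * (g ^+ n + h ^+ n)]. *)
Lemma all_momentsD g h : all_moments g -> all_moments h ->
  all_moments (fun w => g w + h w).
Proof.
move=> [g0 mg ig] [h0 mh ih]; split=> [w||n].
- exact: addr_ge0.
- exact: measurable_funD.
have i2 := integrableZl measurableT (2 ^+ n) (integrableD measurableT (ig n) (ih n)).
apply: le_integrable i2 => //.
  by apply/measurable_EFinP; apply: measurable_funX; exact: measurable_funD.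
move=> w _; rewrite [X in (_ <= `|X|)%E](_ : _ = (2 ^+ n * (g w ^+ n + h w ^+ n))%:E)//.
rewrite !abse_EFin lee_fin.
rewrite ger0_norm ?exprn_ge0 ?addr_ge0// ger0_norm; first exact: expr_add_le.
by rewrite mulr_ge0 ?addr_ge0 ?exprn_ge0.
Qed.

Lemma in_all_Lp_moments (f : Omega -> \bar R) : in_all_Lp P f ->
  (forall w, 0 <= f w)%E -> (forall w, f w < +oo)%E ->
  all_moments (fun w => fine (f w)) /\ forall w, f w = (fine (f w))%:E.
Proof.
move=> [mf Lf] f0 foo.
have fE w : f w = (fine (f w))%:E by rewrite fineK// ge0_fin_numE.
have fine0 w : 0 <= fine (f w) by exact: fine_ge0.
have mfine : measurable_fun [set: Omega] (fun w => fine (f w)).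
  by apply/measurable_EFinP; rewrite (_ : _ \o _ = f)//; apply/funext => w /=; rewrite -fE.
split=> //; split=> // -[|n].
  by under eq_fun do rewrite expr0; exact: finite_measure_integrable_cst.
apply/integrableP; split.
  by apply/measurable_EFinP; exact: measurable_funX.
have n0 : (n.+1%:R : R) != 0 by rewrite pnatr_eq0.
have n1 : 1 <= n.+1%:R :> R by rewrite ler1n.
have := Lf _ n1; move=> /(poweR_lty n.+1%:R); rewrite powR_Lnorm//.
apply: le_lt_trans; rewrite le_eqVlt; apply/orP; left; apply/eqP.
apply: eq_integral => w _.
have -> : (`|f w| `^ n.+1%:R)%E = (fine (f w) ^+ n.+1)%:E.
  by rewrite gee0_abs// {1}fE poweR_EFin powR_mulrn.
by rewrite gee0_abs// lee_fin exprn_ge0.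
Qed.

End Moments.

Lemma bilinear_bound_le (R : realType) (A B C : normedModType R) (m : A -> B -> C) (c c' : R) :
  c <= c' -> bilinear_bound m c -> bilinear_bound m c'.
Proof.
move=> cc [c0 mBl mBr mle]; split=> //; first exact: le_trans cc.
by move=> a b; apply: le_trans (mle a b) _; rewrite !ler_wpM2r.
Qed.

Theorem corollary4p7 (R : realType) (d : measure_display)
    (Omega : measurableType d) (P : probability Omega R)
    (theta : R -> Omega -> Omega)
    (U V W : completeNormedModType R) (alpha t0 : R)
    (X : Omega -> R -> V) (XX : Omega -> R -> R -> tensor2 V)
    (Z : Omega -> R -> U) (Z' : Omega -> R -> 'L(V, U))
    (F : W -> 'L(U, W)) (F0 : W -> W)
    (phi : R -> Omega -> W -> W * 'L(V, W))
    (Y : Omega -> W * 'L(V, W)) :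
  finite_dimensional U -> finite_dimensional V -> finite_dimensional W ->
  3^-1 < alpha -> alpha <= 2^-1 ->
  measure_preserving_flow P theta ->
  rough_path_cocycle alpha theta X XX ->
  controlled_cocycle alpha theta X Z Z' ->
  0 < t0 ->
  class_Cb 3 F ->
  class_Cb 1 F0 ->
  is_solution_cocycle alpha F F0 X XX Z Z' phi ->
  (forall t w, class_C1 (on_states phi t w)) ->
  is_stationary_point theta phi Y ->
  in_all_Lp P (fun w => rough_norm alpha (X w) (XX w) 0 t0) ->
  in_all_Lp P (fun w => controlled_norm alpha (X w) (Z w) (Z' w) 0 t0) ->
  in_all_Lp P (fun w => `|Y w|%:E) ->
  P.-integrable [set: Omega] (M_lin theta phi Y t0).
Proof.
move=> fdU fdV fdW alpha13 alpha12 [_ theta0 thetaD _] rpc cc t0_gt0 CbF CbF0 sol C1.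
move=> [mY _ _] LX LZ _.
have dF : forall y, differentiable F y by case: CbF => _ [].
have cDF : continuous (Dtot F).
  by case: CbF => _ [_ [_ [dDF _]]] y; exact: differentiable_continuous.
have cF0 : continuous F0.
  by case: CbF0 => _ [dF0 _] y; exact: differentiable_continuous.
pose rho w := fine (rough_norm alpha (X w) (XX w) 0 t0).
pose c w := fine (controlled_norm alpha (X w) (Z w) (Z' w) 0 t0).
have [mrho rhoE] : all_moments P rho /\
    forall w, rough_norm alpha (X w) (XX w) 0 t0 = (rho w)%:E.
  apply: in_all_Lp_moments => // w; last first.
    by have [_ _ /(_ w)[_ h] _] := rpc; exact: h.
  by rewrite /rough_norm le_max poweR_ge0 orbT.
have [mc cE] : all_moments P c /\
    forall w, controlled_norm alpha (X w) (Z w) (Z' w) 0 t0 = (c w)%:E.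
  apply: in_all_Lp_moments => // w; last first.
    by have [_ _ /(_ w) h _] := cc; exact: h.
  rewrite /controlled_norm !le_max; apply/orP; left; apply/orP; left.
  apply: (@le_trans _ _ (`|Z w 0|%:E)); first by rewrite lee_fin.
  by apply: ereal_sup_ubound; exists 0 => //=; rewrite in_itv/= lexx ltW.
have [K1 vfK] := class_Cb_bounds CbF CbF0.
have [k liftk] := bilinear_bound_lift2 fdV.
pose K0 := 2 + `|K1| + `|(1 - sewing_ratio alpha)^-1| + `|k|.
have K00 : 0 <= K0 by rewrite !addr_ge0.
pose K w := K0 + rho w + rho w ^+ 2 + c w.
have mK : all_moments P K.
  apply: all_momentsD => //; apply: all_momentsD; last exact: all_moments_sqr.
  by apply: all_momentsD => //; exact: all_moments_cst.
have tameK w : tame alpha X XX Z Z' F F0 t0 w (K w).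
  have rho0 : 0 <= rho w by case: mrho.
  have c0 : 0 <= c w by case: mc.
  have rho20 : 0 <= rho w ^+ 2 by rewrite exprn_ge0.
  have n1 := normr_ge0 K1; have n2 := normr_ge0 (1 - sewing_ratio alpha)^-1.
  have n3 := normr_ge0 k.
  have l1 := ler_norm K1; have l2 := ler_norm (1 - sewing_ratio alpha)^-1.
  have l3 := ler_norm k.
  split.
  - by rewrite /K /K0; lra.
  - by rewrite /K /K0; lra.
  - by apply: bilinear_bound_le (liftk U W); rewrite /K /K0; lra.
  - by apply: vfK; rewrite /K /K0; lra.
  have [_ _ rp _] := rpc.
  apply: (@norms_driver_bounds _ _ _ _ _ (rho w) (c w)) => //.
  - by rewrite rhoE.
  - by rewrite cE.
  - by rewrite /K /K0; lra.
  - by rewrite /K /K0; lra.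
  - by rewrite /K /K0; lra.
have tameP w : exists K, tame alpha X XX Z Z' F F0 t0 w K by exists (K w).
have [_ _ iK] := mK.
have iCK := integrableZl measurableT (2 * (2 + t0 + 1)) (iK 120%N).
apply: le_integrable iCK => //.
  exact: (measurable_M_lin theta0 thetaD rpc cc sol fdV alpha13 alpha12 dF C1 fdU fdW
    t0_gt0 cDF cF0 tameP mY).
move=> w _.
have [M0 MK] := M_lin_bound theta0 thetaD rpc cc sol fdV alpha13 alpha12 dF C1
  t0_gt0 tameP Y (tameK w).
rewrite gee0_abs// (le_trans MK)// -EFinM; exact: lee_abs.
Qed.
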